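(* Let $p$ be a prime, $0<\epsilon<1$, $t\ge0$ an integer and $k$ a positive integer. For each $n$, let $1\le\alpha_n^{(k)}<\alpha_n^{(k-1)}<\cdots<\alpha_n^{(1)}\le n$ and $n+t\ge\beta_n^{(k)}>\beta_n^{(k-1)}>\cdots>\beta_n^{(1)}\ge1$ be integers, and let $M$ be an $\epsilon$-balanced random $n\times(n+t)$ matrix over $\mathbb{Z}_p$ having $k$-step stairs of zeros with respect to $\alpha_n^{(i)}$ and $\beta_n^{(i)}$. Suppose that for every $1\le i\le k$, $\lim_{n\to\infty}(n-\alpha_n^{(i)}-\beta_n^{(i)})=\infty$. Then for every finite abelian $p$-group $G$, $$\lim_{n\to\infty}\mathbb{P}(\mathrm{cok}(M)\cong G)=\frac{1}{|\mathrm{Aut}(G)|\,|G|^t}\prod_{i=1}^\infty(1-p^{-i-t}).$$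
   Context: A random variable $\xi$ in $\mathbb{Z}_p$ is $\epsilon$-balanced if for every $r\in\mathbb{Z}/p\mathbb{Z}$, $\mathbb{P}(\xi\equiv r\pmod p)\le1-\epsilon$. A random $n\times(n+t)$ matrix $M$ is an $\epsilon$-balanced random matrix having $k$-step stairs of zeros with respect to $\alpha_n^{(i)}$ and $\beta_n^{(i)}$ if $M_{i,j}=0$ whenever there is $1\le l\le k$ with $1\le i\le\alpha_n^{(l)}$ and $1\le j\le\beta_n^{(l)}$, and all other entries are independent $\epsilon$-balanced random variables. *)

(* Defs.v *)
From HB Require Import structures.
From mathcomp Require Import all_boot all_order all_algebra all_fingroup all_solvable.
From mathcomp Require Import all_classical all_reals all_analysis.
Import Order.TTheory GRing.Theory Num.Theory.
Import numFieldNormedType.Exports.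

Set Implicit Arguments.
Unset Strict Implicit.
Unset Printing Implicit Defensive.

Local Open Scope classical_set_scope.
Local Open Scope ring_scope.

(** The ring of [p]-adic integers, as the inverse limit of the rings
    Z/p^(m+1)Z for m >= 0.  The exponent is shifted by one because ['Z_(p ^ 0)]
    would be Z/2Z in MathComp instead of the trivial ring. *)
Record padic (p : nat) := Padic {
  residue : forall m : nat, 'Z_(p ^ m.+1) ;
  residue_compat : forall m, (residue m.+1 : nat)%:R = residue m
}.

HB.instance Definition _ (p : nat) := gen_eqMixin (padic p).
HB.instance Definition _ (p : nat) := gen_choiceMixin (padic p).

Lemma padic_eqP (p : nat) (x y : padic p) :
  (forall m, residue x m = residue y m) -> x = y.
Proof.
case: x y => x xP [y yP] /= xy.
have {xy}exy : x = y by apply: functional_extensionality_dep.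
by case: _ / exy in yP *; congr Padic; exact: Prop_irrelevance.
Qed.

Section PadicRing.
Variable p : nat.

Let dvd_modulus m :
  ((Zp_trunc (p ^ m.+1)).+2 %| (Zp_trunc (p ^ m.+2)).+2)%N.
Proof.
case: p => [|[|q]]; first by rewrite !exp0n.
  by rewrite !exp1n.
have gt1 e : (1 < q.+2 ^ e.+1)%N by rewrite -(exp1n e.+1) ltn_exp2r.
by rewrite !Zp_cast // dvdn_exp2l.
Qed.

Let red m (a : 'Z_(p ^ m.+2)) : 'Z_(p ^ m.+1) := (a : nat)%:R.

Let redE m (k : nat) : red (inZp k : 'Z_(p ^ m.+2)) = inZp k.
Proof. by rewrite /red Zp_nat; apply: val_inj => /=; rewrite modn_dvdm. Qed.

Let redD m : {morph @red m : a b / a + b}.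
Proof. by move=> a b; rewrite -natrD !Zp_nat -redE. Qed.

Let redM m : {morph @red m : a b / a * b}.
Proof. by move=> a b; rewrite -natrM !Zp_nat -redE. Qed.

Let red0 m : @red m 0 = 0.
Proof. by []. Qed.

Let red1 m : @red m 1 = 1.
Proof. by []. Qed.

Let redN m : {morph @red m : a / - a}.
Proof. by move=> a; apply/eqP; rewrite -addr_eq0 -redD addNr red0. Qed.

Definition padic_zero : padic p :=
  @Padic p (fun=> 0) (fun m => red0 m).

Definition padic_one : padic p :=
  @Padic p (fun=> 1) (fun m => red1 m).

Lemma padic_opp_compat (x : padic p) m :
  (nat_of_ord (- residue x m.+1)%R)%:R = - residue x m.
Proof. by rewrite -(residue_compat x m); exact: redN. Qed.

Definition padic_opp (x : padic p) : padic p :=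
  @Padic p (fun m => - residue x m) (padic_opp_compat x).

Lemma padic_add_compat (x y : padic p) m :
  (nat_of_ord (residue x m.+1 + residue y m.+1)%R)%:R
    = residue x m + residue y m.
Proof. by rewrite -(residue_compat x m) -(residue_compat y m); exact: redD. Qed.

Definition padic_add (x y : padic p) : padic p :=
  @Padic p (fun m => residue x m + residue y m) (padic_add_compat x y).

Lemma padic_mul_compat (x y : padic p) m :
  (nat_of_ord (residue x m.+1 * residue y m.+1)%R)%:R
    = residue x m * residue y m.
Proof. by rewrite -(residue_compat x m) -(residue_compat y m); exact: redM. Qed.

Definition padic_mul (x y : padic p) : padic p :=
  @Padic p (fun m => residue x m * residue y m) (padic_mul_compat x y).

Lemma padic_addA : associative padic_add.
Proof. by move=> x y z; apply: padic_eqP => m /=; rewrite addrA. Qed.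

Lemma padic_addC : commutative padic_add.
Proof. by move=> x y; apply: padic_eqP => m /=; rewrite addrC. Qed.

Lemma padic_add0 : left_id padic_zero padic_add.
Proof. by move=> x; apply: padic_eqP => m /=; rewrite add0r. Qed.

Lemma padic_addN : left_inverse padic_zero padic_opp padic_add.
Proof. by move=> x; apply: padic_eqP => m /=; rewrite addNr. Qed.

HB.instance Definition _ := GRing.isZmodule.Build (padic p)
  padic_addA padic_addC padic_add0 padic_addN.

Lemma padic_mulA : associative padic_mul.
Proof. by move=> x y z; apply: padic_eqP => m /=; rewrite mulrA. Qed.

Lemma padic_mulC : commutative padic_mul.
Proof. by move=> x y; apply: padic_eqP => m /=; rewrite mulrC. Qed.

Lemma padic_mul1 : left_id padic_one padic_mul.
Proof. by move=> x; apply: padic_eqP => m /=; rewrite mul1r. Qed.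

Lemma padic_mulD : left_distributive padic_mul padic_add.
Proof. by move=> x y z; apply: padic_eqP => m /=; rewrite mulrDl. Qed.

Lemma padic_one_neq0 : padic_one != 0.
Proof.
by apply/eqP => /(congr1 (fun x => residue x 0)) /= /eqP; rewrite oner_eq0.
Qed.

HB.instance Definition _ := GRing.Zmodule_isComNzRing.Build (padic p)
  padic_mulA padic_mulC padic_mul1 padic_mulD padic_one_neq0.

End PadicRing.

HB.instance Definition _ (p : nat) := isPointed.Build (padic p) 0.

(** The residue classes modulo powers of [p] form a countable basis of the
    [p]-adic topology, so they generate the Borel sigma-algebra. *)
Definition residue_classes (p : nat) : set (set (padic p)) :=
  [set A | exists (m : nat) (r : 'Z_(p ^ m.+1)), A = [set x | residue x m = r]].

HB.instance Definition _ (p : nat) :=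
  Measurable.copy (padic p) (g_sigma_algebraType (@residue_classes p)).

Section Cokernel.
Variables (R : comNzRingType) (n m : nat) (M : 'M[R]_(n, m)).

Definition colspan : {pred 'cV[R]_n} :=
  fun y => `[< exists x : 'cV[R]_m, y = M *m x >].

Lemma colspan_zmod_closed : zmod_closed colspan.
Proof.
split; first by apply/asboolP; exists 0; rewrite mulmx0.
move=> _ _ /asboolP[x ->] /asboolP[y ->].
by apply/asboolP; exists (x - y); rewrite mulmxBr.
Qed.

HB.instance Definition _ := GRing.isZmodClosed.Build _ colspan colspan_zmod_closed.

Definition cok := Quotient.quot colspan.

HB.instance Definition _ := GRing.Zmodule.on cok.

(** Group isomorphism between the additive group of [cok] and the (multiplicatively
    written) finite group [G]. *)
Definition cok_isog (gT : finGroupType) (G : {group gT}) : Prop :=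
  exists2 f : cok -> gT,
    {morph f : x y / x + y >-> (x * y)%g} & set_bij [set: cok] [set` G] f.

End Cokernel.

Section RandomMatrices.
Context {d : measure_display} {T : measurableType d} {R : realType}.
Variable P : probability T R.

Definition mutually_independent {d' : measure_display} {T' : measurableType d'}
    (I : finType) (D : {pred I}) (X : I -> {RV P >-> T'}) : Prop :=
  forall (J : {set I}) (A : I -> set T'),
    J \subset D -> (forall i, measurable (A i)) ->
    P (\bigcap_(i in [set` J]) (X i @^-1` A i))
      = (\prod_(i in J) P (X i @^-1` A i))%E.

Variable p : nat.

(** [residue x 0] is the class of [x] modulo [p ^ 1], that is modulo [p]. *)
Definition balanced (eps : R) (xi : {RV P >-> padic p}) : Prop :=
  forall r : 'Z_p, (P [set w | residue (xi w) 0 = r :> 'Z_p] <= (1 - eps)%:E)%E.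

(** Rows and columns are numbered from 0 in ['I_n] and ['I_m], whereas the steps
    are numbered from 1 to [k]. *)
Definition in_stairs (k : nat) (alpha beta : nat -> nat) (i j : nat) : bool :=
  has (fun l => (i < alpha l)%N && (j < beta l)%N) (iota 1 k).

Definition balanced_with_stairs (n m : nat) (eps : R) (k : nat)
    (alpha beta : nat -> nat) (M : 'I_n -> 'I_m -> {RV P >-> padic p}) : Prop :=
  [/\ forall (i : 'I_n) (j : 'I_m), in_stairs k alpha beta i j -> forall w, M i j w = 0,
      forall (i : 'I_n) (j : 'I_m), ~~ in_stairs k alpha beta i j -> balanced eps (M i j)
    & mutually_independent
        (fun ij : 'I_n * 'I_m => ~~ in_stairs k alpha beta ij.1 ij.2)
        (fun ij => M ij.1 ij.2)].

End RandomMatrices.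

Definition stair_steps (k n m : nat) (alpha beta : nat -> nat) : Prop :=
  [/\ (1 <= alpha k)%N,
      forall i, (1 <= i < k)%N -> (alpha i.+1 < alpha i)%N
    & (alpha 1 <= n)%N] /\
  [/\ (1 <= beta 1)%N,
      forall i, (1 <= i < k)%N -> (beta i < beta i.+1)%N
    & (beta k <= m)%N].

Definition euler_product (R : realType) (p t : nat) : R :=
  limn (fun m : nat => \prod_(1 <= i < m.+1) (1 - (p%:R : R) ^- (i + t))).

(** The limit above is a genuine one. *)
Lemma is_cvg_euler_product (R : realType) (p t : nat) : prime p ->
  cvgn (fun m : nat => \prod_(1 <= i < m.+1) (1 - (p%:R : R) ^- (i + t))).
Proof.
move=> /prime_gt1 p1.
have p1R : (1 : R) <= p%:R by rewrite ler1n ltnW.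
have f0 i : (0 : R) <= 1 - p%:R ^- (i + t).
  by rewrite subr_ge0 invf_le1 ?exprn_gt0 ?exprn_ege1 // (lt_le_trans ltr01).
have g0 m : (0 : R) <= \prod_(1 <= i < m.+1) (1 - p%:R ^- (i + t)).
  by apply: prodr_ge0 => i _.
apply: nonincreasing_is_cvgn.
  apply/nonincreasing_seqP => m.
  by rewrite [leLHS]big_nat_recr //= ler_piMr.
by exists 0 => _ [m _ <-].
Qed.

(* Main.v *)
(** Choose [m] with [p ^ m G = 0] and embed [G] as a subgroup [K] of a free module
    over Z/p^(m+1).  Then [cok M] is isomorphic to [G] exactly when some matrix
    [phi] over Z/p^(m+1) has image [K] and kernel the column span [L] of [M], in
    which case there are [#|Aut G|] such [phi]; so it suffices to find the limit
    of their expected number.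

    Suppose [phi] has image [K] and kills [M], and let [N] be its kernel.  By
    Nakayama's lemma [N = L] if and only if [Y = #|N / (L + p N)|] equals 1.  As
    [Y] is a power of [p], the indicator of [Y = 1] lies between consecutive
    partial sums of [\sum_s c_s \prod_(i < s) (Y - p ^ i)], where
    [c_s = \prod_(1 <= i <= s) (1 - p ^ i)^-1].  Up to the factor [#|G| ^ s], the
    product counts the extensions of [phi] by [s] rows to a matrix [F] that kills
    [M] and whose image has order [#|G| p ^ s].  Its expectation is thus a sum of
    probabilities of [F M = 0], and by an identity of Euler the resulting
    alternating series has the infinite product as its sum.

    It remains to see that, summed over all [F] with a given image [H], the
    probabilities of [F M = 0] differ from [#|H| ^- (n + t)] by [o(1)] in total.
    They factor over the columns of [M], and Fourier analysis bounds each factor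
    by [#|U|^-1 \sum_u th ^ w(u)], where [u] runs through the group [U] of
    characters, [th < 1], and [w(u)] counts the random entries of the column that
    are multiplied by a column of [F] on which [u] is nontrivial.  Group the rows
    by the steps that they meet.  As the gaps tend to infinity, all but a few
    columns can be matched injectively with rows in such a way that a column is
    random on the whole group of its row and on the large group of rows that meet
    no step.  The product of the bounds is thereby dominated by a product over the
    groups, which are independent when [F] is uniform on the matrices with columns
    in [H]. *)

Require Import Defs.
From HB Require Import structures.
From mathcomp Require Import all_boot all_order all_algebra all_fingroup all_solvable.
From mathcomp Require Import separable cyclotomic.
From mathcomp Require Import all_classical all_reals all_analysis.
From mathcomp.real_closed Require Import complex.
From mathcomp Require Import ring lra zify.
Import Order.TTheory GRing.Theory Num.Theory.
Import numFieldNormedType.Exports.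

Set Implicit Arguments.
Unset Strict Implicit.
Unset Printing Implicit Defensive.

Local Open Scope ring_scope.

(** * Counting functions with little spread *)

(** The obstacle is that the error is not small for every [F]. When the columns of [F] indexed by a
    block [S] of rows all lie in a subgroup of index [x] in [H], each matrix column matched with
    that block may cost a factor [x], and [x ^ #|S|] is the inverse of the probability of this
    event. Degenerate [F] thus contribute a bounded amount, which does not tend to 0 by itself. The
    decay comes from the gap: [g] rows of the block that meets no step are left unmatched, and the
    spare matrix columns are random in every row. As [F] generates [H], each spare column sees every
    nontrivial character and gains a fixed factor below 1 over the index. The number of blocks is at
    most [2 ^ k], whatever [n], so that constants suffice for the other blocks.

    The modulus has one factor [p] beyond what kills [G] so that [N / p N] has order exactly [p ^ n]
    for every [phi], which makes the number of good [F] explicit. The bracketing by truncated sums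
    replaces a uniqueness theorem for moments: at each precision only finitely many moments are
    compared. *)

Section GeometricBounds.
Variables (R : realType) (th : R).
Hypothesis th01 : 0 < th < 1.

(** Half of the decay pays for the linear factor: with [x = sqrt th], [(j + 1) x ^ j] is at most a
    partial geometric sum, hence at most [1 / (1 - x)], and the other [x ^ j] is at most [x ^ s]. *)
Lemma succ_mul_geometric_le s j : (s <= j)%N ->
  j.+1%:R * th ^+ j <= Num.sqrt th ^+ s / (1 - Num.sqrt th).
Proof.
case/andP: th01 => th0 th1 sj.
set x := Num.sqrt th.
have x0 : 0 < x by rewrite sqrtr_gt0.
have x1 : x < 1 by rewrite -sqrtr1 ltr_sqrt.
have -> : th = x * x by rewrite -expr2 sqr_sqrtr // ltW.
rewrite exprMn mulrA ler_pdivlMr ?subr_gt0 //.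
have key : j.+1%:R * x ^+ j * (1 - x) <= 1.
  have h : j.+1%:R * x ^+ j <= \sum_(i < j.+1) x ^+ i.
    rewrite -[X in X%:R * _](card_ord j.+1) mulr_natl -sumr_const.
    apply: ler_sum => i _; apply: ler_wiXn2l; rewrite ?ltW //.
    by rewrite -ltnS.
  apply: le_trans (ler_wpM2r _ h) _; first by rewrite subr_ge0 ltW.
  have := subrX1 x j.+1.
  have xp : 0 <= x ^+ j.+1 by rewrite exprn_ge0 // ltW.
  nra.
have xj : x ^+ j <= x ^+ s by apply: ler_wiXn2l; rewrite ?ltW.
have xs0 : 0 <= x ^+ j by rewrite exprn_ge0 // ltW.
rewrite mulrAC -[leRHS]mul1r.
by apply: ler_pM => //; rewrite !mulr_ge0 // subr_ge0 ltW.
Qed.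

Lemma expr1D_le (x : R) n (b : R) : 0 <= x -> n%:R * x <= b -> (1 + x) ^+ n <= expR b.
Proof.
move=> x0 nb; apply: (@le_trans _ _ (expR (n%:R * x))); last by rewrite ler_expR.
rewrite mulrC expRM_natr.
by apply: lerXn2r; rewrite ?nnegrE ?addr_ge0 ?expR_ge0 ?expR_ge1Dx.
Qed.

(** The bound is uniform in [n] and vanishes as [s] grows; it controls the [n]-th power of
    [1 + a * th ^ maxn s (n %/ D)]. *)
Lemma mul_geometric_div_le D s n : (0 < D)%N ->
  n%:R * th ^+ maxn s (n %/ D) <= D%:R * (Num.sqrt th ^+ s / (1 - Num.sqrt th)).
Proof.
case/andP: th01 => th0 th1 D0.
set j := maxn s (n %/ D).
apply: (@le_trans _ _ (D%:R * (j.+1%:R * th ^+ j))); last first.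
  apply: ler_wpM2l => //; apply: succ_mul_geometric_le; exact: leq_maxl.
rewrite mulrA; apply: ler_wpM2r; first by rewrite exprn_ge0 // ltW.
rewrite -natrM ler_nat mulnC.
apply: leq_trans (ltnW (ltn_ceil n D0)) _.
by rewrite leq_mul2r ltnS leq_maxr orbT.
Qed.

End GeometricBounds.

Lemma cvg_exprX (R : realType) (u : nat -> R) (l : R) k :
  (u n @[n --> \oo] --> l)%classic -> (u n ^+ k @[n --> \oo] --> l ^+ k)%classic.
Proof.
move=> ul; elim: k => [|k IH]; first by under eq_fun do rewrite expr0; exact: cvg_cst.
by under eq_fun do rewrite exprS; rewrite exprS; exact: cvgM.
Qed.

(** * Independent uniform coordinates *)

Section UniformMean.
Variables (R : realType) (I V : finType) (K : {set V}).
Hypothesis K_gt0 : (0 < #|K|)%N.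
Implicit Types (X Y : {ffun I -> V} -> R) (S : {set I}).

Definition mean X : R := (\sum_(f in ffun_on (mem K)) X f) / #|K|%:R ^+ #|I|.

Let cK_gt0 : 0 < #|K|%:R ^+ #|I| :> R.
Proof. by rewrite exprn_gt0 // ltr0n. Qed.

Lemma mean_le X Y :
  (forall f, f \in ffun_on (mem K) -> X f <= Y f) -> mean X <= mean Y.
Proof.
by move=> XY; rewrite ler_pM2r ?invr_gt0 //; apply: ler_sum => f; exact: XY.
Qed.

Lemma eq_mean X Y : X =1 Y -> mean X = mean Y.
Proof. by move=> XY; congr (_ / _); apply: eq_bigr => f _; exact: XY. Qed.

Lemma meanZ c X : mean (fun f => c * X f) = c * mean X.
Proof. by rewrite /mean -mulr_sumr mulrA. Qed.

Lemma meanD X Y : mean (fun f => X f + Y f) = mean X + mean Y.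
Proof. by rewrite /mean big_split /= mulrDl. Qed.

Lemma mean_sum (J : finType) (P : pred J) (X : J -> {ffun I -> V} -> R) :
  mean (fun f => \sum_(j | P j) X j f) = \sum_(j | P j) mean (X j).
Proof. by rewrite /mean exchange_big /= mulr_suml. Qed.

Lemma mean_cst c : mean (fun=> c) = c.
Proof.
rewrite /mean sumr_const card_ffun_on -(mulr_natr c) natrX mulfK //.
by rewrite gt_eqF.
Qed.

Lemma mean_ge0 X : (forall f, 0 <= X f) -> 0 <= mean X.
Proof. by move=> X0; apply: divr_ge0; rewrite ?exprn_ge0 ?ler0n // sumr_ge0. Qed.

Definition depends_on S X := forall f g : {ffun I -> V}, {in S, f =1 g} -> X f = X g.

(* Exchanging the coordinates in [S] of two independent functions preserves
   their joint law. *)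
Lemma mean_indep S X Y :
  depends_on S X -> depends_on (~: S) Y -> mean (fun f => X f * Y f) = mean X * mean Y.
Proof.
move=> XS YS.
pose mix (f g : {ffun I -> V}) : {ffun I -> V} :=
  [ffun i => if i \in S then f i else g i].
pose h (fg : {ffun I -> V} * {ffun I -> V}) := (mix fg.1 fg.2, mix fg.2 fg.1).
have hK : involutive h.
  by case=> f g; congr (_, _); apply/ffunP => i; rewrite !ffunE; case: (i \in S).
have hon f g : (mix f g \in ffun_on (mem K)) && (mix g f \in ffun_on (mem K))
    = (f \in ffun_on (mem K)) && (g \in ffun_on (mem K)).
  apply/andP/andP => -[/ffun_onP Kf /ffun_onP Kg].
    by split; apply/ffun_onP => i; move: (Kf i) (Kg i); rewrite !ffunE; case: ifP.
  by split; apply/ffun_onP => i; rewrite ffunE; case: ifP.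
have -> : mean (fun f => X f * Y f) =
    mean (fun f => X f * Y f) * mean (fun=> 1) by rewrite mean_cst mulr1.
rewrite /mean !mulf_div; congr (_ / _).
rewrite !big_distrlr /= !pair_big /= [RHS](reindex_inj (inv_inj hK)) /=.
apply: eq_big => [[f g]|[f g] _] /=; first by rewrite -hon.
rewrite mulr1; congr (_ * _).
  by apply: XS => i iS; rewrite ffunE iS.
by apply: YS => i; rewrite inE ffunE => /negbTE ->.
Qed.

Lemma mean_prod (J : finType) (S : J -> {set I}) (X : J -> {ffun I -> V} -> R) (s : seq J) :
  uniq s -> (forall j1 j2, j1 != j2 -> [disjoint S j1 & S j2]) ->
  (forall j, depends_on (S j) (X j)) ->
  mean (fun f => \prod_(j <- s) X j f) = \prod_(j <- s) mean (X j).
Proof.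
move=> us Sdis XS; elim: s us => [|j s IH] /=.
  move=> _; rewrite big_nil -[RHS]mean_cst; apply: eq_mean => f.
  by rewrite big_nil.
case/andP=> js us; rewrite big_cons -IH // -(@mean_indep (S j)) //; last first.
  move=> f g fg; rewrite !(big_seq _ _ _ (fun i => X i _)); apply: eq_bigr => i iS.
  apply: XS => x xi; apply: fg; rewrite inE.
  have ij : i != j by apply: contraNneq js => <-.
  by rewrite (disjointFr (Sdis _ _ ij) xi).
by apply: eq_mean => f; rewrite big_cons.
Qed.

Lemma mean_prod_coord S (h : V -> R) :
  mean (fun f => \prod_(i in S) h (f i)) = ((\sum_(v in K) h v) / #|K|%:R) ^+ #|S|.
Proof.
rewrite /mean; under eq_bigr => f _ do rewrite big_mkcond /=.
rewrite -(bigA_distr_big _ (fun i v => if i \in S then h v else 1)) /=.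
rewrite (bigID (mem S)) /= (eq_bigr (fun=> \sum_(v in K) h v)); last first.
  by move=> i iS; rewrite iS.
rewrite [X in _ * X / _](eq_bigr (fun=> #|K|%:R)); last first.
  by move=> i /negbTE->; rewrite sumr_const.
rewrite !prodr_const exprMn exprVn -mulrA; congr (_ * _).
have -> : (#|I| = #|S| + #|[predC S]|)%N by rewrite cardC.
rewrite exprD invfM mulrCA divff ?mulr1 //.
by rewrite expf_neq0 // pnatr_eq0 -lt0n.
Qed.

End UniformMean.

(** * Frequencies seen by a random walk *)

Section RandomWalk.
Variables (R : realType) (I V U : finType) (nz : U -> V -> bool) (K : {set V}) (th : R).
Implicit Types (S : {set I}) (f : {ffun I -> V}) (u : U) (D : nat).

(** [nz u v] stands for the character [u] being nontrivial on the vector [v]. *)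
Definition annihilator (H : {set V}) : {set U} := [set u | [forall v in H, ~~ nz u v]].

Definition orth_in (B : {set U}) : {set V} := [set v in K | [forall u in B, ~~ nz u v]].

Definition weight S f u : nat := #|[set i in S | nz u (f i)]|.

(* When the frequency [u] contributes at most [th ^ weight S f u] to the Fourier
   expansion of the law of a random combination of the [f i], [i] in [S], the
   combination vanishes with probability at most [spread S 0 f / #|K|]. *)
Definition spread S s f : R :=
  1 + #|K|%:R / #|U|%:R * \sum_(u in ~: annihilator K) th ^+ maxn s (weight S f u).

Definition generic D S f := [forall u in ~: annihilator K, #|S| <= D * weight S f u]%N.

Hypothesis th01 : 0 < th < 1.
Hypothesis card_orth_in :
  forall B : {set U}, (#|orth_in B| * #|annihilator (orth_in B)| = #|U|)%N.
Hypothesis annihilator_half : forall (B : {set U}) v, v \in K -> v \notin orth_in B ->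
  (2 * #|[set u in annihilator (orth_in B) | ~~ nz u v]| <= #|annihilator (orth_in B)|)%N.
Hypothesis U_gt0 : (0 < #|U|)%N.

Let th0 : 0 < th. Proof. by case/andP: th01. Qed.
Let th1 : th < 1. Proof. by case/andP: th01. Qed.

Let orth_in0 : orth_in finset.set0 = K.
Proof.
apply/setP => v; rewrite inE andb_idr // => _.
by apply/forall_inP => u; rewrite inE.
Qed.

Let card_K : (#|K| * #|annihilator K| = #|U|)%N.
Proof. by rewrite -[in RHS](card_orth_in finset.set0) orth_in0. Qed.

Let K_gt0 : (0 < #|K|)%N.
Proof. by move: U_gt0; rewrite -card_K muln_gt0 => /andP[]. Qed.

Let q := #|K|%:R : R.
Let kap := q / #|U|%:R.

Let q_ge1 : 1 <= q. Proof. by rewrite ler1n. Qed.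
Let U0 : 0 < #|U|%:R :> R. Proof. by rewrite ltr0n. Qed.
Let kap_gt0 : 0 < kap.
Proof. by rewrite divr_gt0 // (lt_le_trans ltr01). Qed.
Let kapK : kap * #|annihilator K|%:R = 1.
Proof. by rewrite mulrAC -natrM card_K divff // gt_eqF. Qed.
Let kapU : kap * #|U|%:R = q.
Proof. by rewrite divfK // gt_eqF. Qed.

Lemma weight_subset S S' f u : S \subset S' -> (weight S f u <= weight S' f u)%N.
Proof.
move=> SS'; apply/subset_leq_card/fintype.subsetP => i; rewrite !inE => /andP[iS ->].
by rewrite (fintype.subsetP SS').
Qed.

Lemma weight_depends S (f g : {ffun I -> V}) : {in S, f =1 g} -> weight S f =1 weight S g.
Proof.
move=> fg u; apply: eq_card => i; rewrite !inE.
by case: (boolP (i \in S)) => // iS; rewrite fg.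
Qed.

Lemma spread_depends S s : depends_on S (spread S s).
Proof.
move=> f g fg; congr (1 + _ * _); apply: eq_bigr => u _.
by rewrite (weight_depends fg).
Qed.

Lemma generic_depends D S (f g : {ffun I -> V}) :
  {in S, f =1 g} -> generic D S f = generic D S g.
Proof. by move=> fg; apply: eq_forallb => u; rewrite (weight_depends fg). Qed.

Lemma spread_ge1 S s f : 1 <= spread S s f.
Proof.
rewrite lerDl mulr_ge0 ?(ltW kap_gt0) // sumr_ge0 // => u _.
by rewrite exprn_ge0 // ltW.
Qed.

Lemma spread_ge0 S s f : 0 <= spread S s f.
Proof. exact: le_trans ler01 (spread_ge1 _ _ _). Qed.

Lemma spread_le_uniform S s f N :
  (forall u, u \notin annihilator K -> (N <= maxn s (weight S f u))%N) ->
  spread S s f <= 1 + q * th ^+ N.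
Proof.
move=> Nw; rewrite lerD2l -/q -/kap -[leRHS](congr1 ( *%R^~ _) kapU) /= -mulrA.
apply: ler_wpM2l; first exact: ltW.
apply: (@le_trans _ _ (\sum_(u in ~: annihilator K) th ^+ N)).
  apply: ler_sum => u; rewrite inE => /Nw Nu.
  by apply: ler_wiXn2l => //; exact: ltW.
rewrite sumr_const -(mulr_natl (th ^+ N)); apply: ler_wpM2r; first by rewrite exprn_ge0 // ltW.
by rewrite ler_nat max_card.
Qed.

Lemma spread_generic D S s f : (0 < D)%N -> generic D S f ->
  spread S s f <= 1 + q * th ^+ maxn s (#|S| %/ D).
Proof.
move=> D0 /forall_inP gf; apply: spread_le_uniform => u uK.
rewrite geq_max leq_maxl /= (leq_trans _ (leq_maxr _ _)) //.
by rewrite -(mulKn (weight S f u) D0) leq_div2r // gf // inE.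
Qed.

Lemma spread_le_card S s f : spread S s f <= 1 + q.
Proof.
by have := @spread_le_uniform S s f 0; rewrite expr0 mulr1; apply.
Qed.

Lemma spread_anti S s S' s' f :
  (forall u, u \notin annihilator K ->
     (maxn s (weight S f u) <= maxn s' (weight S' f u))%N) ->
  spread S' s' f <= spread S s f.
Proof.
move=> h; rewrite lerD2l; apply: ler_wpM2l; first exact: ltW.
apply: ler_sum => u; rewrite inE => uK; apply: ler_wiXn2l; rewrite ?(ltW th0) ?(ltW th1) //.
exact: h.
Qed.

Section NonGeneric.
Variables (D : nat) (S : {set I}) (f : {ffun I -> V}).
Hypothesis D_gt0 : (0 < D)%N.
Hypothesis fK : f \in ffun_on (mem K).

(* Here [B] collects the frequencies that the walk hardly sees, and almost every
   step lies in the proper subgroup [H] orthogonal to them: the factor [x ^ #|S|]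
   lost in [spread] is regained, up to a geometric factor, from the rarity of such
   walks. *)
Let B := [set u | (D * weight S f u < #|S|)%N].
Let H := orth_in B.
Let x : R := q / #|H|%:R.
Let eta := th ^+ (#|S| %/ D).
Let c1 := (1 + th) / 2.

Let H_gt0 : (0 < #|H|)%N.
Proof. by move: U_gt0; rewrite -(card_orth_in B) muln_gt0 => /andP[]. Qed.

Let kapH : kap * #|annihilator H|%:R = x.
Proof.
rewrite /kap -(card_orth_in B) natrM invfM mulrA mulfVK //.
move: U_gt0; rewrite -(card_orth_in B) muln_gt0 pnatr_eq0 => /andP[_].
by rewrite lt0n.
Qed.

Let annKH : annihilator K \subset annihilator H.
Proof.
apply/fintype.subsetP => u; rewrite !inE => /forall_inP uK; apply/forall_inP => v.
by rewrite inE => /andP[vK _]; exact: uK.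
Qed.

(** Frequencies outside [annihilator H] are not in [B], so each costs at most [eta]; those of
    [annihilator H] cost at most 1 in [A0] and [y] elsewhere. The leading 1 of [spread] is the cost
    of [annihilator K]. *)
Let spread_le_ann s (A0 : {set U}) (y : R) : 0 <= y <= 1 ->
  annihilator K \subset A0 -> A0 \subset annihilator H ->
  (forall u, u \in annihilator H -> u \notin A0 -> th ^+ maxn s (weight S f u) <= y) ->
  spread S s f <= kap * (#|A0|%:R + (#|annihilator H|%:R - #|A0|%:R) * y) + q * eta.
Proof.
case/andP=> y0 y1 KA0 A0H hy; rewrite /spread -/q -/kap -[1 in leLHS]kapK -mulrDr.
rewrite -[q * eta](congr1 ( *%R^~ _) kapU) /= -mulrA -mulrDr.
apply: ler_wpM2l; first exact: ltW.
rewrite (bigID (mem (annihilator H))) /= addrA; apply: lerD.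
  rewrite (bigID (mem A0)) /= addrA; apply: lerD.
    rewrite -(cardsID (annihilator K) A0) (finset.setIidPr KA0) natrD lerD2l.
    rewrite -[X in _ <= X%:R]sum1_card natr_sum.
    apply: (@le_trans _ _ (\sum_(u in A0 :\: annihilator K) th ^+ maxn s (weight S f u))).
      rewrite le_eqVlt; apply/orP; left; apply/eqP; apply: eq_bigl => u.
      rewrite !inE; case: (boolP (u \in A0)) => uA0; rewrite ?andbF //.
      by rewrite !andbT; move: (fintype.subsetP A0H _ uA0); rewrite !inE => ->; rewrite andbT.
    by apply: ler_sum => u _; apply: exprn_ile1; exact: ltW.
  rewrite -natrB ?subset_leq_card // -{2}(finset.setIidPr A0H) -cardsD mulrC mulr_natr -sumr_const.
  apply: (@le_trans _ _ (\sum_(u in annihilator H :\: A0) th ^+ maxn s (weight S f u))).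
    rewrite le_eqVlt; apply/orP; left; apply/eqP; apply: eq_bigl => u.
    rewrite [in RHS]finset.in_setD finset.in_setC; case: (boolP (u \in A0)) => uA0; rewrite ?andbF //=.
    rewrite andbT; case: (boolP (u \in annihilator H)) => uH; rewrite ?andbF //.
    by rewrite andbT (contra _ uA0) //; exact: (fintype.subsetP KA0).
  by apply: ler_sum => u; rewrite finset.in_setD => /andP[uA0 uH]; exact: hy.
apply: (@le_trans _ _ (\sum_(u in ~: annihilator H) eta)).
  apply: (@le_trans _ _ (\sum_(u in ~: annihilator H) th ^+ maxn s (weight S f u))).
    rewrite le_eqVlt; apply/orP; left; apply/eqP; apply: eq_bigl => u.
    rewrite !finset.in_setC; case: (boolP (u \in annihilator H)) => uH; rewrite ?andbF //.
    by rewrite andbT (contra _ uH) //; exact: (fintype.subsetP annKH).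
  apply: ler_sum => u; rewrite finset.in_setC => uH.
  apply: ler_wiXn2l; rewrite ?(ltW th0) ?(ltW th1) //.
  rewrite leq_max; apply/orP; right.
  rewrite -(mulKn (weight S f u) D_gt0) leq_div2r // leqNgt.
  apply: contra uH => uB; rewrite inE; apply/forall_inP => v; rewrite inE.
  by case/andP=> _ /forall_inP; apply; rewrite inE.
rewrite sumr_const -(mulr_natl eta); apply: ler_wpM2r; first by rewrite exprn_ge0 // ltW.
by rewrite ler_nat max_card.
Qed.

Let x_ge1 : 1 <= x.
Proof.
rewrite ler_pdivlMr ?ltr0n // mul1r ler_nat subset_leq_card //.
by apply/fintype.subsetP => v; rewrite inE => /andP[].
Qed.

Let q_eta : 0 <= q * eta.
Proof. by rewrite mulr_ge0 ?exprn_ge0 ?ltW // (lt_le_trans ltr01). Qed.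

Let c1_bounds : 1 / 2 <= c1 <= 1.
Proof. by move: th0 th1; rewrite /c1; move=> a b; apply/andP; split; lra. Qed.

Let spread_le_index s : spread S s f <= x * (1 + 2 * q * eta).
Proof.
apply: le_trans (@spread_le_ann s (annihilator K) 1 _ _ _ _) _ => //.
- by rewrite ler01 lexx.
- by move=> u _ _; apply: exprn_ile1; exact: ltW.
rewrite mulr1 subrKC kapH mulrDr mulr1 lerD2l.
rewrite -mulrA; move: x_ge1 q_eta; move: (q * eta) x => e z z1 e0.
have : 0 <= (z - 1) * e by rewrite mulr_ge0 // subr_ge0.
by nra.
Qed.

(** At least half of [annihilator H] is damped by [th], so the average cost is at most
    [c1 = (1 + th) / 2]: this is the gain over the index [x]. *)
Let spread_le_half s (A0 : {set U}) : (2 * #|A0| <= #|annihilator H|)%N ->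
  annihilator K \subset A0 -> A0 \subset annihilator H ->
  (forall u, u \in annihilator H -> u \notin A0 -> (0 < maxn s (weight S f u))%N) ->
  spread S s f <= x * c1 * (1 + 2 * q * eta).
Proof.
move=> half KA0 A0H pos.
apply: le_trans (@spread_le_ann s A0 th _ KA0 A0H _) _.
- by rewrite !ltW.
- move=> u uH uA0; rewrite -[leRHS]expr1; apply: ler_wiXn2l; rewrite ?ltW //.
  exact: pos.
have h : kap * (#|A0|%:R + (#|annihilator H|%:R - #|A0|%:R) * th) <= x * c1.
  rewrite -kapH -mulrA; apply: ler_wpM2l; first exact: ltW.
  rewrite -(ler_nat R) natrM in half; rewrite /c1.
  have : 0 <= (1 - th) * (#|annihilator H|%:R - 2 * #|A0|%:R).
    by rewrite mulr_ge0 // subr_ge0 // ltW.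
  by nra.
rewrite [leRHS]mulrDr mulr1; apply: lerD => //.
have xc : 1 / 2 <= x * c1.
  by case/andP: c1_bounds => c _; rewrite -[leLHS]mul1r; apply: ler_pM => //; lra.
rewrite -[2 * q * eta]mulrA; move: xc q_eta; move: (q * eta) (x * c1) => e z z1 e0.
have : 0 <= (z - 1 / 2) * e by rewrite mulr_ge0 // subr_ge0.
by nra.
Qed.

Let orthP v : reflect (v \in K /\ forall u, u \in B -> ~~ nz u v) (v \in H).
Proof. by rewrite inE; apply: (iffP andP) => -[vK /forall_inP]. Qed.

(** A step outside [H] is seen by a frequency of [B]; there are at most [#|U|] of these, and each
    sees fewer than [#|S| / D] steps. This is why [D] carries the factor [#|U|]. *)
Lemma card_exit_le D1 : D = (#|U| * D1)%N ->
  (D1 * #|[set i in S | f i \notin H]| <= #|S|)%N.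
Proof.
move=> defD; rewrite -(leq_pmul2l U_gt0) mulnA -defD.
pose W u := [set i in S | nz u (f i)].
apply: (@leq_trans (\sum_(u in B) D * #|W u|)); last first.
  apply: (@leq_trans (\sum_(u in B) #|S|)).
    by apply: leq_sum => u; rewrite inE => /ltnW.
  by rewrite sum_nat_const leq_mul2r max_card orbT.
rewrite -big_distrr leq_mul2l; apply/orP; right.
apply: leq_trans (_ : (#|\bigcup_(u in B) W u| <= _)%N).
  apply/subset_leq_card/fintype.subsetP => i; rewrite inE => /andP[iS].
  rewrite inE (ffun_onP fK) /= negb_forall => /existsP[u].
  rewrite negb_imply negbK => /andP[uB nzu].
  by apply/finset.bigcupP; exists u => //; rewrite inE iS.
elim/big_rec2: _ => [|u m A uB IH]; first by rewrite finset.cards0.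
by apply: leq_trans (leq_card_setU _ _) _; rewrite leq_add2l.
Qed.

(** If the walk stays in [H], only the [g] factors with floor 1 gain [c1], because [annihilator K]
    is at most half of [annihilator H]. If some step leaves [H], at least half of [annihilator H]
    sees it, and every factor gains [c1]. *)
Lemma spread_nongeneric_le D1 g : D = (#|U| * D1)%N -> ~~ generic D S f -> (g <= #|S|)%N ->
  spread S 0 f ^+ (#|S| - g) * spread S 1 f ^+ g <=
  x ^+ #|S| * (1 + 2 * q * eta) ^+ #|S| *
    (c1 ^+ g * [forall i in S, f i \in H]%:R
     + c1 ^+ #|S| * (D1 * #|[set i in S | f i \notin H]| <= #|S|)%N%:R).
Proof.
move=> defD ngf gS; set Z := 1 + _; rewrite (card_exit_le defD) mulr1.
have Z0 : 0 <= Z by rewrite addr_ge0 // -mulrA mulr_ge0.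
have x0 : 0 <= x by rewrite (le_trans ler01).
have c10 : 0 <= c1 by case/andP: c1_bounds => c _; apply: le_trans c; lra.
have xcZ0 : 0 <= x * c1 * Z by rewrite mulr_ge0 // mulr_ge0.
have xZc0 : 0 <= x * Z * c1 by rewrite mulr_ge0 // mulr_ge0.
case: (boolP [forall i in S, _]) => [allH|].
  rewrite mulr1; apply: (@le_trans _ _ (x ^+ #|S| * Z ^+ #|S| * c1 ^+ g)); last first.
    by apply: ler_wpM2l; rewrite ?mulr_ge0 ?exprn_ge0 // lerDl exprn_ge0.
  rewrite -[in leRHS](subnK gS) !exprD.
  have -> : x ^+ (#|S| - g) * x ^+ g * (Z ^+ (#|S| - g) * Z ^+ g) * c1 ^+ g
      = (x * Z) ^+ (#|S| - g) * (x * c1 * Z) ^+ g by rewrite !exprMn; ring.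
  apply: ler_pM; rewrite ?exprn_ge0 ?spread_ge0 //.
    by apply: lerXn2r; rewrite ?nnegrE ?spread_ge0 ?mulr_ge0 //; exact: spread_le_index.
  apply: lerXn2r; rewrite ?nnegrE ?spread_ge0 //.
  move: ngf; rewrite negb_forall => /existsP[u]; rewrite negb_imply -ltnNge => /andP[].
  rewrite !inE negb_forall => /existsP[v]; rewrite negb_imply negbK => /andP[vK nzuv] uB.
  apply: (@spread_le_half 1%N (annihilator K)) => //; last first.
    by move=> w _ _; rewrite leq_max.
  apply: leq_trans (annihilator_half (B := B) vK _); last first.
    by apply/negP => /orthP[_ /(_ u)]; rewrite inE nzuv => /(_ uB).
  rewrite leq_mul2l /=; apply/subset_leq_card/fintype.subsetP => w wK.
  rewrite inE (fintype.subsetP annKH) //=; move: wK; rewrite inE.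
  by move/forall_inP; apply.
rewrite negb_forall => /existsP[] i; rewrite negb_imply => /andP[iS fiH].
rewrite mulr0 add0r -!exprMn.
have h s : spread S s f <= x * Z * c1.
  rewrite mulrAC; apply: (@spread_le_half s [set u in annihilator H | ~~ nz u (f i)]).
  - by apply: annihilator_half => //; exact: (ffun_onP fK).
  - apply/fintype.subsetP => w wK; rewrite inE (fintype.subsetP annKH) //=.
    by move: wK; rewrite inE => /forall_inP; apply; exact: (ffun_onP fK).
  - by apply/fintype.subsetP => w; rewrite inE => /andP[].
  - move=> u uH; rewrite inE uH negbK => nzu; rewrite leq_max; apply/orP; right.
    by rewrite card_gt0; apply/set0Pn; exists i; rewrite inE iS.
rewrite -[in leRHS](subnK gS) exprD; apply: ler_pM; rewrite ?exprn_ge0 ?spread_ge0 //.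
  by apply: lerXn2r; rewrite ?nnegrE ?spread_ge0 //; exact: h.
by apply: lerXn2r; rewrite ?nnegrE ?spread_ge0 //; exact: h.
Qed.

End NonGeneric.

(** A union bound over the possible sets [B] of neglected frequencies gives [2 ^ #|U|]. For each of
    them [x ^ #|S|] cancels the probability of staying in [H] and leaves [c1 ^ g]; walks with few
    exits are handled by a Chernoff bound with parameter [y]. *)
Lemma mean_nongeneric_le D1 S g (y r Z : R) :
  (0 < D1)%N -> 0 < y < 1 ->
  (1 + th) / 2 <= r <= 1 -> (1 + th) / 2 * (y^-1 * (1 + q * y ^+ D1)) <= r ->
  (1 + 2 * q * th ^+ (#|S| %/ (#|U| * D1))) ^+ #|S| <= Z -> (g <= #|S|)%N ->
  mean K (fun f => (~~ generic (#|U| * D1) S f)%:R *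
                   (spread S 0 f ^+ (#|S| - g) * spread S 1 f ^+ g))
  <= 2 ^+ #|U| * Z * 2 * r ^+ g.
Proof.
move=> D10 /andP[y0 y1] /andP[cr r1] yr ZS gS.
set D := (#|U| * D1)%N; have D0 : (0 < D)%N by rewrite muln_gt0 U_gt0.
set c1 := (1 + th) / 2 in cr yr *.
have c10 : 0 <= c1 by rewrite /c1; move: th0; lra.
have r0 : 0 <= r by exact: le_trans cr.
have Zp : 0 <= (1 + 2 * q * th ^+ (#|S| %/ D)) ^+ #|S|.
  by rewrite exprn_ge0 // addr_ge0 // !mulr_ge0 ?exprn_ge0 ?ltW // (lt_le_trans ltr01).
have Z0 : 0 <= Z by exact: le_trans ZS.
pose x B : R := q / #|orth_in B|%:R.
have H0 B : 0 < #|orth_in B|%:R :> R.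
  by rewrite ltr0n; move: U_gt0; rewrite -(card_orth_in B) muln_gt0 => /andP[].
have x0 B : 0 <= x B by rewrite divr_ge0 // (le_trans ler01).
pose T B f : R := c1 ^+ g * [forall i in S, f i \in orth_in B]%:R
     + c1 ^+ #|S| * (D1 * #|[set i in S | f i \notin orth_in B]| <= #|S|)%N%:R.
have T0 B f : 0 <= T B f by rewrite addr_ge0 ?mulr_ge0 ?exprn_ge0.
apply: (@le_trans _ _ (mean K (fun f => \sum_(B : {set U}) x B ^+ #|S| * Z * T B f))).
  apply: mean_le => // f fK.
  have sum0 : 0 <= \sum_(B : {set U}) x B ^+ #|S| * Z * T B f.
    by apply: sumr_ge0 => B _; rewrite !mulr_ge0 ?exprn_ge0.
  case: (boolP (generic _ _ _)) => gf /=; first by rewrite mul0r.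
  rewrite mul1r; apply: le_trans (spread_nongeneric_le D0 fK (erefl _) gf gS) _.
  rewrite (bigD1 [set u | (D * weight S f u < #|S|)%N]) //=.
  apply: ler_wpDr; first by apply: sumr_ge0 => B _; rewrite !mulr_ge0 ?exprn_ge0.
  apply: ler_wpM2r; first exact: T0.
  by apply: ler_wpM2l; rewrite ?exprn_ge0 //; exact: x0.
rewrite mean_sum //; apply: (@le_trans _ _ (\sum_(B : {set U}) Z * 2 * r ^+ g)); last first.
  have -> : \sum_(B : {set U}) Z * 2 * r ^+ g = #|{set U}|%:R * (Z * 2 * r ^+ g).
    by rewrite sumr_const mulr_natl.
  by rewrite -(finset.cardsT {set U}) -finset.powersetT finset.card_powerset finset.cardsT natrX !mulrA.
apply: ler_sum => B _; rewrite meanZ [x B ^+ _ * Z]mulrC -!mulrA; apply: ler_wpM2l => //.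
rewrite -meanZ mulr2n mulrDl mul1r.
pose h1 v : R := (v \in orth_in B)%:R.
(* With [e] exits from [orth_in B], the product of the [h2 (f i)] is [y ^ (D1 e) / y ^ #|S|], which
   is at least 1 when [D1 e <= #|S|]. *)
pose h2 v : R := y^-1 * (if v \in orth_in B then 1 else y ^+ D1).
have K0 : q != 0 by rewrite gt_eqF // (lt_le_trans ltr01).
have HK : orth_in B \subset K by apply/fintype.subsetP => v; rewrite inE => /andP[].
have xq : x B * (#|orth_in B|%:R / q) = 1.
  by rewrite /x mulrA divfK ?divff // gt_eqF.
apply: (@le_trans _ _ (mean K (fun f => x B ^+ #|S| * c1 ^+ g * \prod_(i in S) h1 (f i)
         + x B ^+ #|S| * c1 ^+ #|S| * \prod_(i in S) h2 (f i)))).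
  apply: mean_le => // f fK; rewrite /T mulrDr !mulrA; apply: lerD.
    apply: ler_wpM2l; first by rewrite mulr_ge0 ?exprn_ge0.
    case: (boolP [forall i in S, _]) => [/forall_inP allH|_].
      by rewrite big1 // => i iS; rewrite /h1 allH.
    by apply: prodr_ge0 => i _; rewrite /h1.
  apply: ler_wpM2l; first by rewrite mulr_ge0 ?exprn_ge0.
  have -> : \prod_(i in S) h2 (f i) =
      y ^+ (D1 * #|[set i in S | f i \notin orth_in B]|) / y ^+ #|S|.
    rewrite big_split /= prodr_const exprVn mulrC; congr (_ / _).
    rewrite (bigID (fun i => f i \in orth_in B)) /= big1 ?mul1r; last first.
      by move=> i /andP[_ ->].
    rewrite (eq_bigr (fun=> y ^+ D1)); last by move=> i /andP[_ /negbTE ->].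
    by rewrite prodr_const exprM; congr (_ ^+ _); apply: eq_card => i; rewrite [RHS]inE.
  case: leqP => [le|_]; last by rewrite divr_ge0 ?exprn_ge0 ?ltW.
  by rewrite ler_pdivlMr ?exprn_gt0 // mul1r; apply: ler_wiXn2l; rewrite ?ltW.
rewrite meanD // !meanZ // !mean_prod_coord // -/q; apply: lerD.
  have -> : \sum_(v in K) h1 v = #|orth_in B|%:R.
    rewrite /h1 -natr_sum; congr _%:R; rewrite -[RHS]sum1_card.
    rewrite (eq_bigr (fun v => if v \in orth_in B then 1 else 0)%N); last first.
      by move=> v _; case: (v \in _).
    rewrite -big_mkcondr; apply: eq_bigl => v; apply: andb_idl.
    exact: (fintype.subsetP HK).
  by rewrite mulrAC -exprMn xq expr1n mul1r; apply: lerXn2r; rewrite ?nnegrE.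
rewrite -!exprMn; apply: (@le_trans _ _ (r ^+ #|S|)); last by apply: ler_wiXn2l.
have h20 v : 0 <= h2 v by rewrite /h2 mulr_ge0 ?invr_ge0 ?ltW //; case: ifP => // _; rewrite ?exprn_gt0.
apply: lerXn2r; rewrite ?nnegrE //.
  apply: mulr_ge0; first exact: mulr_ge0.
  by apply: divr_ge0; [exact: sumr_ge0 | exact: le_trans q_ge1].
apply: le_trans yr; rewrite [x B * _]mulrC -mulrA; apply: ler_wpM2l => //.
rewrite /h2 -mulr_sumr -[X in _ * X]mulrA mulrCA; apply: ler_wpM2l; first by rewrite invr_ge0 ltW.
apply: (@le_trans _ _ (x B * ((#|orth_in B|%:R + #|K|%:R * y ^+ D1) / q))).
  apply: ler_wpM2l => //; rewrite ler_pM2r ?invr_gt0 ?(lt_le_trans ltr01) //.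
  rewrite (bigID (mem (orth_in B))) /= -[X in X%:R + _]sum1_card natr_sum; apply: lerD.
    rewrite le_eqVlt; apply/orP; left; apply/eqP; apply: eq_big => v.
      by rewrite andb_idl //; exact: (fintype.subsetP HK).
    by move=> /andP[_ ->].
  rewrite -sum1_card natr_sum mulr_suml.
  rewrite [leRHS](bigID (mem (orth_in B))) /= addrC; apply: ler_wpDr.
    by apply: sumr_ge0 => v _; rewrite mul1r exprn_ge0 // ltW.
  by apply: ler_sum => v /andP[_ /negbTE ->]; rewrite mul1r.
rewrite mulrDl mulrDr xq lerD2l [_ * _ / q]mulrAC divff // mul1r; apply: ler_wpM2r.
  by rewrite exprn_ge0 // ltW.
rewrite ler_pdivrMr // ler_peMr ?(le_trans ler01) // ler1n.
by rewrite -(ltr0n R).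
Qed.

End RandomWalk.

(** What the estimates need of the characters: the index formula for every subgroup that characters
    cut out, and the fact that one more vector cuts an annihilator at least in half. *)
Definition dual_pair (V U : finType) (nz : U -> V -> bool) (K : {set V}) : Prop :=
  [/\ forall B : {set U}, (#|orth_in nz K B| * #|annihilator nz (orth_in nz K B)| = #|U|)%N,
      forall (B : {set U}) v, v \in K -> v \notin orth_in nz K B ->
        (2 * #|[set u in annihilator nz (orth_in nz K B) | ~~ nz u v]|
           <= #|annihilator nz (orth_in nz K B)|)%N
    & (0 < #|U|)%N].

Section BlockBounds.
Variables (R : realType) (V U : finType) (nz : U -> V -> bool) (K : {set V}) (th : R).
Hypothesis th01 : 0 < th < 1.
Hypothesis dualK : dual_pair nz K.

Let q := #|K|%:R : R.

Lemma dual_pair_gt0 : (0 < #|K|)%N.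
Proof.
case: dualK => /(_ finset.set0) + _ U0; case: (posnP #|K|) => // K0.
suff -> : orth_in nz K finset.set0 = finset.set0 by rewrite finset.cards0 mul0n => E; rewrite -E in U0.
by apply/eqP; rewrite -finset.subset0 -(cards0_eq K0); apply/fintype.subsetP => v; rewrite inE => /andP[].
Qed.

Let geo s := Num.sqrt th ^+ s / (1 - Num.sqrt th).

Let geo_cvg0 : (geo s @[s --> \oo] --> 0)%classic.
Proof.
have [t0 t1] := andP th01.
have -> : 0 = 0 / (1 - Num.sqrt th) :> R by rewrite mul0r.
apply: cvgMr_tmp; apply: cvg_expr; rewrite ger0_norm ?sqrtr_ge0 //.
by rewrite -sqrtr1 ltr_sqrt.
Qed.

Let geo_ge0 s : 0 <= geo s.
Proof.
have [t0 t1] := andP th01.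
by rewrite divr_ge0 ?exprn_ge0 ?sqrtr_ge0 // subr_ge0 -sqrtr1 ler_sqrt ?ltW.
Qed.

Lemma expr1D_geometric_le (a : R) D s n : 0 <= a -> (0 < D)%N ->
  (1 + a * th ^+ maxn s (n %/ D)) ^+ n <= expR (a * D%:R * geo s).
Proof.
move=> a0 D0; have [t0 t1] := andP th01.
apply: expr1D_le; first by rewrite mulr_ge0 // exprn_ge0 // ltW.
rewrite mulrCA -[leRHS]mulrA; apply: ler_wpM2l => //.
exact: mul_geometric_div_le.
Qed.

Lemma expr1D_geometric_cvg (a : R) D : 0 <= a -> (0 < D)%N ->
  exists2 E : nat -> R, (E s @[s --> \oo] --> (1 : R))%classic &
    forall n, (1 + a * th ^+ (n %/ D)) ^+ n <= E (n %/ D)%N.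
Proof.
move=> a0 D0; exists (fun s => expR (a * D%:R * geo s)); last first.
  by move=> n; rewrite -{1}(maxnn (n %/ D)%N); exact: expr1D_geometric_le.
suff : (expR (a * D%:R * geo s) @[s --> \oo] --> expR (a * D%:R * 0))%classic.
  by rewrite mulr0 expR0.
by apply: continuous_cvg; [exact: continuous_expR | apply: cvgMl_tmp].
Qed.

Lemma mean_nongeneric_bound : exists D (C r : R),
  [/\ (0 < D)%N, 0 <= C, 0 < r < 1 &
    forall (I : finType) (S : {set I}) g, (g <= #|S|)%N ->
      mean K (fun f => (~~ generic nz K D S f)%:R *
        (spread nz K th S 0 f ^+ (#|S| - g) * spread nz K th S 1 f ^+ g)) <= C * r ^+ g].
Proof.
have [t0 t1] := andP th01; have [h1 h2 U0] := dualK.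
set c := (1 + th) / 2; have c0 : 0 < c by rewrite /c; lra.
have c1 : c < 1 by rewrite /c; lra.
(* [y] lies above [c] so that [c / y < 1], and [r] between [c / y] and 1; a large [D1] then makes
   [q * y ^ D1] fit into the remaining room. *)
pose y := (1 + c) / 2; have y0 : 0 < y by rewrite /y; lra.
have y1 : y < 1 by rewrite /y; lra.
have cy : c / y < 1 by rewrite ltr_pdivrMr // mul1r /y; lra.
have cy0 : 0 < c / y by rewrite divr_gt0.
pose r := (1 + c / y) / 2; have r0 : 0 < r by rewrite /r; lra.
have r1 : r < 1 by rewrite /r; lra.
have cr : c <= r.
  have : c <= c / y by rewrite ler_pdivlMr // ler_piMr // ltW.
  by rewrite /r; lra.
have [D1 D10 hD1] : exists2 D1, (0 < D1)%N & c * (y^-1 * (1 + q * y ^+ D1)) <= r.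
  have cv : (c * (y^-1 * (1 + q * y ^+ k)) @[k --> \oo] --> c * (y^-1 * (1 + q * 0)))%classic.
    apply: cvgMl_tmp; apply: cvgMl_tmp; apply: cvgD; first exact: cvg_cst.
    by apply: cvgMl_tmp; apply: cvg_expr; rewrite ger0_norm ?ltW.
  have lim_lt : c * (y^-1 * (1 + q * 0)) < r by rewrite mulr0 addr0 mulr1 /r; lra.
  have [N _ hN] := cvgr_lt _ cv _ lim_lt.
  by exists N.+1 => //; apply/ltW/hN => /=.
exists (#|U| * D1)%N, (2 ^+ #|U| * expR (2 * q * (#|U| * D1)%:R * geo 0) * 2), r; split.
- by rewrite muln_gt0 U0.
- by rewrite !mulr_ge0 ?exprn_ge0 ?expR_ge0.
- by rewrite r0.
move=> I S g gS; apply: mean_nongeneric_le hD1 _ gS => //; rewrite ?y0 ?y1 ?cr ?(ltW r1) //.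
rewrite -[X in th ^+ X]max0n. apply: expr1D_geometric_le.
  by rewrite mulr_ge0.
by rewrite muln_gt0 U0.
Qed.

(** The contribution of one block, uniformly in its size. The first bound is for the block that
    meets no step, when it is not generic; the other blocks are then merely bounded. When that block
    is generic it provides the floor [s], and the means over the other blocks are at most
    [1 + e s]. *)
Lemma block_bounds : exists D (C r : R) (e : nat -> R),
  [/\ (0 < D)%N /\ 0 <= C, 0 < r < 1, (e s @[s --> \oo] --> 0)%classic &
    forall (I : finType) (S : {set I}),
    [/\ forall g, (g <= #|S|)%N ->
        mean K (fun f => (~~ generic nz K D S f)%:R *
         (spread nz K th S 0 f ^+ (#|S| - g) * spread nz K th S 1 f ^+ g)) <= C * r ^+ g,
        mean K (fun f => spread nz K th S 0 f ^+ #|S|) <= C &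
        forall s, (0 < s)%N -> mean K (fun f => spread nz K th S s f ^+ #|S|) <= 1 + e s]].
Proof.
have [D [C [r [D0 C0 r01 hC]]]] := mean_nongeneric_bound.
have [t0 t1] := andP th01; have [h1 h2 U0] := dualK; have [r0 r1] := andP r01.
have K0 := dual_pair_gt0; have q0 : 0 <= q by exact: ler0n.
pose E s := expR (q * D%:R * geo s).
have E1 s : 1 <= E s by rewrite -[1]expR0 ler_expR; apply: mulr_ge0 => //; exact: mulr_ge0.
exists D, (E 0 + C), r, (fun s => E s + C * r ^+ s - 1); split => //.
- by split => //; rewrite addr_ge0 // expR_ge0.
- have -> : 0 = expR (q * D%:R * 0) + C * 0 - 1 :> R by rewrite !mulr0 expR0 addr0 subrr.
  apply: cvgB; last exact: cvg_cst.
  apply: cvgD; last by apply: cvgMl_tmp; apply: cvg_expr; rewrite ger0_norm ?ltW.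
  by apply: continuous_cvg; [exact: continuous_expR | apply: cvgMl_tmp].
move=> I S.
have hg s f : generic nz K D S f -> spread nz K th S s f ^+ #|S| <= E s.
  move=> gf; apply: le_trans (expr1D_geometric_le s #|S| q0 D0).
  by apply: lerXn2r; rewrite ?nnegrE ?spread_ge0 ?addr_ge0 ?mulr_ge0 ?exprn_ge0 ?(ltW t0) //; exact: spread_generic.
have split_mean s b : (forall f, f \in ffun_on (mem K) ->
    spread nz K th S s f ^+ #|S| <= E s + (~~ generic nz K D S f)%:R * b f) ->
    mean K (fun f => spread nz K th S s f ^+ #|S|) <=
     E s + mean K (fun f => (~~ generic nz K D S f)%:R * b f).
  move=> h; apply: le_trans (mean_le K0 h) _.
  by rewrite meanD (mean_cst (R := R) I K0).
split.
- move=> g gS; apply: le_trans (hC _ S g gS) _; apply: ler_wpM2r; first by rewrite exprn_ge0 // ltW.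
  by rewrite lerDr (le_trans ler01).
- apply: le_trans (split_mean 0 (fun f => spread nz K th S 0 f ^+ (#|S| - 0) * spread nz K th S 1 f ^+ 0) _) _.
    move=> f _; rewrite expr0 mulr1 subn0; case: (boolP (generic _ _ _ _ _)) => gf.
      by rewrite mul0r addr0; exact: hg.
    by rewrite mul1r lerDr (le_trans ler01).
  by rewrite lerD2l -[leRHS]mulr1 -(expr0 r) hC.
move=> s s0; rewrite addrC subrK.
(* A short block is controlled by the floor [s] alone. For a long one, the choice [g = #|S|] makes
   the nongeneric mean at most [C * r ^ #|S|], hence at most [C * r ^ s]. *)
case: (leqP (#|S| %/ D) s) => [Ss|sS].
  apply: le_trans (_ : E s <= _); last by rewrite lerDl mulr_ge0 // exprn_ge0 // ltW.
  rewrite -(mean_cst (R := R) I K0 (E s)); apply: mean_le => // f _.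
  apply: le_trans (expr1D_geometric_le s #|S| q0 D0).
  apply: lerXn2r; rewrite ?nnegrE ?spread_ge0 ?addr_ge0 ?mulr_ge0 ?exprn_ge0 ?(ltW t0) //.
  by apply: spread_le_uniform => // u _; rewrite geq_max leq_maxl (leq_trans Ss) // leq_maxl.
apply: le_trans (split_mean s (fun f => spread nz K th S 0 f ^+ (#|S| - #|S|) * spread nz K th S 1 f ^+ #|S|) _) _.
  move=> f _; rewrite subnn expr0 mul1r; case: (boolP (generic _ _ _ _ _)) => gf.
    by rewrite mul0r addr0; exact: hg.
  rewrite mul1r ler_wpDl ?(le_trans ler01) //.
  apply: lerXn2r; rewrite ?nnegrE ?spread_ge0 //; apply: spread_anti => // u _.
  by rewrite geq_max leq_maxr andbT (leq_trans s0) // leq_maxl.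
rewrite lerD2l; apply: le_trans (hC _ S _ (leqnn _)) _; apply: ler_wpM2l => //.
apply: ler_wiXn2l; rewrite ?ltW // (leq_trans (ltnW sS)) //; exact: leq_div.
Qed.

End BlockBounds.

(** * Staircase patterns *)

Lemma prod_le_class_powers (R : realType) (J Sig : finType) (free : {set J}) (key : J -> Sig)
    (X : J -> R) (cf : R) (c : Sig -> R) nf (n : Sig -> nat) :
  (forall j, 0 <= X j) -> 1 <= cf -> (forall b, 1 <= c b) ->
  (forall j, j \in free -> X j <= cf) -> (forall j, j \notin free -> X j <= c (key j)) ->
  (#|free| <= nf)%N -> (forall b, #|[set j | (j \notin free) && (key j == b)]| <= n b)%N ->
  \prod_j X j <= cf ^+ nf * \prod_b c b ^+ n b.
Proof.
move=> X0 cf1 c1 Xf Xc nfP nP; rewrite (bigID (mem free)) /=.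
apply: ler_pM; rewrite ?prodr_ge0 //.
  apply: (@le_trans _ _ (\prod_(j in free) cf)); first by apply: ler_prod => j jf; rewrite X0 Xf.
  by rewrite prodr_const; apply: ler_weXn2l.
rewrite (partition_big key predT) //=; apply: ler_prod => b _; rewrite prodr_ge0 //=.
apply: (@le_trans _ _ (\prod_(j in [set j | (j \notin free) && (key j == b)]) c b)).
  rewrite [leRHS](eq_bigl (fun j => (j \notin free) && (key j == b))); last by move=> j; rewrite inE.
  by apply: ler_prod => j /andP[jf /eqP <-]; rewrite X0 Xc.
by rewrite prodr_const; apply: ler_weXn2l.
Qed.

(* [sees j] are the possibly nonzero entries of column [j].  A column outside
   [free] is matched with a row, of which only the block [key j] is recorded. *)
Definition stair_pattern t N g (I J : finType) (sees : J -> {set I}) : Prop :=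
  exists (Sig : finType) (blk : I -> Sig) (b0 : Sig) (free : {set J}) (key : J -> Sig),
  let S b := [set i | blk i == b] in
  [/\ [/\ (#|Sig| <= N)%N, (g <= #|S b0|)%N & (#|free| <= g + t)%N],
      [/\ forall j, S b0 \subset sees j,
          forall j, j \in free -> sees j = finset.setT &
          forall j, j \notin free -> S (key j) \subset sees j],
      (#|[set j | (j \notin free) && (key j == b0)]| <= #|S b0| - g)%N &
      forall b, (#|[set j | (j \notin free) && (key j == b)]| <= #|S b|)%N].

Section Staircase.
Variables (R : realType) (V U : finType) (nz : U -> V -> bool) (K : {set V}) (th : R).
Hypothesis th01 : 0 < th < 1.
Hypothesis dualK : dual_pair nz K.

(** For [f] with values in [K], this says by duality that these values generate [K]. *)
Definition spans (I : finType) (f : {ffun I -> V}) :=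
  [forall u in ~: annihilator nz K, 0 < weight nz finset.setT f u]%N.

(** Every column sees the block [b0]. If [f] is generic there, all columns get a high floor and the
    mean is close to 1. Otherwise the rarity of such [f] and the [g] spare columns give a bound by a
    multiple of [r ^ g]. In both cases the blocks are disjoint, so the means multiply. *)
Lemma staircase_bound t N (delta : R) : 0 < delta -> exists g0, forall (I J : finType)
    (sees : J -> {set I}) g, (g0 <= g)%N -> stair_pattern t N g sees ->
  mean K (fun f => (spans f)%:R * (\prod_j spread nz K th (sees j) 0 f - 1)) <= delta.
Proof.
move=> d0; have [t0 t1] := andP th01; have [h1 h2 U0] := dualK.
have [D [C [r [e [[D0 C0] r01 ecvg hB]]]]] := block_bounds th01 dualK.
have K0 := dual_pair_gt0 dualK; have [r0 r1] := andP r01.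
set q := #|K|%:R : R; have q0 : 0 <= q by exact: ler0n.
have [E Ecvg hE] := expr1D_geometric_cvg th01 q0 D0.
(* [E s] will bound the [rho]-th power and the second factor the [t]-th power that come from free
   columns and columns matched with [b0]; each other block costs [1 + |e s|]. *)
pose h s := E s * (1 + q * th ^+ s) ^+ t * (1 + `|e s|) ^+ N.
have hcvg : (h s @[s --> \oo] --> (1 : R))%classic.
  suff : (h s @[s --> \oo] --> (1 : R) * (1 + q * 0) ^+ t * (1 + `|0 : R|) ^+ N)%classic.
    by rewrite mulr0 normr0 !addr0 !expr1n !mulr1.
  apply: cvgM; last first.
    apply: cvg_exprX.
    by apply: cvgD; [exact: cvg_cst | exact: cvg_norm].
  apply: cvgM => //.
  apply: cvg_exprX.
  apply: cvgD; first exact: cvg_cst.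
  by apply: cvgMl_tmp; apply: cvg_expr; rewrite ger0_norm ?ltW.
pose M := (1 + q) ^+ t * Num.max 1 C ^+ N * C.
have [s0 _ hs] : (\forall s \near \oo, h s < 1 + delta / 2)%classic.
  apply: cvgr_lt hcvg _ _; lra.
have [g1 _ hg] : (\forall g \near \oo, M * r ^+ g < delta / 2)%classic.
  have cv : (M * r ^+ g @[g --> \oo] --> M * 0)%classic.
    by apply: cvgMl_tmp; apply: cvg_expr; rewrite ger0_norm ?ltW.
  apply: cvgr_lt cv _ _; rewrite mulr0; lra.
exists (maxn (D * s0.+1) g1) => I J sees g.
rewrite geq_max => /andP[gs gg1] [Sig [blk [b0 [free [key pat]]]]].
pose S b := [set i | blk i == b].
case: pat; rewrite -/(S b0) => -[SN gS0 nfree] [seeS0 seefree seekey] nb0 nb.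
have {}seekey j : j \notin free -> S (key j) \subset sees j by exact: seekey.
have {}nb b : (#|[set j | (j \notin free) && (key j == b)]| <= #|S b|)%N by exact: nb.

set rho := #|S b0| in gS0 nb0 *; set s := (rho %/ D)%N.
have ss0 : (s0 < s)%N by rewrite leq_divRL // mulnC (leq_trans gs).
pose a b s' f := spread nz K th (S b) s' f.
have a1 b s' f : 1 <= a b s' f by exact: spread_ge1.
have a0 b s' f : 0 <= a b s' f by rewrite (le_trans ler01).
have qt1 : 1 <= 1 + q * th ^+ s by rewrite lerDl mulr_ge0 // exprn_ge0 // ltW.
(* [W] serves the generic case and [Z] the other one. The exponent [rho + t] adds up at most [g + t]
   free columns and at most [rho - g] columns matched with [b0]. *)
pose W f := (1 + q * th ^+ s) ^+ (rho + t) * \prod_(b | b != b0) a b s f ^+ #|S b|.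
pose Z f := (~~ generic nz K D (S b0) f)%:R * ((1 + q) ^+ t *
   (a b0 0%N f ^+ (rho - g) * a b0 1%N f ^+ g * \prod_(b | b != b0) a b 0%N f ^+ #|S b|)).
have sub_w b j f u : S b \subset sees j -> (weight nz (S b) f u <= weight nz (sees j) f u)%N.
  exact: weight_subset.
have W1 f : 1 <= W f.
  have p1 (P : pred Sig) (F : Sig -> R) : (forall b, 1 <= F b) -> 1 <= \prod_(b | P b) F b.
    move=> F1; apply: (big_ind (fun x => 1 <= x)) => // x y x1 y1.
    by rewrite -[leLHS]mulr1; apply: ler_pM.
  by rewrite -[leLHS]mulr1; apply: ler_pM; rewrite // ?exprn_ege1 // p1 // => b; rewrite exprn_ege1.
have Z0 f : 0 <= Z f.
  apply: mulr_ge0 => //; apply: mulr_ge0; first by rewrite exprn_ge0 // addr_ge0.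
  apply: mulr_ge0; first by apply: mulr_ge0; exact: exprn_ge0.
  by apply: prodr_ge0 => b _; exact: exprn_ge0.
have pointwise f : f \in ffun_on (mem K) ->
   (spans f)%:R * (\prod_j spread nz K th (sees j) 0 f - 1) <= W f - 1 + Z f.
  move=> fK; case: (boolP (spans f)) => [/forall_inP spf|_]; last first.
    by rewrite mul0r addr_ge0 // subr_ge0.
  rewrite mul1r /Z; case: (boolP (generic _ _ _ _ _)) => [/forall_inP gf|ngf] /=.
    rewrite mul0r addr0 lerB //.
    have wS0 u : u \notin annihilator nz K -> (s <= weight nz (S b0) f u)%N.
      by move=> uK; rewrite -(mulKn (weight nz (S b0) f u) D0) leq_div2r // gf // finset.in_setC.
    apply: (le_trans (@prod_le_class_powers R J Sig free key _ (1 + q * th ^+ s)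
      (fun b => if b == b0 then 1 + q * th ^+ s else a b s f) (g + t)
      (fun b => if b == b0 then rho - g else #|S b|)%N _ _ _ _ _ _ _)).
    - by move=> j; exact: spread_ge0.
    - exact: qt1.
    - by move=> b; case: ifP.
    - move=> j _; apply: spread_le_uniform => // u uK; rewrite max0n.
      by apply: leq_trans (wS0 u uK) (sub_w _ _ _ _ _).
    - move=> j jf; case: ifP => _; last first.
        apply: spread_anti => // u uK; rewrite max0n geq_max sub_w ?seekey // andbT.
        by apply: leq_trans (wS0 u uK) (sub_w _ _ _ _ _).
      apply: spread_le_uniform => // u uK; rewrite max0n.
      by apply: leq_trans (wS0 u uK) (sub_w _ _ _ _ _).
    - exact: nfree.
    - by move=> b; case: eqP => [->|].
    rewrite (bigD1 b0) //= eqxx mulrA -exprD.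
    have -> : (g + t + (rho - g) = rho + t)%N by lia.
    rewrite /W le_eqVlt; apply/orP; left; apply/eqP; congr (_ * _).
    by apply: eq_bigr => b /negbTE ->.
  rewrite mul1r; apply: (@le_trans _ _ (\prod_j spread nz K th (sees j) 0 f)); first by rewrite gerBl.
  apply: le_trans (_ : _ <= (1 + q) ^+ t *
    (a b0 0 f ^+ (rho - g) * a b0 1 f ^+ g * \prod_(b | b != b0) a b 0 f ^+ #|S b|)) _; last first.
    by rewrite lerDr subr_ge0.
  apply: (le_trans (@prod_le_class_powers R J Sig free key _ (a b0 1 f)
      (fun b => a b 0 f) (g + t) (fun b => if b == b0 then rho - g else #|S b|)%N _ _ _ _ _ _ _)).
  - by move=> j; exact: spread_ge0.
  - exact: a1.
  - by move=> b; exact: a1.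
  (* A free column sees all rows and [f] spans [K], so each nontrivial frequency is damped at least
     once: hence the floor 1. *)
  - move=> j jf; apply: spread_anti => // u uK; rewrite max0n geq_max sub_w // andbT.
    by rewrite (seefree _ jf); apply: spf; rewrite finset.in_setC.
  - by move=> j jf; apply: spread_anti => // u uK; rewrite !max0n sub_w ?seekey.
  - exact: nfree.
  - by move=> b; case: eqP => [->|].
  rewrite (bigD1 b0) //= eqxx exprD -!mulrA mulrCA; apply: ler_pM.
  - by rewrite exprn_ge0.
  - by rewrite !mulr_ge0 ?exprn_ge0 // prodr_ge0 // => b _; rewrite exprn_ge0.
  - apply: lerXn2r; [exact: a0 | by rewrite nnegrE addr_ge0 | ].
    exact: spread_le_card.
  rewrite mulrCA; apply: ler_wpM2l; first by rewrite exprn_ge0.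
  apply: ler_wpM2l; first by rewrite exprn_ge0.
  by rewrite le_eqVlt; apply/orP; left; apply/eqP; apply: eq_bigr => b /negbTE ->.
apply: le_trans (mean_le K0 pointwise) _.
have disS b1 b2 : b1 != b2 -> [disjoint S b1 & S b2].
  move=> b12; apply/pred0P => i /=; rewrite !inE; apply/negP => /andP[/eqP bi1 /eqP bi2].
  by rewrite -bi1 bi2 eqxx in b12.
have prod_mean (X : Sig -> {ffun I -> V} -> R) :
    (forall b, depends_on (S b) (X b)) -> mean K (fun f => \prod_b X b f) = \prod_b mean K (X b).
  by move=> XS; apply: (@mean_prod R I V K K0 Sig S X) => //; exact: index_enum_uniq.
have meanW : mean K W <= h s.
  rewrite /W meanZ exprD; apply: ler_pM.
  - by rewrite mulr_ge0 // exprn_ge0 // (le_trans ler01).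
  - by apply: mean_ge0 => // f; rewrite prodr_ge0 // => b _; rewrite exprn_ge0.
  - by apply: ler_wpM2r; [rewrite exprn_ge0 // (le_trans ler01) | exact: hE].
  under eq_mean do rewrite big_mkcond /=.
  rewrite prod_mean; last first.
    by move=> b f1 f2 ff; case: ifP => // _; congr (_ ^+ _); exact: spread_depends.
  apply: (@le_trans _ _ (\prod_(b : Sig) (1 + `|e s|))); last first.
    by rewrite prodr_const; apply: ler_weXn2l => //; rewrite lerDl.
  apply: ler_prod => b _; rewrite mean_ge0 //=; last first.
    by move=> f; case: ifP => // _; rewrite exprn_ge0.
  case: (b != b0); last by rewrite mean_cst // lerDl.
  have [_ _ hBs] := hB I (S b).
  by apply: le_trans (hBs s _) _; [exact: leq_trans ss0 | rewrite lerD2l ler_norm].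
have meanZ : mean K Z <= M * r ^+ g.
  pose X b f := if b == b0 then (~~ generic nz K D (S b0) f)%:R *
      (a b0 0%N f ^+ (rho - g) * a b0 1%N f ^+ g) else a b 0%N f ^+ #|S b|.
  have -> : mean K Z = (1 + q) ^+ t * mean K (fun f => \prod_b X b f).
    rewrite -meanZ; apply: eq_mean => f; rewrite /Z mulrCA; congr (_ * _).
    rewrite [RHS](bigD1 b0) //= {1}/X eqxx !mulrA; congr (_ * _).
    by apply: eq_bigr => b /negbTE bb; rewrite /X bb.
  rewrite prod_mean; last first.
    move=> b f1 f2 ff; rewrite /X; case: eqP => [bb|_].
      rewrite -bb; congr ((~~ _)%:R * (_ ^+ _ * _ ^+ _)); [exact: generic_depends | |];
        exact: spread_depends.
    by congr (_ ^+ _); exact: spread_depends.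
  rewrite /M -!mulrA; apply: ler_wpM2l; first by rewrite exprn_ge0 // addr_ge0.
  rewrite (bigD1 b0) //= mulrC; apply: ler_pM.
  - apply: prodr_ge0 => b bb; apply: mean_ge0 => // f.
    by rewrite /X (negbTE bb) exprn_ge0.
  - by apply: mean_ge0 => // f; rewrite /X eqxx !mulr_ge0 ?exprn_ge0.
  - apply: (@le_trans _ _ (\prod_(b | b != b0) Num.max 1 C)).
      apply: ler_prod => b bb; rewrite mean_ge0 //=; last first.
        by move=> f; rewrite /X (negbTE bb) exprn_ge0.
      have [_ hb _] := hB I (S b); rewrite le_max; apply/orP; right.
      by apply: le_trans hb; apply: mean_le => // f _; rewrite /X (negbTE bb).
    rewrite prodr_const; apply: ler_weXn2l; first by rewrite le_max lexx.
    by apply: leq_trans SN; exact: max_card.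
  have [hb _ _] := hB I (S b0).
  by apply: le_trans (hb g gS0); apply: mean_le => // f _; rewrite /X eqxx.
rewrite meanD meanD (mean_cst (R := R) I K0 (-1)).
have hs1 := hs s (ltnW ss0); have hg1 := hg g gg1.
by move: meanW meanZ hs1 hg1 => /=; lra.
Qed.

End Staircase.

(** * Characters and kernel probabilities *)

Section AdditiveCharacter.
Local Open Scope complex_scope.
Variables (R : realType) (N : nat).
Local Notation A := 'Z_N.

Lemma prim_root_exists (n : nat) : (n > 0)%N -> {z : R[i] | n.-primitive_root z}.
Proof.
move=> n_gt0; apply/sigW; pose P : {poly R[i]} := 'X^n - 1.
have [s Ps] := closed_field_poly_normal P.
rewrite (monicP _) ?monicXnsubC // scale1r in Ps.
have s1 : all n.-unity_root s by apply/allP => z; rewrite -root_prod_XsubC -Ps.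
have size_s : (n < (size s).+1)%N by rewrite -(size_prod_XsubC s id) -Ps size_XnsubC.
have [|z _ zP] := hasP (has_prim_root n_gt0 s1 _ size_s); last by exists z.
by rewrite -separable_prod_XsubC -Ps separable_Xn_sub_1 // pnatr_eq0 -lt0n.
Qed.

(** The order is the cardinality of ['Z_N] for every [N], and [N] itself when [N > 1]. *)
Definition zeta : R[i] := sval (prim_root_exists (isT : (0 < (Zp_trunc N).+2)%N)).

Lemma zeta_prim : ((Zp_trunc N).+2).-primitive_root zeta.
Proof. by rewrite /zeta; case: prim_root_exists. Qed.

Definition chi (a : A) : R[i] := zeta ^+ a.

Lemma chiD : {morph chi : a b / a + b >-> a * b}.
Proof. by move=> a b; rewrite /chi (prim_expr_mod zeta_prim) exprD. Qed.

Lemma chi_eq1 a : (chi a == 1) = (a == 0).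
Proof.
by rewrite /chi -(expr0 zeta) (eq_prim_root_expr zeta_prim) !modn_small.
Qed.

Lemma chi0 : chi 0 = 1.
Proof. by apply/eqP; rewrite chi_eq1. Qed.

Lemma norm_chi a : `|chi a| = 1.
Proof.
rewrite normrX; have /eqP z1 := prim_expr_order zeta_prim.
suff -> : `|zeta| = 1 by rewrite expr1n.
have := congr1 (fun z => `|z|) (eqP z1); rewrite normrX normr1 => /eqP.
by rewrite pexpr_eq1 // => /eqP.
Qed.

Lemma chi_conj a : (chi a)^* = chi (- a).
Proof.
have c0 : chi a != 0 by rewrite -normr_eq0 norm_chi oner_eq0.
apply: (mulfI c0); rewrite -chiD subrr chi0 -[_ * _]/(chi a * (chi a)^*).
by rewrite -sqr_normc norm_chi expr1n.
Qed.

Lemma Re_chi_lt1 a : a != 0 -> complex.Re (chi a) < 1.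
Proof.
move=> a0; have := norm_chi a; rewrite normc_def => -[] /eqP.
rewrite -[1 in X in X -> _]sqrtr1 eqr_sqrt ?addr_ge0 ?sqr_ge0 // => /eqP ReIm.
rewrite lt_neqAle; apply/andP; split.
  apply: contra a0 => /eqP Re1; rewrite -chi_eq1 eq_complex Re1 eqxx /=.
  by rewrite Re1 expr1n in ReIm; rewrite -sqrf_eq0 -(addrI _ (etrans ReIm (esym (addr0 1)))).
by have := sqr_ge0 (complex.Im (chi a)); nra.
Qed.

Lemma chi_gap : exists2 kappa : R, 0 < kappa <= 1 &
  forall a, a != 0 -> complex.Re (chi a) <= 1 - kappa.
Proof.
exists (\big[Num.min/1]_(a | a != 0) (1 - complex.Re (chi a))).
  apply/andP; split; last exact: bigmin_le_id.
  by apply: lt_bigmin => // a a0; rewrite subr_gt0 Re_chi_lt1.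
move=> a a0; rewrite lerBrDr -lerBrDl; exact: bigmin_le_cond.
Qed.

(** Translation by [h0] permutes [H] and multiplies the sum by [chi (psi h0)], which is not 1. *)
Lemma sum_chi_hom (V : finType) (H : {set V}) (add : V -> V -> V) (psi : V -> A) h0 :
  h0 \in H -> {in H, forall h, add h h0 \in H} -> injective (add^~ h0) ->
  (forall h, psi (add h h0) = psi h + psi h0) -> psi h0 != 0 ->
  \sum_(h in H) chi (psi h) = 0.
Proof.
move=> h0H addH addI psiD psi0.
have imH : [set add h h0 | h in H] = H.
  apply/eqP; rewrite eqEcard card_imset // leqnn andbT.
  by apply/fintype.subsetP => _ /imsetP[h hH ->]; exact: addH.
have : (chi (psi h0) - 1) * (\sum_(h in H) chi (psi h)) = 0.
  rewrite mulrBl mul1r -{2}imH big_imset /=; last by move=> x y _ _; exact: addI.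
  apply/eqP; rewrite subr_eq0 mulr_sumr; apply/eqP; apply: eq_bigr => h _.
  by rewrite psiD chiD mulrC.
by move/eqP; rewrite mulf_eq0 subr_eq0 chi_eq1 (negbTE psi0) => /eqP.
Qed.

End AdditiveCharacter.

(** In a finite group these are the subgroups: [add_closed_opp] recovers opposites, and
    [add_closed_scale] scalars in ['Z_N]. *)
Definition add_closed (V : nmodType) (H : {pred V}) : Prop :=
  0 \in H /\ {in H &, forall x y, x + y \in H}.

Section VectorDuality.
Local Open Scope complex_scope.
Variables (R : realType) (N r : nat).
Local Notation A := 'Z_N.
Implicit Types (u : 'rV[A]_r) (v : 'cV[A]_r) (H : {set 'cV[A]_r}).

Definition pairing u v : A := (u *m v) 0 0.
Definition nonorth u v : bool := pairing u v != 0.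

Lemma pairingDr u : {morph pairing u : v w / v + w}.
Proof. by move=> v w; rewrite /pairing mulmxDr mxE. Qed.
Lemma pairingDl v : {morph pairing^~ v : u w / u + w}.
Proof. by move=> u w; rewrite /pairing mulmxDl mxE. Qed.

Lemma pairing0r u : pairing u 0 = 0. Proof. by rewrite /pairing mulmx0 mxE. Qed.
Lemma pairing0l v : pairing 0 v = 0. Proof. by rewrite /pairing mul0mx mxE. Qed.

Lemma sum_chi_set u H : add_closed H ->
  \sum_(h in H) chi R (pairing u h) = (u \in annihilator nonorth H)%:R * #|H|%:R.
Proof.
case=> H0 HD; case: (boolP (u \in _)) => [|]; rewrite inE.
  move/forall_inP => uH; rewrite mul1r -sumr_const; apply: eq_bigr => h /uH.
  by rewrite negbK => /eqP ->; rewrite chi0.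
rewrite negb_forall => /existsP[h0]; rewrite negb_imply negbK => /andP[h0H uh0].
rewrite mul0r (@sum_chi_hom R N _ H (fun x y => x + y) (pairing u) h0) //.
- by move=> h hH; exact: HD.
- exact: addIr.
- by move=> h; rewrite pairingDr.
Qed.

Lemma sum_chi_dual v : \sum_u chi R (pairing u v) = (v == 0)%:R * #|{: 'rV[A]_r}|%:R.
Proof.
case: eqP => [->|/eqP v0].
  by rewrite mul1r -sumr_const; apply: eq_bigr => u _; rewrite pairing0r chi0.
have /cV0Pn[i vi] := v0.
rewrite mul0r (eq_bigl (fun u => u \in finset.setT)); last by move=> u; rewrite finset.in_setT.
apply: (@sum_chi_hom R N _ finset.setT (fun x y => x + y) (pairing^~ v) (delta_mx 0 i)).
- by rewrite finset.in_setT.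
- by move=> h _; rewrite finset.in_setT.
- exact: addIr.
- by move=> h; rewrite pairingDl.
- by rewrite /pairing -rowE mxE.
Qed.

(** Double counting: the sum of [chi (u v)] over all [u] and over [v] in [H] is evaluated in both
    orders by orthogonality. *)
Lemma card_annihilator H : add_closed H ->
  (#|H| * #|annihilator nonorth H| = #|{: 'rV[A]_r}|)%N.
Proof.
move=> HH; apply/eqP; rewrite -(eqr_nat R[i]); apply/eqP.
have : \sum_u \sum_(h in H) chi R (pairing u h) = \sum_(h in H) \sum_u chi R (pairing u h).
  exact: exchange_big.
rewrite (eq_bigr _ (fun u _ => sum_chi_set u HH)) (eq_bigr _ (fun v _ => sum_chi_dual v)).
rewrite -!mulr_suml -!natr_sum -!natrM.
rewrite (eq_bigr (fun u => if u \in annihilator nonorth H then 1 else 0)%N); last first.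
  by move=> u _; case: (u \in _).
rewrite -big_mkcond sum1_card mulnC => ->; congr _%:R.
rewrite (bigD1 0) ?(proj1 HH) //= eqxx big1 ?addn0 ?mul1n //.
by move=> v /andP[_ /negbTE ->].
Qed.

Lemma add_closed_orth_in (K : {set 'cV[A]_r}) B : add_closed K -> add_closed (orth_in nonorth K B).
Proof.
case=> K0 KD; split.
  by rewrite inE K0; apply/forall_inP => u _; rewrite /nonorth pairing0r eqxx.
move=> v w; rewrite !inE => /andP[vK /forall_inP vB] /andP[wK /forall_inP wB].
rewrite KD //; apply/forall_inP => u uB; rewrite /nonorth pairingDr.
by have /eqP-> := negbNE (vB u uB); rewrite add0r; exact: wB.
Qed.

Lemma dual_pair_vectors (K : {set 'cV[A]_r}) : add_closed K -> dual_pair nonorth K.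
Proof.
move=> KK; split.
- by move=> B; apply: card_annihilator; exact: add_closed_orth_in.
- move=> B v vK; rewrite inE vK negb_forall => /existsP[u0].
  rewrite negb_imply negbK => /andP[u0B u0v].
  set X := annihilator _ _; set Y := [set u in X | _].
  have u0X : u0 \in X.
    by rewrite inE; apply/forall_inP => h; rewrite inE => /andP[_ /forall_inP]; apply.
  have YX : Y \subset X by apply/fintype.subsetP => u; rewrite inE => /andP[].
  rewrite mul2n -addnn -(cardsID Y X) (finset.setIidPr YX) leq_add2l.
  (* Translation by [u0], which is nontrivial on [v], maps [Y] into its complement in [X]. *)
  rewrite -(card_imset (mem Y) (addIr u0)); apply/subset_leq_card/fintype.subsetP => _ /imsetP[u uY ->].
  move: uY u0X; rewrite finset.in_setD !inE => /andP[/forall_inP uX /negbNE/eqP uv] /forall_inP u0X.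
  apply/andP; split.
    by rewrite negb_and; apply/orP; right; rewrite negbK /nonorth pairingDl uv add0r.
  apply/forall_inP => h hH; rewrite /nonorth pairingDl.
  by have /eqP-> := negbNE (uX h hH); rewrite add0r; exact: u0X.
- by apply/card_gt0P; exists 0.
Qed.

End VectorDuality.

Section FourierDecay.
Local Open Scope complex_scope.
Variables (R : realType) (N : nat).
Local Notation A := 'Z_N.

Definition is_pmf (T : finType) (mu : T -> R) : Prop :=
  (forall a, 0 <= mu a) /\ \sum_a mu a = 1.

(** Being balanced modulo [p] implies this modulo every [p ^ (m + 1)]: for [c != 0],
    [c * b == c * a] forces [a] and [b] to agree modulo [p]. *)
Definition spread_out (eps : R) (mu : A -> R) : Prop :=
  forall c a, c != 0 -> \sum_(b | c * b == c * a) mu b <= 1 - eps.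

Definition fourier (mu : A -> R) (c : A) : R[i] := \sum_b (mu b)%:C * chi R (c * b).

Lemma real_complex_sum (I : finType) (P : pred I) (F : I -> R) :
  (\sum_(i | P i) F i)%:C = \sum_(i | P i) (F i)%:C.
Proof. exact: raddf_sum. Qed.

Lemma Re_sum (I : finType) (P : pred I) (F : I -> R[i]) :
  complex.Re (\sum_(i | P i) F i) = \sum_(i | P i) complex.Re (F i).
Proof. by apply: (big_morph (@complex.Re R)) => // -[a b] [c d]. Qed.

Lemma fourier0 mu : is_pmf mu -> fourier mu 0 = 1.
Proof.
case=> _ mu1; rewrite /fourier; under eq_bigr do rewrite mul0r chi0 mulr1.
by rewrite -real_complex_sum mu1.
Qed.

Lemma norm_fourier_le1 mu c : is_pmf mu -> `|fourier mu c| <= 1.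
Proof.
case=> mu0 mu1; apply: le_trans (ler_norm_sum _ _ _) _.
have -> : 1 = (\sum_b mu b)%:C by rewrite mu1.
rewrite real_complex_sum; apply: ler_sum => b _.
by rewrite normrM norm_chi mulr1 ger0_norm // ler0c.
Qed.

(* The squared modulus is the mean of [cos] at the difference of two independent copies. *)
Lemma fourier_decay eps : 0 < eps < 1 -> exists2 th : R, 0 < th < 1 &
  forall mu c, is_pmf mu -> spread_out eps mu -> c != 0 -> `|fourier mu c| <= th%:C.
Proof.
case/andP=> e0 e1; have [k /andP[k0 k1] hk] := chi_gap R N.
have ke0 : 0 < k * eps by rewrite mulr_gt0.
have ke1 : k * eps < 1 by apply: le_lt_trans e1; rewrite ler_piMl // ltW.
(* The square of this number is at least [1 - k * eps], the bound obtained for the squared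
   modulus. *)
exists (1 - k * eps / 2); first by apply/andP; split; lra.
move=> mu c [mu0 mu1] sp c0; set z := fourier mu c.
set x := complex.Re `|z|; have zx : `|z| = x%:C by rewrite RRe_real // normr_real.
rewrite zx lecR; have x0 : 0 <= x by rewrite -ler0c -zx.
suff x2 : x ^+ 2 <= 1 - k * eps.
  have th0 : 0 <= 1 - k * eps / 2 by lra.
  by rewrite -(ler_pXn2r (n := 2)) ?nnegrE //; nra.
have -> : x ^+ 2 = \sum_a \sum_b mu a * mu b * complex.Re (chi R (c * a - c * b)).
  have -> : x ^+ 2 = complex.Re (z * conjc z).
    by rewrite -sqr_normc zx -rmorphXn.
  have cj b : conjc ((mu b)%:C * chi R (c * b)) = (mu b)%:C * chi R (- (c * b)).
    by rewrite -chi_conj -[in RHS](conjc_real (mu b)) -[RHS](rmorphM (@conjc R)).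
  rewrite {1}/z /fourier rmorph_sum /= big_distrlr /= Re_sum; apply: eq_bigr => a _.
  rewrite Re_sum; apply: eq_bigr => b _.
  rewrite cj mulrACA -chiD.
  by rewrite -rmorphM /=; case: (chi _ _) => u v /=; rewrite mul0r subr0.
apply: (@le_trans _ _ (\sum_a mu a * (1 - k * eps))); last by rewrite -mulr_suml mu1 mul1r.
apply: ler_sum => a _; rewrite (eq_bigr _ (fun b _ => esym (mulrA _ _ _))) -mulr_sumr.
apply: ler_wpM2l => //.
rewrite (bigID (fun b => c * b == c * a)) /=.
(* Given [a], the second copy agrees with it after multiplication by [c] with probability
   [s1 <= 1 - eps]; otherwise the real part is at most [1 - k]. *)
set s1 := \sum_(b | c * b == c * a) mu b.
have s1e : s1 <= 1 - eps by exact: sp.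
apply: (@le_trans _ _ (s1 + (1 - s1) * (1 - k))); last first.
  have : 0 <= k * (1 - eps - s1) by rewrite mulr_ge0 ?(ltW k0) // subr_ge0.
  by nra.
apply: lerD.
  by apply: ler_sum => b /eqP ->; rewrite subrr chi0 mulr1.
have -> : 1 - s1 = \sum_(b | c * b != c * a) mu b.
  by apply/eqP; rewrite subr_eq addrC -mu1 [X in X == _](bigID (fun b => c * b == c * a)).
rewrite mulr_suml; apply: ler_sum => b cb; apply: ler_wpM2l => //.
by apply: hk; rewrite subr_eq0 eq_sym.
Qed.

End FourierDecay.

(** Each term in the expansion of the product of the [1 + (y j - 1)] is bounded separately. *)
Lemma norm_prod_sub1_le (R : realType) (J : finType) (y e : J -> R) :
  (forall j, `|y j - 1| <= e j) -> `|\prod_j y j - 1| <= \prod_j (1 + e j) - 1.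
Proof.
move=> ye; have e0 j : 0 <= e j by exact: le_trans (ye j).
apply: (big_rec2 (fun a b => `|a - 1| <= b - 1)); first by rewrite !subrr normr0.
move=> j a b _ IH.
have -> : y j * a - 1 = (y j - 1) * (a - 1) + (y j - 1) + (a - 1) by ring.
have -> : (1 + e j) * b - 1 = e j * (b - 1) + e j + (b - 1) by ring.
do 2![apply: le_trans (ler_normD _ _) _; apply: lerD => //].
by rewrite normrM; apply: ler_pM.
Qed.

Section KernelProbability.
Local Open Scope complex_scope.
Variables (R : realType) (N r : nat) (I : finType).
Local Notation A := 'Z_N.
Local Notation V := ('cV[A]_r).
Local Notation U := ('rV[A]_r).

(** The probability that the combination of the [f i] with independent coefficients of laws [mu i]
    is 0: the factor of one matrix column in the probability of [F M = 0]. *)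
Definition kernel_prob (mu : I -> A -> R) (f : {ffun I -> V}) : R :=
  \sum_(a : {ffun I -> A}) (\prod_i mu i (a i)) * (\sum_i a i *: f i == 0)%:R.

Lemma kernel_prob_fourier mu f :
  (kernel_prob mu f)%:C = #|{: U}|%:R^-1 * \sum_u \prod_i fourier (mu i) (pairing u (f i)).
Proof.
have U0 : #|{: U}|%:R != 0 :> R[i].
  by rewrite pnatr_eq0 -lt0n; apply/card_gt0P; exists 0.
apply: (mulfI U0); rewrite mulVKf //.
under [RHS]eq_bigr => u _ do rewrite /fourier bigA_distr_bigA /=.
rewrite exchange_big /= real_complex_sum mulr_sumr; apply: eq_bigr => a _.
rewrite rmorphM /= rmorph_prod rmorph_nat mulrCA [_%:R * _]mulrC -sum_chi_dual mulr_sumr.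
apply: eq_bigr => u _; rewrite big_split /=; congr (_ * _).
rewrite (big_morph (pairing u) (pairingDr u) (pairing0r u)).
rewrite (big_morph (@chi R N) (@chiD R N) (chi0 R N)); apply: eq_bigr => i _.
by rewrite /pairing -scalemxAr mxE mulrC.
Qed.

(** The characters trivial on [K] contribute exactly [1 / #|K|]. In the others, an entry in [sees]
    at which the character is nontrivial gives a factor at most [th], and any other entry at most
    1. *)
Lemma kernel_prob_bound (K : {set V}) (th eps : R) (mu : I -> A -> R) (f : {ffun I -> V})
    (sees : {set I}) :
  (forall (mu : A -> R) c, is_pmf mu -> spread_out eps mu -> c != 0 -> `|fourier mu c| <= th%:C) ->
  0 < th < 1 ->
  add_closed K -> (forall i, is_pmf (mu i)) -> (forall i, i \in sees -> spread_out eps (mu i)) ->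
  f \in ffun_on (mem K) ->
  `|kernel_prob mu f * #|K|%:R - 1| <= spread (@nonorth N r) K th sees 0 f - 1.
Proof.
move=> hth th01 KK pmu smu fK; have [t0 t1] := andP th01.
have [h1 h2 U0] := dual_pair_vectors R KK; have K0 := dual_pair_gt0 (dual_pair_vectors R KK).
have cK := card_annihilator R KK.
set q := #|K|%:R : R; set Q := #|{: U}|%:R : R.
have q0 : 0 < q by rewrite ltr0n.
have Q0 : 0 < Q by rewrite ltr0n.
rewrite [X in _ <= X]addrAC subrr add0r -lecR.
set W := annihilator _ K in cK *.
set F := fun u => \prod_i fourier (mu i) (pairing u (f i)).
set S := \sum_(u in ~: W) F u.
have Qc0 : Q%:C != 0 by rewrite (inj_eq (@complexI R)) gt_eqF.
have kQ : (kernel_prob mu f)%:C * Q%:C = #|W|%:R + S.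
  rewrite kernel_prob_fourier rmorph_nat mulrC mulVKf -?(rmorph_nat (real_complex R)) //.
  rewrite (bigID (mem W)) /=; congr (_ + _); last by apply: eq_bigl => u; rewrite finset.in_setC.
  rewrite rmorph_nat -sumr_const; apply: eq_bigr => u; rewrite inE => /forall_inP uK.
  rewrite /F big1 // => i _.
  by have /eqP -> := negbNE (uK _ (ffun_onP fK i)); exact: fourier0.
have qW : q%:C * #|W|%:R = Q%:C.
  by rewrite -(rmorph_nat (real_complex R)) -rmorphM /= -natrM cK.
have -> : (`|kernel_prob mu f * q - 1|)%:C = `|(q / Q)%:C * S|.
  have -> (x : R) : `|x|%:C = `|x%:C| by rewrite normc_def /= expr0n addr0 sqrtr_sqr.
  congr (`|_|); apply: (mulIf Qc0).
  rewrite rmorphB !rmorphM /= fmorphV [RHS]mulrAC divfK //.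
  have -> : ((kernel_prob mu f)%:C * q%:C - 1) * Q%:C =
      q%:C * ((kernel_prob mu f)%:C * Q%:C) - Q%:C by ring.
  by rewrite kQ mulrDr qW addrAC subrr add0r.
rewrite normrM ger0_norm; last by rewrite ler0c divr_ge0 // ltW.
rewrite [X in _ <= X]rmorphM /=; apply: ler_wpM2l.
  by rewrite ler0c divr_ge0 // ltW.
rewrite real_complex_sum; apply: le_trans (ler_norm_sum _ _ _) _; apply: ler_sum => u _.
rewrite max0n /F normr_prod (bigID (fun i => (i \in sees) && nonorth u (f i))) /=.
rewrite rmorphXn /= -[X in _ <= X]mulr1; apply: ler_pM; rewrite ?prodr_ge0 //.
  apply: le_trans (_ : \prod_(i in [set i in sees | nonorth u (f i)]) th%:C <= _).
    rewrite [X in _ <= X](eq_bigl (fun i => (i \in sees) && nonorth u (f i))); last by move=> i; rewrite inE.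
    by apply: ler_prod => i /andP[si nzi]; rewrite normr_ge0 (hth _ _ (pmu i) (smu i si)).
  by rewrite prodr_const.
by apply: prodr_ile1 => i _; rewrite normr_ge0 norm_fourier_le1.
Qed.

End KernelProbability.

(** After multiplication by [#|K| ^ #|J|], the product over [j] is within [\prod_j spread - 1] of 1.
    As [#|J| = #|I| + t], the total is at most the mean of [staircase_bound] times [#|K| ^- t]. *)
Lemma kernel_prob_total (R : realType) N r (K : {set 'cV['Z_N]_r}) (eps delta : R) t b :
  add_closed K -> 0 < eps < 1 -> 0 < delta -> exists g0, forall (I J : finType)
    (sees : J -> {set I}) g (mu : J -> I -> 'Z_N -> R),
  (g0 <= g)%N -> stair_pattern t b g sees -> #|J| = (#|I| + t)%N ->
  (forall j i, is_pmf (mu j i)) -> (forall j i, i \in sees j -> spread_out eps (mu j i)) ->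
  \sum_(f in ffun_on (mem K) | spans (@nonorth N r) K f)
    `|\prod_j kernel_prob (mu j) f - (#|K|%:R ^- #|J|)| <= delta.
Proof.
move=> KK eps01 d0; have [th th01 hth] := fourier_decay N eps01.
have [g0 hg0] := staircase_bound th01 (dual_pair_vectors R KK) t b d0.
exists g0 => I J sees g mu gg0 pat cJ pmu smu.
have K0 := dual_pair_gt0 (dual_pair_vectors R KK).
have q0 : 0 < #|K|%:R :> R by rewrite ltr0n.
set X := fun f => (spans (@nonorth N r) K f)%:R * (\prod_j spread (@nonorth N r) K th (sees j) 0 f - 1).
have X0 f : 0 <= X f.
  apply: mulr_ge0 => //; rewrite subr_ge0.
  apply: (big_ind (fun x => 1 <= x)) => // [x y x1 y1|j _].
    by rewrite -[leLHS]mulr1; apply: ler_pM.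
  by have [h1 h2 U0] := dual_pair_vectors R KK; exact: spread_ge1.
apply: le_trans (hg0 I J sees g gg0 pat); rewrite -/X /mean.
apply: (@le_trans _ _ (\sum_(f in ffun_on (mem K)) X f * #|K|%:R ^- #|J|)); last first.
  rewrite -mulr_suml; apply: ler_wpM2l; first exact: sumr_ge0.
  rewrite lef_pV2 ?posrE ?exprn_gt0 // cJ; apply: ler_weXn2l; last exact: leq_addr.
  by rewrite ler1n.
rewrite big_mkcondr; apply: ler_sum => f fK.
case: ifP => spf; last by rewrite mulr_ge0 // invr_ge0 exprn_ge0 // ltW.
rewrite /X spf mul1r; set y := fun j => kernel_prob (mu j) f * #|K|%:R.
have -> : \prod_j kernel_prob (mu j) f - (#|K|%:R ^- #|J|) = (\prod_j y j - 1) * #|K|%:R ^- #|J|.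
  rewrite big_split /= prodr_const mulrBl mul1r mulfK // expf_neq0 //.
  by rewrite gt_eqF.
rewrite normrM [X in _ * X]ger0_norm; last by rewrite invr_ge0 exprn_ge0 // ltW.
apply: ler_wpM2r.
  by rewrite invr_ge0 exprn_ge0 // ltW.
have h j : `|y j - 1| <= spread (@nonorth N r) K th (sees j) 0 f - 1.
  by apply: (kernel_prob_bound hth) => // i si; exact: smu.
apply: le_trans (norm_prod_sub1_le h) _.
rewrite (eq_bigr (fun j => spread (@nonorth N r) K th (sees j) 0 f)) // => j _.
by rewrite addrCA subrr addr0.
Qed.

(** * The pattern of a staircase of zeros *)

(** Column [j < n - g] is matched with row [n - g - 1 - j], and a block consists of the rows meeting
    the same steps. A step [l] hiding a row of that block from column [j] would have
    [n - g - 1 - j < alpha l] and [j < beta l], so [n - g < alpha l + beta l], against the gap. The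
    columns from [n - g] on meet no step, nor do the last [g] rows, which stay unmatched. *)
Lemma stair_pattern_in_stairs n t k g (alpha beta : nat -> nat) : (0 < k)%N ->
  (forall l, (1 <= l <= k)%N -> (alpha l + beta l + g <= n)%N) ->
  stair_pattern t (2 ^ k) g
    (fun j : 'I_(n + t) => [set i : 'I_n | ~~ in_stairs k alpha beta i j]).
Proof.
move=> k0 gap; pose sig (x : nat) : {set 'I_k} := [set l : 'I_k | (x < alpha l.+1)%N].
have gap' (l : 'I_k) : (alpha l.+1 + beta l.+1 + g <= n)%N by apply: gap; rewrite /= ltn_ord.
have gn : (g <= n)%N by apply: leq_trans (gap' (Ordinal k0)); exact: leq_addl.
have stairsP i j : reflect (exists l : 'I_k, (i < alpha l.+1)%N /\ (j < beta l.+1)%N)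
    (in_stairs k alpha beta i j).
  apply: (iffP hasP) => [[l] | [l [li lj]]].
    rewrite mem_iota => /andP[l1 lk] /andP[li lj].
    have lk' : (l.-1 < k)%N by lia.
    by exists (Ordinal lk'); rewrite /= prednK.
  by exists l.+1; rewrite ?li ?lj // mem_iota /= add1n ltnS ltn_ord.
have sig_top (i : nat) : (n - g <= i)%N -> sig i = finset.set0.
  move=> ni; apply/setP => l; rewrite !inE; apply/negbTE; rewrite -leqNgt.
  by have := gap' l; lia.
pose free : {set 'I_(n + t)} := [set j : 'I_(n + t) | (n - g <= j)%N].
pose key (j : 'I_(n + t)) := sig (n - g - j.+1)%N.
pose S b := [set i : 'I_n | sig i == b].
have hlt (i : 'I_n) : (n - g - i.+1 < n + t)%N by have := ltn_ord i; lia.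
pose h i := Ordinal (hlt i).
have matched b : (#|[set j | (j \notin free) && (key j == b)]|
    <= #|[set i in S b | (i < n - g)%N]|)%N.
  apply: leq_trans (leq_imset_card h _); apply/subset_leq_card/fintype.subsetP => j.
  rewrite !inE -ltnNge => /andP[jn kj].
  have jlt : (n - g - j.+1 < n)%N by lia.
  apply/imsetP; exists (Ordinal jlt); last by apply: val_inj => /=; lia.
  by rewrite !inE /= kj /=; lia.
exists {set 'I_k}, (fun i : 'I_n => sig i), finset.set0, free, key; rewrite -/(S _); split.
- split.
  + by rewrite -(finset.cardsT {set 'I_k}) -finset.powersetT finset.card_powerset finset.cardsT card_ord.
  + have ilt (i : 'I_g) : (n - i.+1 < n)%N by have := ltn_ord i; lia.
    rewrite -[g in (g <= _)%N]card_ord -(card_imset predT (f := fun i => Ordinal (ilt i))); last first.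
      by move=> i1 i2 /(congr1 val) /= e; apply: val_inj => /=; have := ltn_ord i1; have := ltn_ord i2; lia.
    apply/subset_leq_card/fintype.subsetP => _ /imsetP[i _ ->].
    by rewrite inE /= sig_top //; have := ltn_ord i; lia.
  + have ilt (i : 'I_(g + t)) : (n - g + i < n + t)%N by have := ltn_ord i; lia.
    apply: (@leq_trans #|[set Ordinal (ilt i) | i : 'I_(g + t)]|); last first.
      by rewrite (leq_trans (leq_imset_card _ _)) // card_ord.
    apply/subset_leq_card/fintype.subsetP => j; rewrite inE => jn.
    have jlt : (j - (n - g) < g + t)%N by have := ltn_ord j; lia.
    by apply/imsetP; exists (Ordinal jlt) => //; apply: val_inj => /=; lia.
- split.
  + move=> j; apply/fintype.subsetP => i; rewrite !inE => /eqP si; apply/stairsP => -[l [li _]].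
    by have : l \in sig i by [rewrite inE]; rewrite si inE.
  + move=> j; rewrite inE => nj; apply/setP => i; rewrite !inE; apply/stairsP => -[l [_ lj]].
    by have := gap' l; lia.
  + move=> j; rewrite inE -ltnNge => jn; apply/fintype.subsetP => i; rewrite !inE => /eqP si.
    apply/stairsP => -[l [li lj]]; have : l \in sig (n - g - j.+1)%N by rewrite -[sig _]si inE.
    by rewrite inE; have := gap' l; lia.
- have : (#|[set i in S finset.set0 | (i < n - g)%N]| + g <= #|S finset.set0|)%N.
    have ilt (i : 'I_g) : (n - i.+1 < n)%N by have := ltn_ord i; lia.
    rewrite -[g in (_ + g <= _)%N]card_ord -(card_imset predT (f := fun i => Ordinal (ilt i))); last first.
      by move=> i1 i2 /(congr1 val) /= e; apply: val_inj => /=; have := ltn_ord i1; have := ltn_ord i2; lia.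
    rewrite -[leqRHS](cardsID [set i : 'I_n | (i < n - g)%N]); apply: leq_add.
      by apply/subset_leq_card/fintype.subsetP => i; rewrite !inE.
    apply/subset_leq_card/fintype.subsetP => _ /imsetP[i _ ->].
    rewrite !inE /= sig_top ?eqxx ?andbT; first by have := ltn_ord i; lia.
    by have := ltn_ord i; lia.
  move=> cS; apply: leq_trans (matched finset.set0) _.
  by apply: leq_trans (leq_sub2r g cS); rewrite addnK.
- move=> b; apply: leq_trans (matched b) _.
  by apply/subset_leq_card/fintype.subsetP => i; rewrite inE => /andP[].
Qed.

(** * Linear algebra over Z/p^(m+1) *)

Section AdditiveFibers.
Variables (V W : finZmodType) (H : {set V}).
Hypothesis addH : add_closed H.

Lemma add_closed_image_addr x : x \in H -> [set h + x | h in H] = H.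
Proof.
move=> xH; apply/eqP; rewrite eqEcard card_imset ?leqnn ?andbT; last exact: addIr.
by apply/fintype.subsetP => _ /imsetP[h hH ->]; exact: (proj2 addH).
Qed.

Lemma add_closed_opp x : x \in H -> - x \in H.
Proof.
move=> xH; have := proj1 addH; rewrite -{1}(add_closed_image_addr xH) => /imsetP[h hH].
by move/eqP; rewrite eq_sym addr_eq0 => /eqP <-.
Qed.

Lemma add_closed_sub x y : x \in H -> y \in H -> x - y \in H.
Proof. by move=> xH yH; apply: (proj2 addH) => //; exact: add_closed_opp. Qed.

Lemma card_additive_fibers (f : {additive V -> W}) :
  #|H| = (#|f @: H| * #|[set x in H | f x == 0%R]|)%N.
Proof.
rewrite -sum1_card (partition_big f (mem (f @: H))) /=; last first.
  by move=> x xH; exact: imset_f.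
rewrite -sum_nat_const; apply: eq_bigr => _ /imsetP[x0 x0H ->].
rewrite sum1_card -[RHS](card_imset _ (addIr x0)); apply: eq_card => x.
rewrite -[LHS]/((x \in H) && (f x == f x0)); apply/andP/imsetP => [[xH /eqP fx]|[y]].
  by exists (x - x0); [rewrite inE add_closed_sub // raddfB fx subrr /= | rewrite subrK].
rewrite inE => /andP[yH /eqP fy] ->; rewrite raddfD fy add0r.
by split=> //; exact: (proj2 addH).
Qed.

End AdditiveFibers.

Section PrimePowerRing.
Variables (p m : nat).
Hypothesis p_prime : prime p.
Local Notation A := 'Z_(p ^ m.+1).

Let p1 : (1 < p)%N. Proof. exact: prime_gt1. Qed.
Let P1 : (1 < p ^ m.+1)%N. Proof. by rewrite -(exp1n m.+1) ltn_exp2r. Qed.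
Let modA : (Zp_trunc (p ^ m.+1)).+2 = (p ^ m.+1)%N. Proof. exact: Zp_cast. Qed.

Lemma natr_Zpp_eq0 k : (k%:R == 0 :> A) = (p ^ m.+1 %| k)%N.
Proof. by rewrite -val_eqE /= val_Zp_nat. Qed.

Lemma card_Zpp : #|{: A}| = (p ^ m.+1)%N.
Proof. by rewrite card_ord. Qed.

Lemma pexp_mul_eq0 i (a : A) : (i <= m.+1)%N ->
  ((p ^ i)%:R * a == 0) = (p ^ (m.+1 - i) %| a)%N.
Proof.
move=> im; rewrite -{1}(natr_Zp a) -natrM natr_Zpp_eq0.
by rewrite -{1}(subnKC im) expnD dvdn_pmul2l // expn_gt0 ltnW.
Qed.

Lemma pexp_mul_eq0_div i (a : A) : (i <= m.+1)%N -> (p ^ i)%:R * a = 0 ->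
  exists b : A, a = (p ^ (m.+1 - i))%:R * b.
Proof.
move=> im /eqP; rewrite pexp_mul_eq0 // => /dvdnP[k ak].
by exists k%:R; rewrite -natrM mulnC -ak natr_Zp.
Qed.

Lemma unit_of_pexp_mul_neq0 (a : A) : (p ^ m)%:R * a != 0 -> a \is a GRing.unit.
Proof.
rewrite pexp_mul_eq0 // subSnn expn1 => pa; rewrite -(natr_Zp a) unitZpE //.
by rewrite coprimeXl // prime_coprime.
Qed.

Lemma card_pexp_torsion i : (i <= m.+1)%N ->
  #|[set a : A | (p ^ i)%:R * a == 0]| = (p ^ i)%N.
Proof.
move=> im; have p0 : (0 < p ^ (m.+1 - i))%N by rewrite expn_gt0 ltnW.
pose h (j : 'I_(p ^ i)) : A := (p ^ (m.+1 - i) * j)%:R.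
have hv j : (h j : nat) = (p ^ (m.+1 - i) * j)%N.
  rewrite /h val_Zp_nat // modn_small //.
  have -> : (p ^ m.+1 = p ^ (m.+1 - i) * p ^ i)%N by rewrite -expnD subnK.
  by rewrite ltn_pmul2l.
rewrite -[RHS]card_ord -(card_imset predT (f := h)); last first.
  move=> j1 j2 /(congr1 val) /=; rewrite !hv => /eqP.
  by rewrite eqn_pmul2l // => /eqP /val_inj.
apply: eq_card => a; rewrite inE pexp_mul_eq0 //; apply/idP/imsetP => [/dvdnP[k ak]|[j _ ->]].
  have kp : (k < p ^ i)%N.
    by rewrite -(ltn_pmul2r p0) -ak -expnD subnKC // -{2}modA ltn_ord.
  by exists (Ordinal kp) => //; apply: val_inj; rewrite /= hv ak mulnC.
by rewrite hv dvdn_mulr.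
Qed.

Lemma card_mx_pexp_torsion i a b : (i <= m.+1)%N ->
  #|[set x : 'M[A]_(a, b) | (p ^ i)%:R *: x == 0]| = (p ^ (i * (a * b)))%N.
Proof.
move=> im; set B := [set y : A | (p ^ i)%:R * y == 0].
pose h (f : {ffun 'I_a * 'I_b -> A}) : 'M[A]_(a, b) := \matrix_(i, j) f (i, j).
have hI : injective h.
  by move=> f g /matrixP fg; apply/ffunP => -[x y]; have := fg x y; rewrite !mxE.
have <- : #|(ffun_on (mem B) : {pred {ffun 'I_a * 'I_b -> A}})| = (p ^ (i * (a * b)))%N.
  by rewrite card_ffun_on card_pexp_torsion // card_prod !card_ord -!expnM mulnA.
rewrite -[RHS](card_imset _ hI); apply: eq_card => x; rewrite inE.
apply/eqP/imsetP => [/matrixP x0|[f /ffun_onP fB ->]].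
  exists [ffun ij => x ij.1 ij.2].
    by apply/ffun_onP => -[k l]; rewrite ffunE inE; have := x0 k l; rewrite !mxE => ->.
  by apply/matrixP => k l; rewrite mxE ffunE.
by apply/matrixP => k l; rewrite !mxE; have := fB (k, l); rewrite inE => /eqP.
Qed.

Lemma card_mx_Zpp a b : #|{: 'M[A]_(a, b)}| = (p ^ (m.+1 * (a * b)))%N.
Proof. by rewrite card_mx card_Zpp -!expnM mulnA. Qed.

Lemma mx_pexp_torsion_div i a b (x : 'M[A]_(a, b)) : (i <= m.+1)%N ->
  (p ^ i)%:R *: x = 0 -> exists y, x = (p ^ (m.+1 - i))%:R *: y.
Proof.
move=> im /matrixP x0; exists (\matrix_(k, l) ((x k l : nat) %/ p ^ (m.+1 - i))%N%:R).
apply/matrixP => k l; rewrite !mxE -natrM mulnC.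
have /eqP := x0 k l; rewrite !mxE pexp_mul_eq0 // => /divnK ->.
by rewrite natr_Zp.
Qed.

Lemma pexp_scale_eq0 a b (x : 'M[A]_(a, b)) : (p ^ m.+1)%:R *: x = 0.
Proof.
have /eqP -> : (p ^ m.+1)%:R == 0 :> A by rewrite natr_Zpp_eq0.
exact: scale0r.
Qed.

End PrimePowerRing.

Section IndependentTuples.
Variables (p m n : nat).
Hypothesis p_prime : prime p.
Local Notation A := 'Z_(p ^ m.+1).
Variables Lam Lam0 : {set 'rV[A]_n}.
Hypothesis addLam0 : add_closed Lam0.
Hypothesis addLam : add_closed Lam.
Hypothesis scaleLam0 : forall a : A, {in Lam0, forall u, a *: u \in Lam0}.
Hypothesis scaleLam : forall a : A, {in Lam, forall u, a *: u \in Lam}.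
Hypothesis sub_Lam : Lam0 \subset Lam.
Hypothesis pLam : {in Lam, forall u, p%:R *: u \in Lam0}.

(* Linear independence over F_p of the rows of [lam] in the quotient [Lam / Lam0]. *)
Definition independent s (lam : 'M[A]_(s, n)) :=
  [forall c : 'rV[A]_s, (c *m lam \in Lam0) ==> ((p ^ m)%:R *: c == 0)].

Definition independent_tuples s : {set 'M[A]_(s, n)} :=
  [set lam | [forall i, row i lam \in Lam] && independent lam].

Definition span_mod s (lam : 'M[A]_(s, n)) : {set 'rV[A]_n} :=
  [set v | [exists c : 'rV[A]_s, v - c *m lam \in Lam0]].

Let add_closed_sum (H : {set 'rV[A]_n}) (I : finType) (F : I -> 'rV[A]_n) :
  add_closed H -> (forall i, F i \in H) -> \sum_i F i \in H.
Proof. by case=> H0 HD FH; apply: (big_ind (fun x => x \in H)). Qed.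

Lemma mulmx_in_Lam s (lam : 'M[A]_(s, n)) (c : 'rV[A]_s) :
  (forall i, row i lam \in Lam) -> c *m lam \in Lam.
Proof.
move=> rlam; rewrite mulmx_sum_row; apply: (add_closed_sum addLam) => i.
exact: scaleLam.
Qed.

Lemma torsion_mulmx_in_Lam0 s (lam : 'M[A]_(s, n)) (c : 'rV[A]_s) :
  (forall i, row i lam \in Lam) -> (p ^ m)%:R *: c = 0 -> c *m lam \in Lam0.
Proof.
move=> rlam /(mx_pexp_torsion_div p_prime (leqnSn m)) [c' ->].
rewrite subSnn expn1 -scalemxAl; apply: pLam; exact: mulmx_in_Lam.
Qed.

(** The map sending [(c, u)], with [u] in [Lam0], to [c lam + u] has image [span_mod lam]. By
    independence its kernel is parametrized by the [c] divisible by [p], which are [p ^ (m * s)] in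
    number. *)
Lemma card_span_mod s (lam : 'M[A]_(s, n)) :
  lam \in independent_tuples s -> #|span_mod lam| = (p ^ s * #|Lam0|)%N.
Proof.
rewrite inE => /andP[/forallP rlam /forallP ilam].
pose g (x : 'rV[A]_(s + n)) : 'rV[A]_n := lsubmx x *m lam + rsubmx x.
have gB : zmod_morphism g.
  by move=> x y; rewrite /g !raddfB /= mulmxBl addrACA -opprD.
pose gadd := GRing.isZmodMorphism.Build _ _ g gB.
pose gA : {additive _ -> _} := HB.pack g gadd.
pose pair (cu : 'rV[A]_s * 'rV[A]_n) : 'rV[A]_(s + n) := row_mx cu.1 cu.2.
have pairI : injective pair by move=> [c u] [c' u'] /= /eq_row_mx[/= -> ->].
pose H := pair @: finset.setX [set: 'rV[A]_s] Lam0.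
have inH x : (x \in H) = (rsubmx x \in Lam0).
  apply/imsetP/idP => [[[c u]]|xL].
    by rewrite finset.in_setX => /andP[_ /= uL] ->; rewrite row_mxKr.
  by exists (lsubmx x, rsubmx x); rewrite /pair /= ?hsubmxK // finset.in_setX finset.in_setT.
have addH : add_closed H.
  split; first by rewrite inH raddf0 (proj1 addLam0).
  by move=> x y; rewrite !inH raddfD; exact: (proj2 addLam0).
have imH : gA @: H = span_mod lam.
  apply/setP => v; rewrite [in RHS]inE; apply/imsetP/existsP => [[x]|[c vc]].
    rewrite inH => xL ->; exists (lsubmx x).
    by rewrite /g /= addrAC subrr add0r.
  exists (row_mx c (v - c *m lam)); first by rewrite inH row_mxKr.
  by rewrite /= /g row_mxKl row_mxKr addrC subrK.
have kerH : #|[set x in H | gA x == 0]| = (p ^ (m * s))%N.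
  pose h (c : 'rV[A]_s) := row_mx c (- (c *m lam)).
  have hI : injective h by move=> c c' /eq_row_mx[].
  rewrite -[s in RHS]mul1n -(card_mx_pexp_torsion p_prime 1 s (leqnSn m)) -[RHS](card_imset _ hI).
  apply: eq_card => x; rewrite [LHS]inE inH; apply/andP/imsetP.
    case=> uL; rewrite /= /g addrC addr_eq0 => /eqP uc.
    exists (lsubmx x); last by rewrite /h -uc hsubmxK.
    rewrite inE; apply: (implyP (ilam _)).
    rewrite -[_ *m lam]opprK -uc; exact: add_closed_opp.
  case=> c; rewrite inE => /eqP c0 ->; rewrite /= /g row_mxKl row_mxKr subrr; split=> //.
  by apply: add_closed_opp => //; exact: torsion_mulmx_in_Lam0.
have := card_additive_fibers addH gA; rewrite imH kerH card_imset // cardsX finset.cardsT.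
rewrite card_mx_Zpp // mul1n mulSn expnD.
have : (0 < p ^ (m * s))%N by rewrite expn_gt0 prime_gt0.
move: (p ^ (m * s))%N (p ^ s)%N => a b a0 e.
by apply/eqP; rewrite -(eqn_pmul2r a0) -e [X in X == _]mulnAC.
Qed.

Lemma independent_tuples_col_mx s (l : 'rV[A]_n) (lam : 'M[A]_(s, n)) :
  (col_mx l lam \in independent_tuples (1 + s)) =
  [&& lam \in independent_tuples s, l \in Lam & l \notin span_mod lam].
Proof.
apply/idP/and3P => [|[ilam lLam lspan]].
  rewrite inE => /andP[/forallP rows /forallP ind].
  have indlam : lam \in independent_tuples s.
    rewrite inE; apply/andP; split.
      by apply/forallP => i; have := rows (rshift 1 i); rewrite rowKd.
    apply/forallP => c; apply/implyP => cL; have := ind (row_mx 0 c).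
    rewrite mul_row_col mul0mx add0r cL /= => /eqP c0; apply/eqP.
    by have := congr1 rsubmx c0; rewrite linearZ /= row_mxKr raddf0.
  split=> //.
    have := rows (lshift s 0); rewrite rowKu.
    by rewrite row_id.
  rewrite inE; apply/existsP => -[c lc]; have := ind (row_mx 1%:M (- c)).
  rewrite mul_row_col mul1mx mulNmx lc /= => /eqP /(congr1 lsubmx).
  rewrite linearZ /= row_mxKl raddf0 => /matrixP/(_ 0 0); rewrite !mxE eqxx mulr1.
  move/eqP; rewrite natr_Zpp_eq0 // dvdn_Pexp2l ?prime_gt1 //.
  by rewrite ltnn.
have [rlam indlam] : (forall i, row i lam \in Lam) /\ independent lam.
  by move: ilam; rewrite inE => /andP[/forallP].
rewrite inE; apply/andP; split.
  apply/forallP => i; rewrite -(splitK i); case: (fintype.split i) => j /=.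
    by rewrite rowKu row_id.
  by rewrite rowKd.
apply/forallP => c; apply/implyP; rewrite -[c]hsubmxK mul_row_col.
set c0 := lsubmx c; set c1 := rsubmx c; set a := c0 0 0.
have c0E : c0 = a%:M by exact: mx11_scalar.
rewrite c0E mul_scalar_mx => cL; rewrite scale_row_mx.
(* If [p] divides [a], then [a *: l] is in [Lam0] and the relation is one for [lam]; otherwise [a]
   is a unit and the relation puts [l] in the span. *)
case: (eqVneq ((p ^ m)%:R * a) 0) => a0.
  have aL : a *: l \in Lam0.
    have [b ->] := pexp_mul_eq0_div p_prime (leqnSn m) a0.
    by rewrite subSnn expn1 mulrC -scalerA scaleLam0 // pLam.
  have c1L : c1 *m lam \in Lam0.
    rewrite -[_ *m _](addKr (a *: l)); apply: (proj2 addLam0) => //; exact: add_closed_opp.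
  have /eqP -> := implyP (forallP indlam c1) c1L.
  by rewrite scale_scalar_mx a0 raddf0 row_mx0.
have ua := unit_of_pexp_mul_neq0 p_prime a0.
case/negP: lspan; rewrite inE; apply/existsP; exists (- (a^-1 *: c1)).
have lE : l = a^-1 *: (a *: l) by rewrite scalerA mulVr // scale1r.
rewrite mulNmx opprK -scalemxAl {1}lE -scalerDr; exact: scaleLam0.
Qed.

(** Each row is chosen outside the span of the others; truncated subtraction gives 0 once that span
    exhausts [Lam]. *)
Lemma card_independent_tuples s :
  #|independent_tuples s| = (\prod_(i < s) (#|Lam| - p ^ i * #|Lam0|))%N.
Proof.
elim: s => [|s IH].
  rewrite big_ord0 -(finset.cards1 (0 : 'M[A]_(0, n))); apply: eq_card => x.
  rewrite !inE [x]flatmx0 eqxx; apply/andP; split.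
    by apply/forallP => -[].
  by apply/forallP => c; apply/implyP => _; rewrite [c]thinmx0 scaler0.
rewrite big_ord_recr /= -IH.
pose h (x : 'rV[A]_n * 'M[A]_(s, n)) : 'M[A]_(1 + s, n) := col_mx x.1 x.2.
have hI : injective h by move=> [l x] [l' x'] /= /eq_col_mx[/= -> ->].
pose D := [set x : 'rV[A]_n * 'M[A]_(s, n) | h x \in independent_tuples (1 + s)].
have -> : #|independent_tuples s.+1| = #|D|.
  rewrite -(card_imset D hI); apply: eq_card => x; apply/idP/imsetP => [xi|[y]].
    exists (@usubmx _ 1 s n x, @dsubmx _ 1 s n x); last by rewrite /h vsubmxK.
    by rewrite [_ \in D]finset.in_set /h vsubmxK.
  by rewrite inE => yi ->.
rewrite -sum1_card (eq_bigl (fun x => (x.2 \in independent_tuples s) &&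
   ((x.1 \in Lam) && (x.1 \notin span_mod x.2)))); last first.
  by move=> x; rewrite inE -independent_tuples_col_mx.
rewrite (partition_big snd (mem (independent_tuples s))) /=; last by move=> x /andP[].
rewrite -sum_nat_const; apply: eq_bigr => lam lami.
rewrite -(card_span_mod lami).
have spanLam : span_mod lam \subset Lam.
  apply/fintype.subsetP => v; rewrite inE => /existsP[c vc].
  have rlam i : row i lam \in Lam by move: lami; rewrite inE => /andP[/forallP].
  rewrite -(subrK (c *m lam) v); apply: (proj2 addLam); first exact: (fintype.subsetP sub_Lam).
  exact: mulmx_in_Lam.
rewrite -{1}(finset.setIidPr spanLam) -cardsD.
pose k (l : 'rV[A]_n) := (l, lam).
have kI : injective k by move=> l l' [].
rewrite sum1_card -[RHS](card_imset _ kI); apply: eq_card => -[l x].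
apply/idP/imsetP => [|[l' + [-> ->]]].
  by case/andP=> /andP[xi /andP[/= lL lx]] /eqP /= xl; exists l; rewrite /k -?xl // finset.in_setD lx lL.
by rewrite finset.in_setD => /andP[ls lL]; rewrite unfold_in /= lami lL ls eqxx.
Qed.

End IndependentTuples.

Lemma add_closed_card_dvd (V : finZmodType) (H H' : {set V}) :
  add_closed H -> add_closed H' -> H \subset H' -> (#|H| %| #|H'|)%N.
Proof.
have grp (B : {set V}) : add_closed B -> group_set B.
  by case=> B0 BD; apply/group_setP; split=> // x y; exact: BD.
move=> /grp gH /grp gH' HH'; have sGH : Group gH \subset Group gH' by []. exact: (cardSg sGH).
Qed.

Lemma add_closed_setT (V : finZmodType) : add_closed [set: V].
Proof. by split=> [|x y _ _]; rewrite inE. Qed.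

Lemma add_closed_scale N a b (H : {set 'M['Z_N]_(a, b)}) c x :
  add_closed H -> x \in H -> c *: x \in H.
Proof.
case=> H0 HD xH; rewrite -(natr_Zp c) scaler_nat.
by elim: (c : nat) => [|k IH]; rewrite ?mulr0n // mulrS HD.
Qed.

Lemma annihilator_add_closed N r (H : {set 'cV['Z_N]_r}) :
  add_closed (annihilator (@nonorth N r) H).
Proof.
split.
  by rewrite inE; apply/forall_inP => v _; rewrite /nonorth pairing0l eqxx.
move=> u u'; rewrite !inE => /forall_inP uH /forall_inP u'H; apply/forall_inP => v vH.
by rewrite /nonorth pairingDl (eqP (negbNE (uH v vH))) add0r; exact: u'H.
Qed.

Lemma in_annihilator N r (H : {set 'cV['Z_N]_r}) (u : 'rV['Z_N]_r) :
  reflect {in H, forall v, u *m v = 0} (u \in annihilator (@nonorth N r) H).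
Proof.
rewrite inE; apply: (iffP forall_inP) => uH v vH.
  apply/matrixP => i j; rewrite !ord1 [RHS]mxE; apply/eqP.
  by have := uH v vH; rewrite negbK.
by rewrite /nonorth /pairing uH // mxE eqxx.
Qed.

Section MatrixMaps.
Variables (N a b : nat).
Local Notation A := 'Z_N.
Implicit Types F : 'M[A]_(a, b).

Definition mx_image F : {set 'cV[A]_a} := [set F *m x | x : 'cV[A]_b].
Definition mx_kernel F : {set 'cV[A]_b} := [set x | F *m x == 0].

Lemma mx_image_add_closed F : add_closed (mx_image F).
Proof.
split; first by apply/imsetP; exists 0; rewrite ?mulmx0.
by move=> _ _ /imsetP[x _ ->] /imsetP[y _ ->]; apply/imsetP; exists (x + y); rewrite ?mulmxDr.
Qed.

Lemma mx_kernel_add_closed F : add_closed (mx_kernel F).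
Proof.
split; first by rewrite inE mulmx0.
by move=> x y; rewrite !inE mulmxDr => /eqP-> /eqP->; rewrite addr0.
Qed.

Lemma card_image_on F (H : {set 'cV[A]_b}) : add_closed H ->
  #|H| = (#|[set F *m x | x in H]| * #|[set x in H | F *m x == 0%R]|)%N.
Proof. by move=> addH; exact: (card_additive_fibers addH (mulmx F)). Qed.

Lemma card_image_kernel F : (#|mx_image F| * #|mx_kernel F|)%N = #|{: 'cV[A]_b}|.
Proof.
have addT : add_closed [set: 'cV[A]_b] by exact: add_closed_setT.
rewrite -finset.cardsT (card_image_on F addT); congr (_ * _)%N; apply: eq_card => x.
  by apply/imsetP/imsetP => -[y _ ->]; exists y.
by rewrite !inE.
Qed.

End MatrixMaps.

(** * Maps onto a given subgroup and their kernels *)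

Section Surjections.
Variables (R : realType) (p m r n : nat).
Hypothesis p_prime : prime p.
Local Notation A := 'Z_(p ^ m.+1).
Variable K : {set 'cV[A]_r}.
Hypothesis pmK : {in K, forall v, (p ^ m)%:R *: v = 0}.

(* With [N] the kernel of [phi] and [L] the column span of [X], the functionals are
   those vanishing on [L + p N]; those vanishing on [N] number [#|K|], so that
   [corank_size] is the order of [N / (L + p N)]. *)
Definition functionals (phi : 'M[A]_(r, n)) c (X : 'M[A]_(n, c)) : {set 'rV[A]_n} :=
  [set u | (u *m X == 0) && [forall x in mx_kernel phi, p%:R *: (u *m x) == 0]].

Definition corank_size phi c (X : 'M[A]_(n, c)) : nat :=
  (#|functionals phi X| %/ #|K|)%N.

Section FixedMap.
Variable phi : 'M[A]_(r, n).
Hypothesis phiK : mx_image phi = K.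

Let N := mx_kernel phi.
Let Lam0 := annihilator (@nonorth (p ^ m.+1) n) N.

Let addN : add_closed N. Proof. exact: mx_kernel_add_closed. Qed.

Lemma card_annihilator_kernel : #|Lam0| = #|K|.
Proof.
have N0 : (0 < #|N|)%N by apply/card_gt0P; exists 0; exact: (proj1 addN).
apply/eqP; rewrite -(eqn_pmul2l N0) (card_annihilator R addN) -phiK mulnC.
by rewrite card_image_kernel !card_mx mul1n muln1.
Qed.

Lemma functionalsP c (X : 'M[A]_(n, c)) u :
  reflect (u *m X = 0 /\ {in N, forall x, p%:R *: (u *m x) = 0}) (u \in functionals phi X).
Proof.
rewrite inE; apply: (iffP andP) => [[/eqP uX /forall_inP uN]|[/eqP uX uN]].
  by split=> // x xN; apply/eqP/uN.
by split=> //; apply/forall_inP => x xN; apply/eqP/uN.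
Qed.

Lemma functionals_add_closed c (X : 'M[A]_(n, c)) : add_closed (functionals phi X).
Proof.
split; first by apply/functionalsP; rewrite mul0mx; split=> // x _; rewrite mul0mx scaler0.
move=> u v /functionalsP[uX uN] /functionalsP[vX vN]; apply/functionalsP.
rewrite mulmxDl uX vX addr0; split=> // x xN.
by rewrite mulmxDl scalerDr uN // vN // addr0.
Qed.

Lemma p_functionals c (X : 'M[A]_(n, c)) u :
  u \in functionals phi X -> p%:R *: u \in Lam0.
Proof.
by case/functionalsP=> _ uN; apply/in_annihilator => x xN; rewrite -scalemxAl uN.
Qed.

Lemma annihilator_sub_functionals c (X : 'M[A]_(n, c)) : phi *m X = 0 ->
  Lam0 \subset functionals phi X.
Proof.
move=> phiX; apply/fintype.subsetP => u /in_annihilator uN; apply/functionalsP; split.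
  apply/matrixP => i j; have := uN (col j X); rewrite colE inE mulmxA phiX mul0mx eqxx.
  by move=> /(_ isT); rewrite !ord1 mulmxA -colE => /matrixP/(_ 0 0); rewrite !mxE.
by move=> x xN; rewrite uN // scaler0.
Qed.

Section Columns.
Variables (c : nat) (X : 'M[A]_(n, c)).
Hypothesis phiX : phi *m X = 0.

Lemma corank_sizeE : #|functionals phi X| = (corank_size phi X * #|K|)%N.
Proof.
rewrite divnK // -card_annihilator_kernel; apply: add_closed_card_dvd.
- exact: annihilator_add_closed.
- exact: functionals_add_closed.
- exact: annihilator_sub_functionals.
Qed.

Lemma corank_size_pow : exists e, corank_size phi X = (p ^ e)%N.
Proof.
have addT : add_closed [set: 'rV[A]_n] by exact: add_closed_setT.
have := add_closed_card_dvd (functionals_add_closed X) addT (finset.subsetT _).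
rewrite finset.cardsT card_mx_Zpp // corank_sizeE => /(dvdn_trans (dvdn_mulr _ (dvdnn _))).
by move/(dvdn_pfactor _ _ p_prime) => [e _ ->]; exists e.
Qed.

Lemma card_independent_functionals s :
  #|independent_tuples (functionals phi X) Lam0 s| =
  (#|K| ^ s * \prod_(i < s) (corank_size phi X - p ^ i))%N.
Proof.
rewrite card_independent_tuples //; last first.
- exact: p_functionals.
- exact: annihilator_sub_functionals.
- by move=> a0 u; apply: add_closed_scale; exact: functionals_add_closed.
- by move=> a0 u; apply: add_closed_scale; exact: annihilator_add_closed.
- exact: functionals_add_closed.
- exact: annihilator_add_closed.
have -> : (#|K| ^ s = \prod_(i < s) #|K|)%N by rewrite prod_nat_const card_ord.
rewrite card_annihilator_kernel corank_sizeE -big_split /=.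
by apply: eq_bigr => i _; rewrite -mulnBl mulnC.
Qed.

(** Nakayama's lemma: if only the functionals vanishing on [N] vanish on [L + p N], duality gives
    [N = L + p N]; iteration yields [N = L + p ^ (m + 1) N], which is [L]. *)
Lemma corank_size_eq1 : (corank_size phi X == 1)%N = (N == mx_image X).
Proof.
have K0 : (0 < #|K|)%N by rewrite -phiK; apply/card_gt0P; exists 0; exact: (proj1 (mx_image_add_closed _)).
have LN : mx_image X \subset N.
  by apply/fintype.subsetP => _ /imsetP[y _ ->]; rewrite inE mulmxA phiX mul0mx.
have subL := annihilator_sub_functionals phiX.
apply/eqP/eqP => [Y1|NL]; last first.
  apply/eqP; rewrite -(eqn_pmul2r K0) mul1n -corank_sizeE -card_annihilator_kernel.
  rewrite eqn_leq (subset_leq_card subL) andbT; apply/subset_leq_card/fintype.subsetP => u.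
  case/functionalsP => uX _; apply/in_annihilator => x; rewrite NL => /imsetP[y _ ->].
  by rewrite mulmxA uX mul0mx.
have LamE : Lam0 = functionals phi X.
  by apply/eqP; rewrite eqEcard subL corank_sizeE Y1 mul1n card_annihilator_kernel leqnn.
pose H : {set 'cV[A]_n} := [set X *m yx.1 + p%:R *: yx.2 | yx in finset.setX [set: 'cV[A]_c] N].
have HP v : reflect (exists y x, x \in N /\ v = X *m y + p%:R *: x) (v \in H).
  apply: (iffP imsetP) => [[[y x]]|[y [x [xN ->]]]].
    by rewrite finset.in_setX => /andP[_ xN] ->; exists y, x.
  by exists (y, x) => //; rewrite finset.in_setX finset.in_setT.
have addH : add_closed H.
  split; first by apply/HP; exists 0, 0; rewrite mulmx0 scaler0 addr0; split=> //; exact: (proj1 addN).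
  move=> _ _ /HP[y [x [xN ->]]] /HP[y' [x' [xN' ->]]]; apply/HP; exists (y + y'), (x + x').
  by rewrite mulmxDr scalerDr addrACA; split=> //; exact: (proj2 addN).
have HN : H \subset N.
  apply/fintype.subsetP => _ /HP[y [x [xN ->]]]; apply: (proj2 addN).
    by apply: (fintype.subsetP LN); exact: imset_f.
  exact: add_closed_scale.
have annH : annihilator (@nonorth (p ^ m.+1) n) H = functionals phi X.
  apply/setP => u; apply/in_annihilator/functionalsP => [uH|[uX uN] _ /HP[y [x [xN ->]]]].
    split=> [|x xN]; last first.
      rewrite scalemxAr; apply: uH; apply/HP; exists 0, x; split=> //.
      by rewrite mulmx0 add0r.
    apply/matrixP => i j; have := uH (col j X); rewrite !ord1.
    have -> : col j X \in H.
      apply/HP; exists (delta_mx j 0), 0; rewrite scaler0 addr0 colE; split=> //.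
      exact: (proj1 addN).
    by move=> /(_ isT); rewrite colE mulmxA -colE => /matrixP/(_ 0 0); rewrite !mxE.
  by rewrite mulmxDr mulmxA uX mul0mx add0r -scalemxAr uN.
have HNE : H = N.
  apply/eqP; rewrite eqEcard HN /=.
  have L0 : (0 < #|Lam0|)%N by rewrite card_annihilator_kernel.
  rewrite -(leq_pmul2r L0) {2}LamE -annH (card_annihilator R addH).
  by rewrite (card_annihilator R addN).
have nak i : {in N, forall x, exists y x', x' \in N /\ x = X *m y + (p ^ i)%:R *: x'}.
  elim: i => [|i IH] x xN.
    by exists 0, x; rewrite mulmx0 add0r scale1r.
  have [y [x' [x'N ->]]] := IH x xN.
  have /HP[y' [x'' [x''N ->]]] : x' \in H by rewrite HNE.
  exists (y + (p ^ i)%:R *: y'), x''; split=> //.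
  rewrite mulmxDr scalerDr addrA -scalemxAr scalerA; congr (_ + _ *: _).
  by rewrite -natrM -expnSr.
apply/eqP; rewrite finset.eqEsubset LN andbT; apply/fintype.subsetP => x /(nak m.+1)[y [x' [_ ->]]].
by rewrite pexp_scale_eq0 // addr0; exact: imset_f.
Qed.

End Columns.
End FixedMap.
End Surjections.

Section GoodMatrices.
Variables (R : realType) (p m r n : nat).
Hypothesis p_prime : prime p.
Local Notation A := 'Z_(p ^ m.+1).
Variable K : {set 'cV[A]_r}.
Hypothesis pmK : {in K, forall v, (p ^ m)%:R *: v = 0}.

(** A matrix without columns imposes nothing, so this is the order of [N / p N], equal to that of
    the [p]-torsion of [N]. The vectors killed by [p] are the multiples of [p ^ m], and all of them
    lie in [N] because [p ^ m K = 0]. *)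
Lemma corank_size0 (phi : 'M[A]_(r, n)) : mx_image phi = K ->
  corank_size K phi (0 : 'M[A]_(n, 0)) = (p ^ n)%N.
Proof.
move=> phiK; have K0 : (0 < #|K|)%N.
  by rewrite -phiK; apply/card_gt0P; exists 0; exact: (proj1 (mx_image_add_closed _)).
have phi0 : phi *m (0 : 'M[A]_(n, 0)) = 0 by rewrite mulmx0.
set N := mx_kernel phi; have addN : add_closed N by exact: mx_kernel_add_closed.
pose pN : {set 'cV[A]_n} := [set p%:R%:M *m x | x in N].
have addpN : add_closed pN.
  split; first by apply/imsetP; exists 0; rewrite ?mulmx0 ?(proj1 addN).
  move=> _ _ /imsetP[x xN ->] /imsetP[y yN ->]; apply/imsetP; exists (x + y).
    exact: (proj2 addN).
  by rewrite mulmxDr.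
have annE : functionals phi (0 : 'M[A]_(n, 0)) = annihilator (@nonorth (p ^ m.+1) n) pN.
  apply/setP => u; apply/functionalsP/in_annihilator => [[_ uN] _ /imsetP[x xN ->]|uN].
    by rewrite mul_scalar_mx -scalemxAr uN.
  split=> [|x xN]; first by rewrite [LHS]thinmx0.
  by rewrite scalemxAr -mul_scalar_mx uN //; exact: imset_f.
have torsion : #|[set x in N | p%:R%:M *m x == 0]| = (p ^ n)%N.
  have := card_mx_pexp_torsion p_prime n 1 (ltn0Sn m).
  rewrite !expn1 mul1n muln1 => <-; apply: eq_card => x; rewrite !inE mul_scalar_mx.
  apply: andb_idl => /eqP x0.
  have [y ->] := @mx_pexp_torsion_div p m p_prime 1 _ _ x (ltn0Sn m) (etrans (congr1 (fun z => z%:R *: x) (expn1 p)) x0).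
  rewrite subSS subn0 -scalemxAr; apply/eqP; apply: pmK.
  by rewrite -phiK; exact: imset_f.
have pN0 : (0 < #|pN|)%N by apply/card_gt0P; exists 0; exact: (proj1 addpN).
apply/eqP; rewrite -(eqn_pmul2r K0) -(corank_sizeE R phiK phi0) annE.
rewrite -(eqn_pmul2l pN0) (card_annihilator R addpN) -(card_annihilator R addN).
by rewrite (card_annihilator_kernel R phiK) (card_image_on p%:R%:M addN) torsion mulnA.
Qed.

(* [phi] completed by [s] functionals that are independent on [N / p N]. *)
Definition good_matrix s (F : 'M[A]_(r + s, n)) : bool :=
  (mx_image (usubmx F) == K) &&
  (dsubmx F \in independent_tuples (functionals (usubmx F) (0 : 'M[A]_(n, 0)))
     (annihilator (@nonorth (p ^ m.+1) n) (mx_kernel (usubmx F))) s).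

(** The order is [#|K|] times that of [lam N]. A functional [c] kills [lam N] exactly when [c lam]
    kills [N], that is when [p] divides [c]; by duality [lam N] has order [p ^ s]. *)
Lemma card_image_good s (F : 'M[A]_(r + s, n)) : good_matrix F ->
  #|mx_image F| = (#|K| * p ^ s)%N.
Proof.
case/andP=> /eqP phiK; set phi := usubmx F in phiK *; set lam := dsubmx F.
set N := mx_kernel phi; set Lam0 := annihilator _ _ => ilam.
have addN : add_closed N by exact: mx_kernel_add_closed.
have kerF : #|mx_kernel F| = #|[set x in N | lam *m x == 0]|.
  apply: eq_card => x; rewrite !inE -{1}[F]vsubmxK mul_col_mx.
  apply/eqP/andP => [|[/eqP e1 /eqP e2]]; last by rewrite e1 e2 col_mx0.
  by rewrite -col_mx0 => /eq_col_mx[-> ->].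
have rows : forall i, row i lam \in functionals phi (0 : 'M[A]_(n, 0)).
  by move: ilam; rewrite inE => /andP[/forallP].
pose lN : {set 'cV[A]_s} := [set lam *m x | x in N].
have addlN : add_closed lN.
  split; first by apply/imsetP; exists 0; rewrite ?mulmx0 ?(proj1 addN).
  move=> _ _ /imsetP[x xN ->] /imsetP[y yN ->]; apply/imsetP; exists (x + y).
    exact: (proj2 addN).
  by rewrite mulmxDr.
have annlN : #|annihilator (@nonorth (p ^ m.+1) s) lN| = (p ^ (m * s))%N.
  have := card_mx_pexp_torsion p_prime 1 s (leqnSn m); rewrite mul1n => <-.
  apply: eq_card => c; rewrite [RHS]inE.
  have cP : (c \in annihilator (@nonorth (p ^ m.+1) s) lN) = (c *m lam \in Lam0).
    apply/in_annihilator/in_annihilator => [cl x xN|cl _ /imsetP[x xN ->]].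
      by rewrite -mulmxA; apply: cl; exact: imset_f.
    by rewrite mulmxA; exact: cl.
  rewrite cP; apply/idP/eqP => [cL|c0].
    by move: ilam; rewrite inE => /andP[_ /forallP/(_ c)]; rewrite cL => /eqP.
  apply: (torsion_mulmx_in_Lam0 p_prime _ _ _ rows c0).
  - exact: functionals_add_closed.
  - by move=> a0 u; apply: add_closed_scale; exact: functionals_add_closed.
  - by move=> u uL; apply: p_functionals uL.
have clN : #|lN| = (p ^ s)%N.
  have := card_annihilator R addlN; rewrite annlN card_mx_Zpp // mul1n mulSn expnD.
  by move/eqP; rewrite eqn_pmul2r ?expn_gt0 ?prime_gt0 // => /eqP.
have kF0 : (0 < #|mx_kernel F|)%N.
  by apply/card_gt0P; exists 0; exact: (proj1 (mx_kernel_add_closed _)).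
apply/eqP; rewrite -(eqn_pmul2r kF0) card_image_kernel -(card_image_kernel phi) phiK -/N.
by rewrite (card_image_on lam addN) -/lN clN kerF mulnA.
Qed.

(** A good [F] kills [X] exactly when [phi] does and the other rows lie in [functionals phi X];
    independence is modulo the same [Lam0], whatever [X]. *)
Lemma card_good_annihilating s c (X : 'M[A]_(n, c)) :
  #|[set F : 'M[A]_(r + s, n) | good_matrix F && (F *m X == 0)]| =
  (\sum_(phi : 'M[A]_(r, n) | (mx_image phi == K) && (phi *m X == 0%R))
     #|K| ^ s * \prod_(i < s) (corank_size K phi X - p ^ i))%N.
Proof.
pose h (x : 'M[A]_(r, n) * 'M[A]_(s, n)) := col_mx x.1 x.2.
have hI : injective h by move=> [a b] [a' b'] /eq_col_mx[/= -> ->].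
pose D (phi : 'M[A]_(r, n)) := independent_tuples (functionals phi X)
   (annihilator (@nonorth (p ^ m.+1) n) (mx_kernel phi)) s.
pose E := [set x : 'M[A]_(r, n) * 'M[A]_(s, n) |
   ((mx_image x.1 == K) && (x.1 *m X == 0)) && (x.2 \in D x.1)].
have -> : #|[set F : 'M[A]_(r + s, n) | good_matrix F && (F *m X == 0)]| = #|E|.
  rewrite -(card_imset E hI); apply: eq_card => F; rewrite -[F]vsubmxK.
  rewrite -[col_mx _ _ in RHS]/(h (_, _)) mem_imset // !inE /good_matrix col_mxKu col_mxKd.
  rewrite mul_col_mx col_mx_eq0 inE -!andbA; congr (_ && _).
  case: eqP => phiX; rewrite ?andbF //= ?andbT.
  set ind := independent _ _; case: ind; rewrite ?andbF ?andbT //.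
  apply/andP/forallP => [[/forallP r0 /eqP lX] i|rX].
    have /functionalsP[_ rN] := r0 i; apply/functionalsP; split=> //.
    by rewrite -row_mul lX row0.
  split.
    apply/forallP => i; have /functionalsP[_ rN] := rX i; apply/functionalsP; split=> //.
    by rewrite [LHS]thinmx0.
  apply/eqP/row_matrixP => i; have /functionalsP[rX0 _] := rX i.
  by rewrite row_mul rX0 row0.
rewrite -sum1_card (partition_big fst (fun phi => (mx_image phi == K) && (phi *m X == 0))) /=; last first.
  by move=> x; rewrite inE => /andP[].
apply: eq_bigr => phi /andP[/eqP phiK /eqP phiX].
rewrite -(card_independent_functionals R p_prime phiK phiX) sum1_card.
have kI : injective (fun lam : 'M[A]_(s, n) => (phi, lam)) by move=> l l' [].
rewrite -[RHS](card_imset _ kI); apply: eq_card => -[f lam].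
apply/idP/imsetP => [|[lam' li [-> ->]]].
  by rewrite unfold_in /= inE /= => /andP[/andP[_ li] /eqP fphi]; exists lam; rewrite -?fphi.
rewrite unfold_in /=; apply/andP; split=> //=.
by rewrite finset.in_set /= phiK phiX !eqxx.
Qed.

End GoodMatrices.

Section MatrixColumns.
Variables (R : realType) (N r n : nat).
Local Notation A := 'Z_N.

Definition columns (F : 'M[A]_(r, n)) : {ffun 'I_n -> 'cV[A]_r} := [ffun i => col i F].

Lemma columns_inj : injective columns.
Proof.
by move=> F G /ffunP FG; apply/matrixP => i j; have := FG j; rewrite !ffunE => /colP/(_ i); rewrite !mxE.
Qed.

Lemma mulmx_columns (F : 'M[A]_(r, n)) (x : 'cV[A]_n) :
  F *m x = \sum_i x i 0 *: columns F i.
Proof.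
apply/colP => k; rewrite mxE summxE; apply: eq_bigr => i _.
by rewrite ffunE !mxE mulrC.
Qed.

(** This identifies the matrices with image [H] with the functions over which the staircase estimate
    sums. *)
Lemma image_columnsP (H : {set 'cV[A]_r}) (F : 'M[A]_(r, n)) : add_closed H ->
  (mx_image F == H) = (columns F \in ffun_on (mem H)) && spans (@nonorth N r) H (columns F).
Proof.
move=> addH; have addI := mx_image_add_closed F.
have weight0 u : (weight (@nonorth N r) finset.setT (columns F) u == 0)%N = (u *m F == 0).
  rewrite cards_eq0; apply/eqP/eqP => [/setP w0|uF].
    apply/matrixP => i j; have := w0 j; rewrite !inE ffunE /= => /negbFE.
    by rewrite /pairing colE mulmxA -colE !ord1 !mxE => /eqP.
  by apply/setP => j; rewrite !inE ffunE /nonorth /pairing colE mulmxA uF mul0mx mxE eqxx.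
apply/eqP/andP => [FH|[/ffun_onP FH /forall_inP sp]].
  split.
    by apply/ffun_onP => i; rewrite ffunE -FH colE; exact: imset_f.
  apply/forall_inP => u; rewrite finset.in_setC lt0n weight0; apply: contra => /eqP uF.
  by apply/in_annihilator => v; rewrite -FH => /imsetP[x _ ->]; rewrite mulmxA uF mul0mx.
have IH : mx_image F \subset H.
  apply/fintype.subsetP => _ /imsetP[x _ ->]; rewrite mulmx_columns.
  apply: (big_ind (fun z => z \in H)); [exact: (proj1 addH)|exact: (proj2 addH)|].
  by move=> i _; apply: (add_closed_scale _ addH); exact: FH.
have annI : annihilator (@nonorth N r) (mx_image F) \subset annihilator (@nonorth N r) H.
  apply/fintype.subsetP => u /in_annihilator uI; apply: contraT => uH.
  have := sp u; rewrite finset.in_setC uH lt0n weight0 => /(_ isT)/eqP[].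
  apply/matrixP => i j; have := uI (col j F); rewrite colE imset_f // => /(_ isT).
  by rewrite mulmxA -colE => /matrixP/(_ 0 0); rewrite !ord1 !mxE.
apply/eqP; rewrite eqEcard IH /=.
have a0 : (0 < #|annihilator (@nonorth N r) (mx_image F)|)%N.
  by apply/card_gt0P; exists 0; exact: (proj1 (annihilator_add_closed _)).
rewrite -(leq_pmul2r a0) (card_annihilator R addI) -(card_annihilator R addH) leq_mul2l.
by rewrite subset_leq_card ?orbT.
Qed.

End MatrixColumns.

(** * The sieve *)

Section Sieve.
Variables (R : realType) (p : nat).
Hypothesis p_gt1 : (1 < p)%N.
Let P := p%:R : R.

Let P2 : 2 <= P. Proof. by rewrite ler_nat. Qed.
Let P0 : 0 < P. Proof. by rewrite (lt_le_trans _ P2). Qed.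
Let P_neq0 : P != 0. Proof. by rewrite gt_eqF. Qed.

Let Pexp_ge i : 2 <= P ^+ i.+1.
Proof.
apply: le_trans P2 _; rewrite -[leLHS]expr1; apply: ler_weXn2l => //.
by apply: le_trans P2; rewrite ler1n.
Qed.

Let den_neq0 i : 1 - P ^+ i.+1 != 0.
Proof. by rewrite lt_eqF // subr_lt0 (lt_le_trans _ (Pexp_ge i)) // ltr1n. Qed.

(** The coefficients of Euler's expansion of [\prod_(i >= 1) (1 - x / p ^ i)] in powers of [x]. *)
Definition sieve_coef s : R := \prod_(i < s) (1 - (p%:R : R) ^+ i.+1)^-1.

(* The sieve weight of a group of corank [d], for [Y = p ^ d]. *)
Definition sieve S (Y : R) : R :=
  \sum_(s < S.+1) sieve_coef s * \prod_(i < s) (Y - p%:R ^+ i).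

(** With [x = p ^ (S + 1)], the last term multiplies the previous sum by [1 + (Y - 1) / (1 - x)],
    which is [(Y - x) / (1 - x)]. *)
Lemma sieveE S Y : sieve S Y = \prod_(i < S) ((Y - P ^+ i.+1) / (1 - P ^+ i.+1)).
Proof.
rewrite /sieve; elim: S => [|S IH].
  by rewrite big_ord_recr !big_ord0 /= /sieve_coef !big_ord0 mulr1 add0r.
rewrite big_ord_recr /= IH [RHS]big_ord_recr /=.
rewrite big_ord_recl /= /bump /=; under [X in _ * (_ * X)]eq_bigr do rewrite add1n.
rewrite /sieve_coef [in LHS]big_ord_recr /= !big_split /= -/P.
set a := \prod_(i < S) (Y - _); set b := \prod_(i < S) (1 - _)^-1.
have d0 := den_neq0 S; rewrite expr0; move: (P ^+ S.+1) d0 => x d0.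
have e : (Y - x) / (1 - x) = 1 + (Y - 1) / (1 - x) by field.
by rewrite e; ring.
Qed.

(** In the product form all factors are 1 if [d = 0]. If [d > 0], those with [i + 1 < d] are
    negative and the one with [i + 1 = d] vanishes, so the signs alternate until the partial sums
    become 0. *)
Lemma sieve_bracket S d :
  sieve S.*2.+1 (p ^ d)%:R <= (d == 0)%N%:R <= sieve S.*2 (p ^ d)%:R.
Proof.
rewrite !sieveE natrX -/P; case: d => [|d] /=.
  by rewrite expr0 !big1 ?lexx // => i _; rewrite divff.
have key N : ~~ odd N -> 0 <= \prod_(i < N) ((P ^+ d.+1 - P ^+ i.+1) / (1 - P ^+ i.+1)).
  move=> oN; case: (leqP N d) => Nd.
    have -> : \prod_(i < N) ((P ^+ d.+1 - P ^+ i.+1) / (1 - P ^+ i.+1))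
        = \prod_(i < N) - ((P ^+ d.+1 - P ^+ i.+1) / (P ^+ i.+1 - 1)).
      by apply: eq_bigr => i _; rewrite -mulrN -invrN opprB.
    rewrite prodrN card_ord -signr_odd (negbTE oN) expr0 mul1r; apply: prodr_ge0 => i _.
    apply: divr_ge0; rewrite subr_ge0; last by apply: le_trans (Pexp_ge i); rewrite ler1n.
    apply: ler_weXn2l; first by apply: le_trans P2; rewrite ler1n.
    by have := ltn_ord i; lia.
  by rewrite (bigD1 (Ordinal Nd)) //= subrr mul0r mul0r.
rewrite key ?odd_double // andbT big_ord_recr /=.
case: (leqP d.+1 S.*2) => dS.
  by rewrite (bigD1 (Ordinal dS)) //= subrr !mul0r.
apply: mulr_ge0_le0; first by rewrite key ?odd_double.
rewrite -[leRHS]oppr0 -[leLHS]opprK lerN2 -mulrN -invrN opprB; apply: divr_ge0; rewrite subr_ge0.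
  by apply: ler_weXn2l => //; apply: le_trans P2; rewrite ler1n.
by apply: le_trans (Pexp_ge _); rewrite ler1n.
Qed.

Lemma sieve_coefS s : sieve_coef s.+1 = sieve_coef s / (1 - P ^+ s.+1).
Proof. by rewrite /sieve_coef big_ord_recr. Qed.

(** The first factor is only bounded by 1, attained for [p = 2], whence the constant 2; the later
    ones are at most 1/2. *)
Lemma norm_sieve_coef_le s : `|sieve_coef s| <= 2 * (2^-1) ^+ s.
Proof.
have step i : `|(1 - P ^+ i.+1)^-1| <= 1.
  rewrite normfV invf_le1 ?normr_gt0 // distrC ger0_norm; last first.
    by rewrite subr_ge0 (le_trans _ (Pexp_ge i)) // ler1n.
  by have := Pexp_ge i; lra.
case: s => [|s]; first by rewrite /sieve_coef big_ord0 normr1 expr0 mulr1 ler1n.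
elim: s => [|s IH].
  by rewrite sieve_coefS /sieve_coef big_ord0 mul1r expr1 mulfV // (le_trans (step 0)).
rewrite sieve_coefS normrM [in leRHS]exprSr [leRHS]mulrA; apply: ler_pM => //.
rewrite normfV lef_pV2 ?posrE ?normr_gt0 // distrC ger0_norm; last first.
  by rewrite subr_ge0 (le_trans _ (Pexp_ge s.+1)) // ler1n.
have : P * P <= P ^+ s.+2.
  rewrite -expr2; apply: ler_weXn2l => //; by apply: le_trans P2; rewrite ler1n.
by have := P2; nra.
Qed.

Definition sieve_sum S (x : R) : R := \sum_(s < S.+1) sieve_coef s * x ^+ s.

(** Up to its last coefficient, the truncated series satisfies Euler's equation
    [f x = (1 - x / p) * f (x / p)]. *)
Lemma sieve_sum_rec S x :
  sieve_sum S x = (1 - x / P) * sieve_sum S (x / P) + sieve_coef S * (x / P) ^+ S.+1.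
Proof.
set y := x / P; have xy : x = y * P by rewrite divfK.
rewrite /sieve_sum; elim: S => [|S IH].
  by rewrite !big_ord_recr !big_ord0 /= /sieve_coef big_ord0; ring.
rewrite big_ord_recr /= IH [in RHS]big_ord_recr /= {2}sieve_coefS.
have -> : x ^+ S.+1 = y ^+ S.+1 * P ^+ S.+1 by rewrite -exprMn -xy.
rewrite sieve_coefS; have d0 := den_neq0 S.
set L := \sum_(_ < _) _; set c := sieve_coef S.
rewrite ![y ^+ S.+2]exprS; move: (y ^+ S.+1) (P ^+ S.+1) d0 => z w d0.
by field.
Qed.

Lemma sieve_sum_prod S N x : 0 <= x <= 1 ->
  `|sieve_sum S x - \prod_(i < N) (1 - x / P ^+ i.+1) * sieve_sum S (x / P ^+ N)|
    <= `|sieve_coef S| * x.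
Proof.
elim: N x => [|N IH] x /andP[x0 x1].
  by rewrite big_ord0 mul1r expr0 divr1 subrr normr0 mulr_ge0.
set y := x / P; have y0 : 0 <= y by rewrite divr_ge0 // ltW.
(* As [p >= 2], the error made here and the sum of all later ones each take at most half of the
   allowance. *)
have yx : y + y <= x.
  by rewrite /y -mulrDl ler_pdivrMr //; have := P2; nra.
have y1 : y <= 1 by lra.
have -> : \prod_(i < N.+1) (1 - x / P ^+ i.+1) * sieve_sum S (x / P ^+ N.+1) =
    (1 - y) * (\prod_(i < N) (1 - y / P ^+ i.+1) * sieve_sum S (y / P ^+ N)).
  have sh k : x / P ^+ k.+1 = y / P ^+ k by rewrite /y exprS invfM mulrA.
  rewrite big_ord_recl /= sh expr0 divr1 !sh -mulrA; congr (_ * (_ * _)).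
  by apply: eq_bigr => i _; rewrite /bump add1n sh.
rewrite sieve_sum_rec -/y addrAC -mulrBr; apply: le_trans (ler_normD _ _) _.
apply: (@le_trans _ _ (`|sieve_coef S| * y + `|sieve_coef S| * y)); last first.
  by rewrite -mulrDr; apply: ler_wpM2l.
apply: lerD.
  rewrite normrM -[leRHS]mul1r; apply: ler_pM => //.
    by rewrite ger0_norm ?subr_ge0 // gerBl.
  by apply: IH; rewrite y0.
rewrite normrM [`|y ^+ _|]ger0_norm ?exprn_ge0 //; apply: ler_wpM2l => //.
by rewrite -[leRHS]expr1; apply: ler_wiXn2l.
Qed.

Lemma sieve_sum_limit S x (E : R) : 0 <= x <= 1 ->
  (\prod_(i < N) (1 - x / P ^+ i.+1) @[N --> \oo] --> E)%classic ->
  `|sieve_sum S x - E| <= `|sieve_coef S| * x.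
Proof.
move=> x01 EE.
have arg0 : (x / P ^+ N @[N --> \oo] --> (0 : R))%classic.
  suff : (x * P^-1 ^+ N @[N --> \oo] --> x * 0)%classic.
    by rewrite mulr0; under eq_fun do rewrite exprVn.
  apply: cvgMl_tmp; apply: cvg_expr; rewrite normfV ger0_norm ?(ltW P0) //.
  by rewrite invf_lt1 // (lt_le_trans _ P2) // ltr1n.
have sum1 : (sieve_sum S (x / P ^+ N) @[N --> \oo] --> (1 : R))%classic.
  suff : (sieve_sum S (x / P ^+ N) @[N --> \oo] --> \sum_(s < S.+1) sieve_coef s * (0 : R) ^+ s)%classic.
    by rewrite big_ord_recl /= big1 ?addr0 ?mulr1 /sieve_coef ?big_ord0 // => i _; rewrite expr0n mulr0.
  apply: cvg_big => [|s _]; first exact: add_continuous.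
  by apply: cvgMl_tmp; exact: cvg_exprX.
have lim : (`|sieve_sum S x - \prod_(i < N) (1 - x / P ^+ i.+1) * sieve_sum S (x / P ^+ N)|
    @[N --> \oo] --> `|sieve_sum S x - E * 1|)%classic.
  by apply: cvg_norm; apply: cvgB; [exact: cvg_cst | exact: cvgM].
rewrite mulr1 in lim; apply: (cvgr_to_le lim).
by apply: nearW => N; exact: sieve_sum_prod.
Qed.

End Sieve.

(** * Moments *)

Section RandomMatrix.
Variables (R : realType) (N n c : nat).
Local Notation A := 'Z_N.
Variable mu : 'I_n -> 'I_c -> A -> R.

Definition mx_prob (X : 'M[A]_(n, c)) : R := \prod_j \prod_i mu i j (X i j).

Lemma mx_prob_ge0 X : (forall i j, is_pmf (mu i j)) -> 0 <= mx_prob X.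
Proof.
move=> pmu; apply: prodr_ge0 => j _; apply: prodr_ge0 => i _.
by have [mu0 _] := pmu i j; exact: mu0.
Qed.

Lemma sum_mx_prob_kernel r (F : 'M[A]_(r, n)) :
  \sum_X mx_prob X * (F *m X == 0)%:R = \prod_j kernel_prob (mu^~ j) (columns F).
Proof.
rewrite /kernel_prob bigA_distr_bigA /=.
pose h (f : {ffun 'I_c -> {ffun 'I_n -> A}}) : 'M[A]_(n, c) := \matrix_(i, j) f j i.
pose h' (X : 'M[A]_(n, c)) : {ffun 'I_c -> {ffun 'I_n -> A}} := [ffun j => [ffun i => X i j]].
rewrite (reindex h) /=; last first.
  exists h' => f _; first by apply/ffunP => j; apply/ffunP => i; rewrite !ffunE mxE.
  by apply/matrixP => i j; rewrite mxE !ffunE.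
apply: eq_bigr => f _; rewrite big_split /=; congr (_ * _).
  by apply: eq_bigr => j _; apply: eq_bigr => i _; rewrite mxE.
have hP : (F *m h f == 0) = [forall j, \sum_i f j i *: columns F i == 0].
  have colE' j : \sum_i f j i *: columns F i = col j (F *m h f).
    rewrite [RHS]colE -mulmxA -colE mulmx_columns.
    by apply: eq_bigr => i _; rewrite !mxE.
  apply/eqP/forallP => [F0 j|F0]; first by rewrite colE' F0 colE mul0mx.
  by apply/matrixP => i j; have := F0 j; rewrite colE' => /eqP/colP/(_ i); rewrite !mxE.
rewrite hP; case: (boolP [forall j, _]) => [/forallP F0|].
  by rewrite big1 // => j _; rewrite F0.
rewrite negb_forall => /existsP[j /negbTE Fj].
by rewrite (bigD1 j) //= Fj mul0r.
Qed.

End RandomMatrix.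

Section Moments.
Variables (R : realType) (p m r : nat).
Hypothesis p_prime : prime p.
Local Notation A := 'Z_(p ^ m.+1).
Variable K : {set 'cV[A]_r}.
Hypothesis addK : add_closed K.
Hypothesis pmK : {in K, forall v, (p ^ m)%:R *: v = 0}.

Let K_gt0 : (0 < #|K|)%N. Proof. by apply/card_gt0P; exists 0; case: addK. Qed.
Let p_gt1 : (1 < p)%N. Proof. exact: prime_gt1. Qed.

Definition corank_moment s n c (X : 'M[A]_(n, c)) : nat :=
  (\sum_(phi : 'M[A]_(r, n) | (mx_image phi == K) && (phi *m X == 0%R))
     \prod_(i < s) (corank_size K phi X - p ^ i))%N.

(** By [iso_count_cok_isog], this is [#|Aut G|] or 0 according to whether the cokernel of a p-adic
    lift of [X] is isomorphic to [G]. *)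
Definition iso_count n c (X : 'M[A]_(n, c)) : nat :=
  #|[set phi : 'M[A]_(r, n) | (mx_image phi == K) && (mx_kernel phi == mx_image X)]|.

Definition onto_count n : nat := #|[set phi : 'M[A]_(r, n) | mx_image phi == K]|.

Lemma sum_image_le t b (eps delta : R) : 0 < eps < 1 -> 0 < delta ->
  forall a, exists g0, forall n g (sees : 'I_(n + t) -> {set 'I_n})
    (mu : 'I_n -> 'I_(n + t) -> A -> R),
  (g0 <= g)%N -> stair_pattern t b g sees ->
  (forall i j, is_pmf (mu i j)) -> (forall i j, i \in sees j -> spread_out eps (mu i j)) ->
  \sum_(F : 'M[A]_(a, n))
     `|\prod_j kernel_prob (mu^~ j) (columns F) - (#|mx_image F|%:R ^- (n + t))| <= delta.
Proof.
(* The number of candidate images does not depend on [n], so each of them gets the share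
   [delta / B]. *)
move=> e01 d0 a; pose B : R := #|{set 'cV[A]_a}|%:R.
have B0 : 0 < B by rewrite ltr0n; apply/card_gt0P; exists finset.set0.
have exg : forall H : {set 'cV[A]_a}, exists g0,
    forall n g (sees : 'I_(n + t) -> {set 'I_n}) (mu : 'I_n -> 'I_(n + t) -> A -> R),
    (g0 <= g)%N -> stair_pattern t b g sees ->
    (forall i j, is_pmf (mu i j)) -> (forall i j, i \in sees j -> spread_out eps (mu i j)) ->
    \sum_(F : 'M[A]_(a, n) | mx_image F == H)
       `|\prod_j kernel_prob (mu^~ j) (columns F) - (#|H|%:R ^- (n + t))| <= delta / B.
  move=> H; have [addH|naddH] := pselect (add_closed H); last first.
    exists 0%N => n' g sees mu _ _ _ _; rewrite big1 ?divr_ge0 ?ltW // => F /eqP FH.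
    by case: naddH; rewrite -FH; exact: mx_image_add_closed.
  have dB : 0 < delta / B by rewrite divr_gt0.
  have [g0 hg0] := kernel_prob_total t b addH e01 dB.
  exists g0 => n' g sees mu gg pat pmu smu.
  have cJ : #|'I_(n' + t)| = (#|'I_n'| + t)%N by rewrite !card_ord.
  apply: le_trans (hg0 _ _ sees g (fun j i => mu i j) gg pat cJ (fun j i => pmu i j) (fun j i => smu i j)).
  rewrite [leRHS](reindex (@columns (p ^ m.+1) a n')) /=; last first.
    exists (fun f : {ffun 'I_n' -> 'cV[A]_a} => \matrix_(i, j) f j i 0) => F _.
      by apply/matrixP => i j; rewrite mxE ffunE mxE.
    by apply/ffunP => i; apply/colP => k; rewrite ffunE !mxE.
  rewrite card_ord le_eqVlt; apply/orP; left; apply/eqP; apply: eq_bigl => F.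
  by rewrite (image_columnsP R F addH).
have [g0 hg0] := fin_all_exists exg.
exists (\max_H g0 H)%N => n' g sees mu gg pat pmu smu.
rewrite (partition_big (@mx_image _ _ _) predT) //=.
apply: (@le_trans _ _ (\sum_(H : {set 'cV[A]_a}) delta / B)).
  apply: ler_sum => H _; rewrite (eq_bigr (fun F =>
     `|\prod_j kernel_prob (mu^~ j) (columns F) - (#|H|%:R ^- (n' + t))|)); last first.
    by move=> F /eqP ->.
  by apply: (hg0 H n' g sees mu _ pat pmu smu); apply: leq_trans gg; exact: leq_bigmax.
by rewrite sumr_const -mulr_natr divfK // gt_eqF.
Qed.

Lemma card_good_total s n :
  #|[set F : 'M[A]_(r + s, n) | good_matrix K F]| =
  (onto_count n * (#|K| ^ s * \prod_(i < s) (p ^ n - p ^ i)))%N.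
Proof.
have := card_good_annihilating R p_prime K s (0 : 'M[A]_(n, 0)).
rewrite (eq_card (B := [set F : 'M[A]_(r + s, n) | good_matrix K F])); last first.
  by move=> F; rewrite !inE mulmx0 eqxx andbT.
move=> ->; rewrite (eq_bigr (fun=> #|K| ^ s * \prod_(i < s) (p ^ n - p ^ i)))%N; last first.
  by move=> phi /andP[/eqP phiK _]; rewrite (corank_size0 R p_prime pmK phiK).
rewrite sum_nat_const; congr (_ * _)%N; apply: eq_card => phi.
by rewrite !inE unfold_in mulmx0 eqxx andbT.
Qed.

(** The moment as it would be if every good [F] killed the random matrix with probability
    [#|mx_image F| ^- (n + t)]; the factor [#|K| ^ s] has been divided out. *)
Definition moment_main s t n : R :=
  (onto_count n * \prod_(i < s) (p ^ n - p ^ i))%N%:R * (#|K| * p ^ s)%:R ^- (n + t).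

Lemma moment_close s t b (eps delta : R) : 0 < eps < 1 -> 0 < delta ->
  exists g0, forall n g (sees : 'I_(n + t) -> {set 'I_n})
    (mu : 'I_n -> 'I_(n + t) -> A -> R),
  (g0 <= g)%N -> stair_pattern t b g sees ->
  (forall i j, is_pmf (mu i j)) -> (forall i j, i \in sees j -> spread_out eps (mu i j)) ->
  `|\sum_X mx_prob mu X * (corank_moment s X)%:R - moment_main s t n| <= delta.
Proof.
move=> e01 d0; have [g0 hg0] := sum_image_le t b e01 d0 (r + s).
exists g0 => n g sees mu gg pat pmu smu.
apply: le_trans (hg0 n g sees mu gg pat pmu smu).
have Ks : 1 <= #|K|%:R ^+ s :> R by rewrite exprn_ege1 // ler1n.
have Ks0 : #|K|%:R ^+ s != 0 :> R by rewrite gt_eqF // (lt_le_trans ltr01).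
(* Being at least 1, the factor [#|K| ^ s] may be inserted; it turns the moment into an expected
   number of good matrices. *)
apply: (@le_trans _ _ (#|K|%:R ^+ s *
    `|\sum_X mx_prob mu X * (corank_moment s X)%:R - moment_main s t n|)).
  by rewrite ler_peMl.
rewrite -[X in X * _]ger0_norm; last by rewrite (le_trans ler01).
rewrite -normrM mulrBr.
have -> : #|K|%:R ^+ s * (\sum_X mx_prob mu X * (corank_moment s X)%:R) =
    \sum_(F : 'M[A]_(r + s, n) | good_matrix K F)
      \prod_j kernel_prob (mu^~ j) (columns F).
  under [RHS]eq_bigr do rewrite -sum_mx_prob_kernel.
  rewrite exchange_big mulr_sumr; apply: eq_bigr => X _.
  rewrite mulrCA -mulr_sumr -natrX -natrM -natr_sum; congr (_ * _%:R).
  rewrite /corank_moment big_distrr /= -(card_good_annihilating R p_prime).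
  rewrite -sum1_card [RHS]big_mkcond /= big_mkcond /=; apply: eq_bigr => F _; rewrite inE.
  by case: (good_matrix _ _) => //=; case: (_ == _).
have -> : #|K|%:R ^+ s * moment_main s t n =
    \sum_(F : 'M[A]_(r + s, n) | good_matrix K F) #|mx_image F|%:R ^- (n + t).
  rewrite (eq_bigr (fun=> (#|K| * p ^ s)%:R ^- (n + t))); last first.
    by move=> F /(card_image_good R p_prime) ->.
  rewrite sumr_const -[RHS]mulr_natl /moment_main mulrA; congr (_ * _).
  rewrite -natrX -natrM mulnCA -card_good_total; congr _%:R.
  by apply: eq_card => F; rewrite inE.
rewrite -sumrB; apply: le_trans (ler_norm_sum _ _ _) _.
rewrite [leRHS](bigID (fun F => good_matrix K F)) /= lerDl.
exact: sumr_ge0.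
Qed.

End Moments.

(** * Limits of the moments *)

Section MomentLimits.
Variables (R : realType) (p m r : nat).
Hypothesis p_prime : prime p.
Local Notation A := 'Z_(p ^ m.+1).
Variable K : {set 'cV[A]_r}.
Hypothesis addK : add_closed K.
Hypothesis pmK : {in K, forall v, (p ^ m)%:R *: v = 0}.

Let K_gt0 : (0 < #|K|)%N. Proof. by apply/card_gt0P; exists 0; case: addK. Qed.
Let p_gt1 : (1 < p)%N. Proof. exact: prime_gt1. Qed.
Let q := #|K|%:R : R.
Let q_gt0 : 0 < q. Proof. by rewrite ltr0n. Qed.
Let P := p%:R : R.
Let P_gt1 : 1 < P. Proof. by rewrite ltr1n. Qed.
Let P_gt0 : 0 < P. Proof. exact: lt_trans P_gt1. Qed.
Let nz := @nonorth (p ^ m.+1) r.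

Lemma card_orth_in_half u : u \notin annihilator nz K ->
  (2 * #|orth_in nz K [set u]| <= #|K|)%N.
Proof.
have [h1 h2 U0] := dual_pair_vectors R addK.
set H := orth_in nz K [set u] => uK.
have HK : H \subset K by apply/fintype.subsetP => v; rewrite inE => /andP[].
have [v vK uv] : exists2 v, v \in K & nz u v.
  by move: uK; rewrite inE negb_forall => /existsP[v]; rewrite negb_imply negbK => /andP[]; exists v.
have vH : v \notin H.
  rewrite inE vK /= negb_forall; apply/existsP; exists u.
  by rewrite inE eqxx uv.
have annH0 : (0 < #|annihilator nz H|)%N.
  by apply/card_gt0P; exists 0; exact: (proj1 (annihilator_add_closed _)).
rewrite -(leq_pmul2r annH0) -mulnA h1 -(card_annihilator R addK) mulnCA leq_mul2l.
apply/orP; right; apply: leq_trans (h2 _ _ vK vH); rewrite leq_mul2l /=.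
apply/subset_leq_card/fintype.subsetP => w; rewrite !inE => /forall_inP wK.
rewrite wK // andbT; apply/forall_inP => x xH; apply: wK; exact: (fintype.subsetP HK).
Qed.

(** Union bound: columns in [K] that do not generate it all lie in [orth_in K [set u]] for some [u],
    a subgroup of index at least 2. *)
Lemma onto_count_bounds n :
  1 - #|{: 'rV[A]_r}|%:R / 2 ^+ n <= (onto_count K n)%:R / q ^+ n <= 1.
Proof.
pose Sp := [set f : {ffun 'I_n -> 'cV[A]_r} | (f \in ffun_on (mem K)) && spans nz K f].
have -> : onto_count K n = #|Sp|.
  rewrite /onto_count -(card_imset _ (@columns_inj (p ^ m.+1) r n)); apply: eq_card => f.
  apply/imsetP/idP => [[F]|]; first by rewrite inE (image_columnsP R F addK) => FK ->; rewrite inE.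
  move=> fS; pose F := \matrix_(i, j) f j i 0.
  have fF : f = columns F by apply/ffunP => i; apply/colP => k; rewrite ffunE !mxE.
  by exists F => //; rewrite inE (image_columnsP R F addK) -fF; move: fS; rewrite inE.
have qn0 : 0 < q ^+ n by rewrite exprn_gt0.
have cK : #|[set f : {ffun 'I_n -> 'cV[A]_r} | f \in ffun_on (mem K)]| = (#|K| ^ n)%N.
  by rewrite -[in RHS](card_ord n) -card_ffun_on; apply: eq_card => f; rewrite inE.
have qnE : q ^+ n = (#|K| ^ n)%N%:R by rewrite natrX.
rewrite ler_pdivlMr // ler_pdivrMr // mul1r qnE; apply/andP; split; last first.
  by rewrite ler_nat -cK subset_leq_card //; apply/fintype.subsetP => f; rewrite !inE => /andP[].
rewrite mulrBl mul1r lerBlDr -[in leLHS]cK -[in leLHS](cardsID [set f | spans nz K f]) natrD; apply: lerD.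
  by rewrite ler_nat subset_leq_card //; apply/fintype.subsetP => f; rewrite !inE.
pose W u := [set f : {ffun 'I_n -> 'cV[A]_r} | f \in ffun_on (mem (orth_in nz K [set u]))].
have sub : [set f : {ffun 'I_n -> 'cV[A]_r} | f \in ffun_on (mem K)] :\: [set f | spans nz K f]
    \subset \bigcup_(u in ~: annihilator nz K) W u.
  apply/fintype.subsetP => f; rewrite !inE => /andP[+ /ffun_onP fK].
  rewrite negb_forall => /existsP[u]; rewrite negb_imply -eqn0Ngt cards_eq0 => /andP[uK /eqP/setP w0].
  apply/finset.bigcupP; exists u => //; rewrite inE; apply/ffun_onP => i.
  have := w0 i; rewrite !inE (fK i) /= => /negbT fi; apply/forall_inP => u'.
  by rewrite inE => /eqP ->.
rewrite mulrAC ler_pdivlMr ?exprn_gt0 //.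
rewrite -(natrX _ 2) -!natrM ler_nat.
apply: leq_trans (leq_mul (subset_leq_card sub) (leqnn _)) _.
have card_bigcup (B : {set 'rV[A]_r}) : (#|\bigcup_(u in B) W u| <= \sum_(u in B) #|W u|)%N.
  elim/big_rec2: _ => [|u k C _ IH]; first by rewrite finset.cards0.
  by apply: leq_trans (leq_card_setU _ _) _; rewrite leq_add2l.
apply: leq_trans (leq_mul (card_bigcup _) (leqnn _)) _.
rewrite big_distrl /= -[#|{: 'rV[A]_r}|]sum1_card [leqRHS]big_distrl /=.
apply: (@leq_trans (\sum_(u in ~: annihilator nz K) #|K| ^ n)); last first.
  rewrite [leqRHS](bigID (mem (~: annihilator nz K))) /=; apply: leq_trans (leq_addr _ _).
  by apply: leq_sum => u _; rewrite mul1n.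
apply: leq_sum => u; rewrite finset.in_setC => uK.
have -> : #|W u| = (#|orth_in nz K [set u]| ^ n)%N.
  by rewrite -[in RHS](card_ord n) -card_ffun_on; apply: eq_card => f; rewrite inE.
by rewrite -expnMn mulnC; case: (n) => // k; rewrite leq_exp2r // card_orth_in_half.
Qed.

Lemma onto_count_limit : ((onto_count K n)%:R / q ^+ n @[n --> \oo] --> (1 : R))%classic.
Proof.
apply: (squeeze_cvgr (f := fun n => 1 - #|{: 'rV[A]_r}|%:R / 2 ^+ n) (h := fun=> 1)).
- by apply: nearW => n; exact: onto_count_bounds.
- suff : (1 - #|{: 'rV[A]_r}|%:R * (2^-1 : R) ^+ n @[n --> \oo] --> (1 : R) - #|{: 'rV[A]_r}|%:R * 0)%classic.
    by rewrite mulr0 subr0; under eq_fun do rewrite exprVn.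
  apply: cvgB; first exact: cvg_cst.
  apply: cvgMl_tmp; apply: cvg_expr; rewrite ger0_norm ?invr_ge0 //; lra.
- exact: cvg_cst.
Qed.

Lemma falling_power_limit s :
  ((\prod_(i < s) (p ^ n - p ^ i))%N%:R / P ^+ (n * s) @[n --> \oo] --> (1 : R))%classic.
Proof.
have -> : (fun n => (\prod_(i < s) (p ^ n - p ^ i))%N%:R / P ^+ (n * s)) =
    (fun n => \prod_(i < s) ((p ^ n - p ^ i)%N%:R / P ^+ n)) :> (nat -> R).
  apply/funext => n; rewrite natr_prod prodf_div; congr (_ / _).
  by rewrite prodr_const card_ord exprM.
suff : (\prod_(i < s) ((p ^ n - p ^ i)%N%:R / P ^+ n) @[n --> \oo] --> \prod_(i < s) (1 : R))%classic.
  by rewrite big1.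
apply: cvg_big => [|i _]; first exact: mul_continuous.
have : (1 - P ^+ i * P^-1 ^+ n @[n --> \oo] --> (1 : R) - P ^+ i * 0)%classic.
  apply: cvgB; first exact: cvg_cst.
  apply: cvgMl_tmp; apply: cvg_expr; rewrite ger0_norm ?invr_ge0 ?(ltW P_gt0) //.
  by rewrite invf_lt1.
rewrite mulr0 subr0; apply: cvg_trans; apply: near_eq_cvg; near=> n.
have ni : (i <= n)%N by near: n; exists i.
rewrite natrB ?leq_exp2l // !natrX mulrBl divff ?expf_neq0 ?gt_eqF //.
by rewrite exprVn.
Unshelve. all: by end_near.
Qed.

(** The growth in [n] cancels and only the [t] extra columns leave a trace, so the sieve series is
    evaluated at [x = p ^- t]. *)
Lemma moment_main_limit s t :
  (moment_main R K s t n @[n --> \oo] --> q ^- t * (P ^- t) ^+ s)%classic.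
Proof.
have -> : moment_main R K s t =
    (fun n => ((onto_count K n)%:R / q ^+ n) *
       ((\prod_(i < s) (p ^ n - p ^ i))%N%:R / P ^+ (n * s)) * (q ^- t * (P ^- t) ^+ s)).
  apply/funext => n; rewrite /moment_main !natrM natrX -/q -/P.
  have -> : (q * P ^+ s) ^+ (n + t) = (q ^+ n * q ^+ t) * (P ^+ (n * s) * P ^+ (t * s)).
    by rewrite exprMn exprD -exprM mulnDr exprD ![(s * _)%N]mulnC.
  by rewrite exprVn -exprM !invfM; ring.
suff : (((onto_count K n)%:R / q ^+ n) *
       ((\prod_(i < s) (p ^ n - p ^ i))%N%:R / P ^+ (n * s)) * (q ^- t * (P ^- t) ^+ s)
     @[n --> \oo] --> (1 : R) * 1 * (q ^- t * (P ^- t) ^+ s))%classic by rewrite !mul1r.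
by apply: cvgMr_tmp; apply: cvgM; [exact: onto_count_limit | exact: falling_power_limit].
Qed.

End MomentLimits.

Lemma euler_product_cvg (R : realType) p t : prime p ->
  (\prod_(i < N) (1 - (p%:R : R) ^- t / p%:R ^+ i.+1) @[N --> \oo] --> euler_product R p t)%classic.
Proof.
move=> p_prime; have := @is_cvg_euler_product R p t p_prime; rewrite /euler_product.
suff -> : (fun m : nat => \prod_(1 <= i < m.+1) (1 - (p%:R : R) ^- (i + t))) =
  (fun N => \prod_(i < N) (1 - (p%:R : R) ^- t / p%:R ^+ i.+1)) by [].
apply/funext => N; rewrite big_add1 /= big_mkord; apply: eq_bigr => i _.
by rewrite exprD invfM mulrC.
Qed.

Section IsoExpectation.
Variables (R : realType) (p m r : nat).
Hypothesis p_prime : prime p.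
Local Notation A := 'Z_(p ^ m.+1).
Variable K : {set 'cV[A]_r}.
Hypothesis addK : add_closed K.
Hypothesis pmK : {in K, forall v, (p ^ m)%:R *: v = 0}.

Let K_gt0 : (0 < #|K|)%N. Proof. by apply/card_gt0P; exists 0; case: addK. Qed.
Let p_gt1 : (1 < p)%N. Proof. exact: prime_gt1. Qed.
Let q := #|K|%:R : R.
Let P := p%:R : R.
Let P_ge1 : 1 <= P. Proof. by rewrite ler1n ltnW. Qed.

(** Truncated subtraction does no harm: if a factor with [i > e] occurs, so does the one with
    [i = e], which is 0 on both sides. *)
Lemma falling_power_natr s e :
  (\prod_(i < s) (p ^ e - p ^ i))%N%:R = \prod_(i < s) ((p ^ e)%:R - P ^+ i) :> R.
Proof.
case: (leqP s e) => se.
  rewrite natr_prod; apply: eq_bigr => i _; rewrite natrB ?natrX // leq_exp2l //.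
  by apply: ltnW; exact: leq_trans se.
rewrite natr_prod [LHS](bigD1 (Ordinal se)) //= [RHS](bigD1 (Ordinal se)) //=.
by rewrite subnn natrX subrr [LHS]mul0r [RHS]mul0r.
Qed.

Lemma sum_corank_moment S n c (X : 'M[A]_(n, c)) :
  \sum_(s < S.+1) sieve_coef R p s * (corank_moment K s X)%:R =
  \sum_(phi : 'M[A]_(r, n) | (mx_image phi == K) && (phi *m X == 0))
     sieve p S ((corank_size K phi X)%:R : R).
Proof.
rewrite /sieve exchange_big /=; apply: eq_bigr => s _.
rewrite -mulr_sumr /corank_moment natr_sum; congr (_ * _).
apply: eq_bigr => phi /andP[/eqP phiK /eqP phiX].
by have [e ->] := corank_size_pow R p_prime phiK phiX; rewrite falling_power_natr.
Qed.

Lemma iso_count_bracket S n c (X : 'M[A]_(n, c)) :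
  \sum_(s < S.*2.+2) sieve_coef R p s * (corank_moment K s X)%:R <= (iso_count K X)%:R
  <= \sum_(s < S.*2.+1) sieve_coef R p s * (corank_moment K s X)%:R.
Proof.
rewrite !sum_corank_moment.
have -> : (iso_count K X)%:R = \sum_(phi : 'M[A]_(r, n) | (mx_image phi == K) && (phi *m X == 0))
    (corank_size K phi X == 1)%N%:R :> R.
  rewrite -natr_sum /iso_count -sum1_card; congr _%:R.
  rewrite big_mkcond [RHS]big_mkcond; apply: eq_bigr => phi _; rewrite inE.
  case: eqP => //= phiK; case: (phi *m X =P 0) => phiX.
    by rewrite (corank_size_eq1 R p_prime phiK phiX); case: (_ == _).
  case: eqP => // kerX; case: phiX; apply/matrixP => i j.
  have : X *m delta_mx j 0 \in mx_kernel phi by rewrite kerX; exact: imset_f.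
  by rewrite inE mulmxA -colE => /eqP/colP/(_ i); rewrite !mxE.
have e1 e : (p ^ e == 1)%N = (e == 0)%N by rewrite -[X in _ == X](expn0 p) eqn_exp2l.
apply/andP; split; apply: ler_sum => phi /andP[/eqP phiK /eqP phiX];
  have [e ->] := corank_size_pow R p_prime phiK phiX;
  by rewrite e1; case/andP: (sieve_bracket R p_gt1 S e).
Qed.

Lemma sum_norm_sieve_coef N : \sum_(s < N) `|sieve_coef R p s| <= 4.
Proof.
suff : \sum_(s < N) `|sieve_coef R p s| <= 4 - 4 * (2^-1) ^+ N.
  by move/le_trans; apply; rewrite lerBlDr lerDl mulr_ge0 // exprn_ge0 // invr_ge0.
elim: N => [|N IH]; first by rewrite big_ord0 expr0 mulr1 subrr.
rewrite big_ord_recr /= exprS.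
have := norm_sieve_coef_le R p_gt1 N; move: IH.
by set a := \sum_(_ < _) _; set b := `|_|; move: (2^-1 ^+ N) => z; lra.
Qed.

Lemma iso_count_expectation t b (eps delta : R) : 0 < eps < 1 -> 0 < delta ->
  exists g0 n0, forall n g (sees : 'I_(n + t) -> {set 'I_n})
    (mu : 'I_n -> 'I_(n + t) -> A -> R),
  (n0 <= n)%N -> (g0 <= g)%N -> stair_pattern t b g sees ->
  (forall i j, is_pmf (mu i j)) -> (forall i j, i \in sees j -> spread_out eps (mu i j)) ->
  `|\sum_X mx_prob mu X * (iso_count K X)%:R - q ^- t * euler_product R p t| <= delta.
Proof.
move=> e01 d0; pose x := P ^- t; pose E := euler_product R p t.
have x0 : 0 <= x by rewrite invr_ge0 exprn_ge0 // (le_trans ler01).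
have x1 : x <= 1 by rewrite invf_le1 ?exprn_ege1 // exprn_gt0 // (lt_le_trans ltr01).
have q1 : 0 <= q ^- t <= 1.
  rewrite invr_ge0 exprn_ge0 ?ler0n //= invf_le1 ?exprn_ege1 ?exprn_gt0 ?ltr0n //.
  by rewrite ler1n.
have [S small] : exists S, forall k, (S <= k)%N -> `|sieve_coef R p k| <= delta / 2.
  have : (2 * (2^-1 : R) ^+ k @[k --> \oo] --> 2 * (0 : R))%classic.
    apply: cvgMl_tmp; apply: cvg_expr; rewrite ger0_norm ?invr_ge0 //; lra.
  rewrite mulr0 => cv; have d2 : 0 < delta / 2 by lra.
  have [S _ hS] := cvgr_lt _ cv _ d2.
  by exists S => k Sk; apply: le_trans (norm_sieve_coef_le R p_gt1 k) _; exact/ltW/hS.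
(* Each moment will be within [2 * d'] of its limit, and the coefficients sum to at most 4 in
   absolute value: [8 * d' = delta / 2]. *)
pose d' := delta / 16; have d'0 : 0 < d' by rewrite /d'; lra.
have exg : forall s : 'I_(S.*2.+2), exists gn : nat * nat,
    forall n g (sees : 'I_(n + t) -> {set 'I_n}) (mu : 'I_n -> 'I_(n + t) -> A -> R),
    (gn.2 <= n)%N -> (gn.1 <= g)%N -> stair_pattern t b g sees ->
    (forall i j, is_pmf (mu i j)) -> (forall i j, i \in sees j -> spread_out eps (mu i j)) ->
    `|\sum_X mx_prob mu X * (corank_moment K s X)%:R - q ^- t * x ^+ s| <= 2 * d'.
  move=> s; have [g0 hg0] := moment_close p_prime addK pmK s t b e01 d'0.
  have /cvgrPdist_le/(_ _ d'0)[n0 _ hn0] := @moment_main_limit R p m r p_prime K addK s t.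
  exists (g0, n0) => n g sees mu /= nn gg pat pmu smu.
  have h1 := hg0 n g sees mu gg pat pmu smu; have h2 := hn0 n nn; rewrite /= distrC in h2.
  rewrite -[X in `|X|](subrKA (moment_main R K s t n)).
  by apply: le_trans (ler_normD _ _) _; rewrite mulr2n mulrDl mul1r; apply: lerD.
have [gn hgn] := fin_all_exists exg.
exists (\max_s (gn s).1)%N, (\max_s (gn s).2)%N => n g sees mu nn gg pat pmu smu.
pose T s := \sum_X mx_prob mu X * (corank_moment K s X)%:R.
have Tclose s : (s < S.*2.+2)%N -> `|T s - q ^- t * x ^+ s| <= 2 * d'.
  move=> sS; apply: (hgn (Ordinal sS) n g sees) => //.
    by apply: leq_trans nn; exact: (leq_bigmax (Ordinal sS)).
  by apply: leq_trans gg; exact: (leq_bigmax (Ordinal sS)).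
have sumclose k : (S <= k)%N -> (k < S.*2.+2)%N ->
    `|\sum_(s < k.+1) sieve_coef R p s * T s - q ^- t * E| <= delta.
  move=> Sk kS; rewrite -[X in `|X|](subrKA (q ^- t * sieve_sum p k x)).
  apply: le_trans (ler_normD _ _) _; rewrite [leRHS](splitr delta); apply: lerD.
    rewrite /sieve_sum mulr_sumr -sumrB; apply: le_trans (ler_norm_sum _ _ _) _.
    apply: (@le_trans _ _ (\sum_(s < k.+1) `|sieve_coef R p s| * (2 * d'))).
      apply: ler_sum => i _; rewrite mulrCA -mulrBr normrM; apply: ler_wpM2l => //.
      by apply: Tclose; apply: leq_trans (ltn_ord i) _.
    rewrite -mulr_suml; apply: le_trans (ler_wpM2r _ (sum_norm_sieve_coef _)) _; rewrite /d'; lra.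
  rewrite -mulrBr normrM ger0_norm; last by case/andP: q1.
  have h := sieve_sum_limit p_gt1 k (introT andP (conj x0 x1)) (@euler_product_cvg R p t p_prime).
  rewrite -[leRHS]mul1r; apply: ler_pM; [by case/andP: q1 | by [] | by case/andP: q1 |].
  apply: le_trans h _; apply: le_trans (small k Sk).
  by rewrite ler_piMr.
have exch N : \sum_(s < N) sieve_coef R p s * T s =
    \sum_X mx_prob mu X * \sum_(s < N) sieve_coef R p s * (corank_moment K s X)%:R.
  rewrite /T; under eq_bigr do rewrite mulr_sumr.
  rewrite exchange_big; apply: eq_bigr => X _; rewrite mulr_sumr; apply: eq_bigr => s _.
  by rewrite mulrCA.
have up := sumclose S.*2; have lo := sumclose S.*2.+1.
have SS : (S <= S.*2)%N by rewrite -addnn leq_addr.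
move: (up SS (leqnSn _)) (lo (leqW SS) (leqnn _)); rewrite !exch => {up lo}.
set U := \sum_X _; set L := \sum_X _; set W := \sum_X _.
have WU : W <= U.
  by apply: ler_sum => X _; apply: ler_wpM2l; [exact: mx_prob_ge0 | case/andP: (iso_count_bracket S X)].
have LW : L <= W.
  by apply: ler_sum => X _; apply: ler_wpM2l; [exact: mx_prob_ge0 | case/andP: (iso_count_bracket S X)].
rewrite !ler_norml => /andP[_ u] /andP[l _]; apply/andP; split.
  by apply: le_trans l _; rewrite lerD2r.
by apply: le_trans u; rewrite lerD2r.
Qed.

End IsoExpectation.

(** * From the p-adic integers to Z/p^(m+1) *)

Section PadicResidues.
Variable p : nat.
Hypothesis p_prime : prime p.

Let p_gt1 : (1 < p)%N. Proof. exact: prime_gt1. Qed.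

Let P_gt1 k : (1 < p ^ k.+1)%N.
Proof. by rewrite -(exp1n k.+1) ltn_exp2r. Qed.

(** The level comes first, so that [resid k] can be declared a ring morphism. *)
Definition resid k (x : padic p) : 'Z_(p ^ k.+1) := residue x k.

Lemma resid_zmod_morphism k : zmod_morphism (resid k). Proof. by []. Qed.
Lemma resid_monoid_morphism k : monoid_morphism (resid k). Proof. by []. Qed.

HB.instance Definition _ k :=
  GRing.isZmodMorphism.Build (padic p) ('Z_(p ^ k.+1)) (resid k) (resid_zmod_morphism k).
HB.instance Definition _ k :=
  GRing.isMonoidMorphism.Build (padic p) ('Z_(p ^ k.+1)) (resid k) (resid_monoid_morphism k).

Lemma natr_Zpp_val k a : ((a%:R : 'Z_(p ^ k.+1)) : nat) = (a %% p ^ k.+1)%N.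
Proof. by rewrite val_Zp_nat. Qed.

Lemma natr_Zpp_eq k a b :
  (a%:R == b%:R :> 'Z_(p ^ k.+1)) = (a == b %[mod p ^ k.+1]).
Proof. by rewrite -val_eqE /= !natr_Zpp_val. Qed.

Lemma resid_val_mod k l (x : padic p) : (k <= l)%N ->
  (resid k x : nat) = (resid l x %% p ^ k.+1)%N.
Proof.
elim: l => [|l IH].
  by rewrite leqn0 => /eqP ->; rewrite modn_small // -[X in (_ < X)%N]Zp_cast.
rewrite leq_eqVlt => /predU1P[->|kl].
  by rewrite modn_small // -[X in (_ < X)%N]Zp_cast.
rewrite IH //; have := residue_compat x l; rewrite -/(resid l x) => <-.
by rewrite natr_Zpp_val modn_dvdm // dvdn_exp2l.
Qed.

Lemma natrM_Zpp_reduce k (a b : 'Z_(p ^ k.+2)) :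
  (nat_of_ord (a * b))%:R = (a : nat)%:R * (b : nat)%:R :> 'Z_(p ^ k.+1).
Proof.
rewrite -natrM; apply/eqP; rewrite natr_Zpp_eq.
have -> : ((a * b)%R : nat) = ((a : nat) * b %% p ^ k.+2)%N by rewrite /=; congr (_ %% _)%N; exact: Zp_cast.
by rewrite modn_dvdm // dvdn_exp2l.
Qed.

(** Division shifts the level: the quotient modulo [p ^ (k + 1)] is read off the residue of [z]
    modulo [p ^ (k + m + 2)]. *)
Lemma padic_divisible m (z : padic p) : resid m z = 0 ->
  exists y : padic p, z = (p ^ m.+1)%:R * y.
Proof.
move=> z0; pose Z k := nat_of_ord (resid (k + m.+1) z).
have ZE k l : (k <= l)%N -> Z k = (Z l %% p ^ (k + m.+2))%N.
  by move=> kl; rewrite [(k + m.+2)%N]addnS; apply: resid_val_mod; rewrite leq_add2r.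
have dvdZ k : (p ^ m.+1 %| Z k)%N.
  by rewrite /dvdn -(@resid_val_mod m (k + m.+1)) ?z0 // (leq_trans (leqnSn m)) // leq_addl.
pose y k : 'Z_(p ^ k.+1) := (Z k %/ p ^ m.+1)%N%:R.
have ycompat k : (y k.+1 : nat)%:R = y k.
  apply/eqP; rewrite natr_Zpp_eq natr_Zpp_val modn_dvdm ?dvdn_exp2l //.
  rewrite (ZE k k.+1) //; have := divn_eq (Z k.+1) (p ^ (k + m.+2)).
  set w := (_ %/ p ^ (k + m.+2))%N; set v := (_ %% p ^ (k + m.+2))%N => ->.
  rewrite -[(k + m.+2)%N]addSnnS expnD mulnA divnMDl ?expn_gt0 ?(ltnW p_gt1) //.
  by rewrite modnMDl.
exists (Padic ycompat); apply: padic_eqP => k.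
rewrite -[residue (_ * _) k]/(resid k (_ * Padic ycompat)) rmorphM rmorph_nat.
rewrite -[X in _ = _ * X]/(y k) -natrM mulnC divnK // -[residue z k]natr_Zp.
apply/eqP; rewrite natr_Zpp_eq -/(resid k z) (@resid_val_mod k (k + m.+1)) ?leq_addr //.
by rewrite modn_mod.
Qed.

Lemma padic_invertible (x : padic p) : resid 0 x = 1 -> exists y : padic p, x * y = 1.
Proof.
move=> x1; have xu k : resid k x \is a GRing.unit.
  rewrite -(natr_Zp (resid k x)) unitZpE // coprimeXl // prime_coprime //.
  apply/negP => px; have := @resid_val_mod 0 k x (leq0n k).
  by move: px; rewrite /dvdn x1 expn1 => /eqP ->; rewrite /= modn_small.
pose y k : 'Z_(p ^ k.+1) := (resid k x)^-1.
have ycompat k : (y k.+1 : nat)%:R = y k.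
  apply: (mulrI (xu k)); rewrite [RHS]mulrV ?xu //.
  have := residue_compat x k; rewrite -/(resid k x) -/(resid k.+1 x) => <-.
  by rewrite -natrM_Zpp_reduce mulrV ?xu.
exists (Padic ycompat); apply: padic_eqP => k.
by rewrite -[LHS]/(resid k x * y k) mulrV ?xu.
Qed.

Lemma resid_natr k a : resid k a%:R = a%:R.
Proof. exact: rmorph_nat. Qed.

End PadicResidues.

(* The elements of [G] give a surjection from a free module onto [G]; pairing with
   all functionals that vanish on its kernel embeds [G] in a free module. *)
Section Embedding.
Variables (R : realType) (p : nat) (gT : finGroupType) (G : {group gT}).
Hypothesis p_prime : prime p.
Hypothesis abelG : abelian G.
Hypothesis pG : (p.-group G)%g.

Let m := logn p #|G|.
Local Notation A := 'Z_(p ^ m.+1).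

Let cardG : #|G| = (p ^ m)%N. Proof. exact: card_pgroup. Qed.

Let N_gt1 : (1 < p ^ m.+1)%N.
Proof. by rewrite -(exp1n m.+1) ltn_exp2r // prime_gt1. Qed.

Lemma prodg_abelian_split (I : finType) (F1 F2 : I -> gT) :
  (forall i, F1 i \in G) -> (forall i, F2 i \in G) ->
  (\prod_i (F1 i * F2 i) = (\prod_i F1 i) * (\prod_i F2 i))%g.
Proof.
move=> F1G F2G; elim: (index_enum I) => [|i s IH]; first by rewrite !big_nil mulg1.
rewrite !big_cons IH -!mulgA; congr (_ * _)%g; rewrite !mulgA; congr (_ * _)%g.
have comm := centsP abelG; apply: comm => //; exact: group_prod.
Qed.

Definition word_value (x : 'cV[A]_#|G|) : gT :=
  (\prod_(i < #|G|) enum_val i ^+ (x i 0%R : nat))%g.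

Lemma word_value_in x : word_value x \in G.
Proof. by apply: group_prod => i _; apply: groupX; exact: enum_valP. Qed.

Lemma expg_Zp (g : gT) (a b : A) : g \in G ->
  (g ^+ (a + b)%R = g ^+ a * g ^+ b)%g.
Proof.
move=> gG; rewrite -expgD; apply/eqP; rewrite eq_expg_mod_order.
have -> : ((a + b)%R : nat) = (((a : nat) + b) %% p ^ m.+1)%N.
  by rewrite /=; congr (_ %% _)%N; exact: Zp_cast.
rewrite modn_dvdm // (dvdn_trans (order_dvdG gG)) // cardG dvdn_exp2l //.
Qed.

Lemma word_valueD x y : word_value (x + y) = (word_value x * word_value y)%g.
Proof.
rewrite /word_value -prodg_abelian_split; last 2 first.
- by move=> i; apply: groupX; exact: enum_valP.
- by move=> i; apply: groupX; exact: enum_valP.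
by apply: eq_bigr => i _; rewrite mxE expg_Zp // enum_valP.
Qed.

Lemma word_value_delta i : word_value (delta_mx i 0) = enum_val i.
Proof.
rewrite /word_value (big_only1 i) // => [|j ji _]; first by rewrite mxE !eqxx expg1.
by rewrite mxE (negbTE ji) expg0.
Qed.

Lemma exists_embedding : exists r (K : {set 'cV[A]_r}) (iota : gT -> 'cV[A]_r),
  [/\ add_closed K, {in K, forall v, (p ^ m)%:R *: v = 0},
      {in G &, {morph iota : x y / (x * y)%g >-> x + y}},
      {in G &, injective iota} & [set iota g | g in G] = K].
Proof.
pose H := [set x | word_value x == 1%g].
have wv0 : word_value 0 = 1%g.
  by rewrite /word_value big1 // => i _; rewrite mxE expg0.
have addH : add_closed H.
  split; first by rewrite inE wv0.
  by move=> x y; rewrite !inE word_valueD => /eqP-> /eqP->; rewrite mulg1.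
pose Hp := annihilator (@nonorth (p ^ m.+1) #|G|) H.
pose U : 'M[A]_(#|Hp|, #|G|) := \matrix_(i, j) (enum_val i : 'rV[A]_#|G|) 0 j.
have UH x : (U *m x == 0) = (x \in H).
  have Ux0 y : U *m y = 0 <-> {in Hp, forall u, u *m y = 0}.
    split=> [/matrixP Uy u uHp|yHp].
      apply/matrixP => i j; have := Uy (enum_rank_in uHp u) j; rewrite !ord1 !mxE => e; rewrite -[RHS]e.
      by apply: eq_bigr => k _; rewrite mxE enum_rankK_in.
    apply/matrixP => i j; have /matrixP/(_ 0 j) := yHp _ (enum_valP i); rewrite !mxE => e; rewrite -[RHS]e.
    by apply: eq_bigr => k _; rewrite mxE.
  (* [H2] contains [H] and is killed by all of [Hp], so the order formula shows that it is no larger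
     than [H]. *)
  pose H2 := mx_kernel U; have addH2 : add_closed H2 by exact: mx_kernel_add_closed.
  have HH2 : H \subset H2.
    apply/fintype.subsetP => y yH; rewrite inE; apply/eqP/Ux0 => u /in_annihilator; exact.
  have annH2 : Hp \subset annihilator (@nonorth (p ^ m.+1) #|G|) H2.
    apply/fintype.subsetP => u uHp; apply/in_annihilator => y; rewrite inE => /eqP/Ux0; exact.
  have Hp0 : (0 < #|Hp|)%N.
    by apply/card_gt0P; exists 0; exact: (proj1 (annihilator_add_closed _)).
  have -> : H = H2; last by rewrite inE.
  apply/eqP; rewrite eqEcard HH2 /= -(leq_pmul2r Hp0) (card_annihilator R addH).
  by rewrite -(card_annihilator R addH2) leq_mul2l subset_leq_card ?orbT.
pose delta (g : gT) : 'cV[A]_#|G| := delta_mx (enum_rank_in (group1 G) g) 0.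
have wv_delta g : g \in G -> word_value (delta g) = g.
  by move=> gG; rewrite word_value_delta enum_rankK_in.
have Ueq x y : word_value x = word_value y -> U *m x = U *m y.
  move=> xy; apply/eqP; rewrite -subr_eq0 -mulmxBr UH inE.
  by rewrite -(inj_eq (mulIg (word_value y))) -word_valueD subrK xy mul1g.
pose iota g := U *m delta g.
exists #|Hp|, (mx_image U), iota; split.
- exact: mx_image_add_closed.
- move=> _ /imsetP[x _ ->]; rewrite scalemxAr; apply/eqP; rewrite UH inE scaler_nat.
  have -> k : word_value (x *+ k) = (word_value x ^+ k)%g.
    elim: k => [|k IH]; first by rewrite mulr0n wv0.
    by rewrite mulrS word_valueD IH -expgS.
  by rewrite -cardG expg_cardG // word_value_in.
- move=> g h gG hG; rewrite -mulmxDr; apply: Ueq.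
  by rewrite word_valueD !wv_delta // groupM.
- move=> g h gG hG /eqP; rewrite -subr_eq0 -mulmxBr UH inE => /eqP gh.
  by rewrite -(wv_delta g gG) -(subrK (delta h) (delta g)) word_valueD gh mul1g wv_delta.
apply/setP => v; apply/imsetP/imsetP => -[x].
  by move=> xG ->; exists (delta x).
move=> _ ->; exists (word_value x); first exact: word_value_in.
by apply: Ueq; rewrite wv_delta // word_value_in.
Qed.

End Embedding.

Lemma additive_matrix N n r (f : 'cV['Z_N]_n -> 'cV['Z_N]_r) :
  {morph f : x y / x + y} -> exists phi : 'M['Z_N]_(r, n), forall x, f x = phi *m x.
Proof.
move=> fD; have f0 : f 0 = 0 by apply: (addrI (f 0)); rewrite -fD !addr0.
have fZ (a : 'Z_N) x : f (a *: x) = a *: f x.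
  rewrite -(natr_Zp a) !scaler_nat; elim: (a : nat) => [|k IH]; first by rewrite !mulr0n f0.
  by rewrite !mulrS fD IH.
exists (\matrix_(i, j) f (delta_mx j 0) i 0) => x.
have -> : x = \sum_j x j 0 *: delta_mx j 0.
  by rewrite {1}[x]matrix_sum_delta; apply: eq_bigr => j _; rewrite big_ord1.
rewrite (big_morph f fD f0) mulmx_sumr; apply: eq_bigr => j _.
by rewrite fZ -scalemxAr -colE; congr (_ *: _); apply/colP => i; rewrite !mxE.
Qed.

(** * Matrices with prescribed image and kernel *)

Section IsoCount.
Variables (p : nat) (gT : finGroupType) (G : {group gT}) (m r : nat).
Hypothesis p_prime : prime p.
Local Notation A := 'Z_(p ^ m.+1).
Variables (K : {set 'cV[A]_r}) (iota : gT -> 'cV[A]_r).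
Hypothesis addK : add_closed K.
Hypothesis pmK : {in K, forall v, (p ^ m)%:R *: v = 0}.
Hypothesis iotaM : {in G &, {morph iota : x y / (x * y)%g >-> x + y}}.
Hypothesis iotaI : {in G &, injective iota}.
Hypothesis iotaK : [set iota g | g in G] = K.

Definition uniota (v : 'cV[A]_r) : gT := odflt 1%g [pick g in G | iota g == v].

Lemma iota_in g : g \in G -> iota g \in K.
Proof. by move=> gG; rewrite -iotaK imset_f. Qed.

Lemma uniotaP v : v \in K -> uniota v \in G /\ iota (uniota v) = v.
Proof.
rewrite -iotaK => /imsetP[g gG ->]; rewrite /uniota; case: pickP => [h /andP[hG /eqP ->]//|].
by move=> /(_ g); rewrite gG eqxx.
Qed.

Lemma iotaK_uniota g : g \in G -> uniota (iota g) = g.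
Proof. by move=> gG; have [uG] := uniotaP (iota_in gG); exact: iotaI. Qed.

Lemma uniotaD : {in K &, {morph uniota : v w / v + w >-> (v * w)%g}}.
Proof.
move=> v w vK wK; have [vG vE] := uniotaP vK; have [wG wE] := uniotaP wK.
by rewrite -{1}vE -{1}wE -iotaM // iotaK_uniota // groupM.
Qed.

Lemma uniota_inj : {in K &, injective uniota}.
Proof. by move=> v w /uniotaP[_ vE] /uniotaP[_ wE] vw; rewrite -vE -wE vw. Qed.

Lemma iota1 : iota 1%g = 0.
Proof. by apply: (addrI (iota 1%g)); rewrite -iotaM ?group1 // mulg1 addr0. Qed.

Definition iso_maps n (L : {set 'cV[A]_n}) : {set 'M[A]_(r, n)} :=
  [set phi : 'M[A]_(r, n) | (mx_image phi == K) && (mx_kernel phi == L)].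

(** Two maps onto [K] with the same kernel differ by a unique automorphism of [K], that is of [G]:
    if nonempty, [iso_maps L] is a torsor under [Aut G]. *)
Lemma card_iso_maps n (L : {set 'cV[A]_n}) phi0 :
  phi0 \in iso_maps L -> #|iso_maps L| = #|Aut G|.
Proof.
rewrite inE => /andP[/eqP im0 /eqP ker0].
have in0 x : phi0 *m x \in K by rewrite -im0 imset_f.
pose F (a : {perm gT}) x := iota (a (uniota (phi0 *m x))).
have aG a g : a \in Aut G -> g \in G -> a g \in G.
  by move=> aA gG; rewrite (Aut_closed aA).
have aM a : a \in Aut G -> {in G &, {morph a : x y / (x * y)%g}}.
  by move=> /Aut_morphic/morphicP.
have FD a : a \in Aut G -> {morph F a : x y / x + y}.
  move=> aA x y; have [xG _] := uniotaP (in0 x); have [yG _] := uniotaP (in0 y).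
  by rewrite /F mulmxDr (uniotaD (in0 x) (in0 y)) (aM a aA _ _ xG yG) iotaM // aG.
have onto0 g : g \in G -> exists x, phi0 *m x = iota g.
  by move=> gG; have := iota_in gG; rewrite -im0 => /imsetP[x _ ->]; exists x.
pose M (a : {perm gT}) : 'M[A]_(r, n) := \matrix_(i, j) F a (delta_mx j 0) i 0.
have ME a x : a \in Aut G -> F a x = M a *m x.
  move=> aA; have [phi phiE] := additive_matrix (FD a aA).
  suff -> : M a = phi by exact: phiE.
  by apply/matrixP => i j; rewrite mxE phiE -colE mxE.
have a_inj a : injective (a : {perm gT}) by exact: perm_inj.
have MI : {in Aut G &, injective M}.
  move=> a b aA bA Mab; apply: (eq_Aut aA bA) => g gG.
  have [x xg] := onto0 g gG; have := ME a x aA; rewrite Mab -ME // /F xg iotaK_uniota //.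
  by apply: iotaI; rewrite aG.
rewrite -(card_in_imset MI); apply: eq_card => phi; apply/idP/imsetP => [|[a aA ->]]; last first.
  have a1 g : g \in G -> (a g == 1%g) = (g == 1%g).
    move=> gG; have e := aM a aA _ _ (group1 G) (group1 G); rewrite mulg1 in e.
    have a11 : a 1%g = 1%g by apply: (mulgI (a 1%g)); rewrite mulg1 -e.
    by rewrite -[RHS](inj_eq (a_inj a)) a11.
  rewrite inE; apply/andP; split; apply/eqP.
    apply/setP => v; apply/imsetP/idP => [[x _ ->]|vK].
      by rewrite -ME //; apply: iota_in; apply: aG => //; case: (uniotaP (in0 x)).
    have [gG gE] := uniotaP vK; set g := uniota v in gG gE.
    have aV : (a^-1)%g \in Aut G by rewrite groupV.
    have [x xg] := onto0 ((a^-1)%g g) (aG _ _ aV gG).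
    by exists x => //; rewrite -ME // /F xg iotaK_uniota ?aG // permKV gE.
  rewrite -ker0; apply/setP => x; rewrite !inE -ME // /F -iota1.
  have [uG uE] := uniotaP (in0 x).
  rewrite (inj_in_eq iotaI) ?aG ?group1 // a1 // -(inj_in_eq iotaI) ?group1 // uE iota1.
  by [].
rewrite inE => /andP[/eqP imphi /eqP kerphi].
have inphi x : phi *m x \in K by rewrite -imphi imset_f.
have eqker (x y : 'cV[A]_n) : (phi0 *m x == phi0 *m y) = (phi *m x == phi *m y).
  rewrite -subr_eq0 -mulmxBr -[RHS]subr_eq0 -mulmxBr.
  have := congr1 (fun S : {set 'cV[A]_n} => (x - y)%R \in S) (etrans ker0 (esym kerphi)).
  by rewrite /= !inE.
(* [X g] is a preimage of [iota g] under [phi0]; the automorphism is [phi] after the inverse of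
   [phi0], carried over to [G]. *)
pose X g := odflt 0 [pick x | phi0 *m x == iota g].
have XE g : g \in G -> phi0 *m X g = iota g.
  move=> gG; rewrite /X; case: pickP => [x /eqP //|noX].
  by have [x xg] := onto0 g gG; have := noX x; rewrite xg eqxx.
pose f g := uniota (phi *m X g).
have fM : {in G &, {morph f : x y / (x * y)%g}}.
  move=> g h gG hG; rewrite /f -uniotaD // -mulmxDr; congr uniota; apply/eqP.
  by rewrite -eqker mulmxDr !XE ?groupM // iotaM.
have fI : {in G &, injective f}.
  move=> g h gG hG /(uniota_inj (inphi _) (inphi _)) /eqP.
  by rewrite -eqker !XE // => /eqP; exact: iotaI.
pose fm := @Morphism _ _ G f fM.
have injf : ('injm fm)%g by apply/injmP.
have fG : (fm @* G)%g = G.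
  rewrite morphimEdom; apply/eqP; rewrite eqEcard card_in_imset // leqnn andbT.
  by apply/fintype.subsetP => _ /imsetP[g gG ->]; case: (uniotaP (inphi (X g))).
exists (aut injf fG); first exact: Aut_aut.
apply/matrixP => i j; rewrite [RHS]mxE.
suff -> : F (aut injf fG) (delta_mx j 0) = phi *m delta_mx j 0 by rewrite -colE mxE.
have [uG uE] := uniotaP (in0 (delta_mx j 0)).
rewrite /F autE //= /f; have [_ ->] := uniotaP (inphi (X (uniota (phi0 *m delta_mx j 0)))).
by apply/eqP; rewrite -eqker XE // uE.
Qed.


End IsoCount.

(** * Cokernels over the p-adic integers *)

Section CokernelProjection.
Variables (R : comNzRingType) (n c : nat) (M : 'M[R]_(n, c)).

Definition cok_proj (x : 'cV[R]_n) : cok M := (\pi_(Quotient.quot (colspan M)) x)%qT.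

Lemma cok_projD : {morph cok_proj : x y / x + y}.
Proof. by move=> x y; rewrite /cok_proj [LHS]Quotient.pi_add. Qed.

Lemma cok_proj_eq x y : cok_proj x = cok_proj y <-> exists z, x - y = M *m z.
Proof.
transitivity (x - y \in colspan M).
  by rewrite /cok_proj Quotient.idealrBE; split=> [->|/eqP].
by split=> /asboolP.
Qed.

Lemma cok_proj_surj (z : cok M) : exists x, cok_proj x = z.
Proof. by exists (generic_quotient.repr (z : Quotient.quot (colspan M))); exact: generic_quotient.reprK. Qed.

End CokernelProjection.

Section CokIsog.
Variables (p : nat) (gT : finGroupType) (G : {group gT}) (m r : nat).
Hypothesis p_prime : prime p.
Local Notation A := 'Z_(p ^ m.+1).
Variables (K : {set 'cV[A]_r}) (iota : gT -> 'cV[A]_r).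
Hypothesis addK : add_closed K.
Hypothesis pmK : {in K, forall v, (p ^ m)%:R *: v = 0}.
Hypothesis iotaM : {in G &, {morph iota : x y / (x * y)%g >-> x + y}}.
Hypothesis iotaI : {in G &, injective iota}.
Hypothesis iotaK : [set iota g | g in G] = K.
Variables (n c : nat) (M : 'M[padic p]_(n, c)).

Let red (a b : nat) (X : 'M[padic p]_(a, b)) : 'M[A]_(a, b) := map_mx (@resid p m) X.

Let redD a b : {morph (@red a b) : x y / x + y}. Proof. exact: map_mxD. Qed.
Let redM a b d (X : 'M[padic p]_(a, b)) (Y : 'M[padic p]_(b, d)) : red (X *m Y) = red X *m red Y.
Proof. exact: map_mxM. Qed.

(** Only a section of [red] as a map of sets: it is not additive. *)
Let lift (a b : nat) (X : 'M[A]_(a, b)) : 'M[padic p]_(a, b) :=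
  map_mx (fun z : A => (z : nat)%:R) X.

Let liftK a b (X : 'M[A]_(a, b)) : red (lift X) = X.
Proof. by apply/matrixP => i j; rewrite !mxE resid_natr natr_Zp. Qed.

Lemma red_eq0_divisible a b (X : 'M[padic p]_(a, b)) : map_mx (@resid p m) X = 0 ->
  exists Y, X = (p ^ m.+1)%:R *: Y.
Proof.
move=> /matrixP X0.
have ex i j : exists y, X i j = (p ^ m.+1)%:R * y.
  by apply: padic_divisible => //; have := X0 i j; rewrite !mxE.
pose Y : 'M[padic p]_(a, b) := \matrix_(i, j) xget 0 [set y | X i j = (p ^ m.+1)%:R * y]%classic.
exists Y; apply/matrixP => i j; rewrite !mxE; have [y Xy] := ex i j.
by case: xgetP => [z _ //|]; move=> /(_ y).
Qed.

(* [p ^ m I = M Y + p ^ (m + 1) Z] gives [p ^ m (I - p Z) = M Y], and [I - p Z]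
   is invertible because its determinant is 1 modulo [p]. *)
Lemma colspan_pow_of_red (Y : 'M[padic p]_(c, n)) (Z : 'M[padic p]_n) :
  (p ^ m)%:R *: 1%:M = M *m Y + (p ^ m.+1)%:R *: Z ->
  exists W : 'M[padic p]_(c, n), (p ^ m)%:R *: 1%:M = M *m W.
Proof.
move=> e; pose D := 1%:M - p%:R *: Z.
have MD : M *m Y = (p ^ m)%:R *: D.
  rewrite /D scalerBr e scalerA -natrM -expnSr; exact/esym/addrK.
have d1 : resid 0 (\det D) = 1.
  rewrite -det_map_mx /D map_mxB map_scalar_mx rmorph1 map_mxZ rmorph_nat.
  suff -> : p%:R = 0 :> 'Z_(p ^ 1) by rewrite scale0r subr0 det1.
  by apply/eqP; rewrite natr_Zpp_eq0 // expn1.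
have [d dD] := padic_invertible p_prime d1.
exists (d *: (Y *m \adj D)).
rewrite -scalemxAr mulmxA MD -scalemxAl mul_mx_adj scale_scalar_mx !scale_scalar_mx mulr1.
by rewrite mulrCA [d * _]mulrC dD mulr1.
Qed.

(** A homomorphism into [K] kills multiples of [p ^ (m + 1)], so it factors through the reduction.
    For the converse, a vector whose reduction is in the reduced column span must be shown to be in
    the p-adic one. *)
Lemma cok_isogP : cok_isog M G <-> exists phi, phi \in iso_maps K (mx_image (red M)).
Proof.
split=> [[f fM [fG fI fS]]|[phi]].
  pose h x := iota (f (cok_proj M x)).
  have fGin z : f z \in G by have := fG z I.
  have hK x : h x \in K by exact: (iota_in iotaK).
  have hD : {morph h : x y / x + y}.
    by move=> x y; rewrite /h cok_projD fM iotaM.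
  have h0 : h 0 = 0 by apply: (addrI (h 0)); rewrite -hD !addr0.
  have hn k x : h (k%:R *: x) = k%:R *: h x.
    rewrite !scaler_nat; elim: k => [|k IH]; first by rewrite !mulr0n.
    by rewrite !mulrS hD IH.
  have hred x y : red x = red y -> h x = h y.
    move=> xy; have : red (x - y) = 0 by rewrite /red map_mxB -!/(red _) xy subrr.
    move/red_eq0_divisible => [z e]; rewrite -(subrK y x) hD e hn.
    by rewrite pexp_scale_eq0 // add0r.
  have hliftD : {morph (fun x : 'cV[A]_n => h (lift x)) : x y / x + y}.
    by move=> x y; rewrite -hD; apply: hred; rewrite redD !liftK.
  have [phi phiE] := additive_matrix hliftD.
  have phih x : phi *m red x = h x by rewrite -phiE; apply: hred; rewrite liftK.
  have finj : forall z1 z2, f z1 = f z2 -> z1 = z2.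
    by move=> z1 z2; apply: fI; rewrite in_setE.
  exists phi; rewrite inE; apply/andP; split; apply/eqP/setP => v.
    apply/imsetP/idP => [[x _ ->]|]; first by rewrite -phiE.
    rewrite -iotaK => /imsetP[g gG ->]; have [z _ zg] := fS g gG.
    have [x xz] := cok_proj_surj z; exists (red x) => //.
    by rewrite phih /h xz zg.
  rewrite inE -(liftK v) phih; set x := lift v; rewrite -h0 /h.
  rewrite (inj_in_eq iotaI) //; apply/eqP/imsetP => [/finj /cok_proj_eq[z]|[y _]].
    by rewrite subr0 => ->; exists (red z) => //; rewrite redM.
  rewrite -(liftK y) -redM => /hred; rewrite /h => /iotaI -> //.
  by congr f; apply/cok_proj_eq; exists (lift y); rewrite subr0.
rewrite inE => /andP[/eqP imphi /eqP kerphi].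
have inphi x : phi *m x \in K by rewrite -imphi imset_f.
have phiM (z : 'cV[padic p]_c) : phi *m red (M *m z) = 0.
  have : red M *m red z \in mx_kernel phi by rewrite kerphi imset_f.
  by rewrite inE redM => /eqP.
pose sec (z : cok M) : 'cV[padic p]_n := xget 0 [set x | cok_proj M x = z]%classic.
have secP z : cok_proj M (sec z) = z.
  by rewrite /sec; have [x xz] := cok_proj_surj z; case: xgetP => [y _ //|/(_ x)].
have phi_proj x y : cok_proj M x = cok_proj M y -> phi *m red x = phi *m red y.
  move=> /cok_proj_eq[z e]; rewrite -(subrK y x) redD mulmxDr e phiM.
  exact: add0r.
exists (fun z => uniota G iota (phi *m red (sec z))).
  move=> z1 z2; rewrite -(uniotaD iotaM iotaI iotaK) // -mulmxDr -redD; congr uniota.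
  by apply: phi_proj; rewrite cok_projD !secP.
split.
- by move=> z _; case: (uniotaP iotaK (inphi (red (sec z)))).
- move=> z1 z2 _ _ /(uniota_inj iotaK (inphi _) (inphi _)) e.
  rewrite -(secP z1) -(secP z2); apply/cok_proj_eq; set x := sec z1 - sec z2.
  have kerK (y : 'cV[A]_n) : phi *m y = 0 -> exists w, y = red M *m w.
    move=> y0; have : y \in mx_kernel phi by rewrite inE y0.
    by rewrite kerphi => /imsetP[w _ ->]; exists w.
  have redx : phi *m red x = 0 by rewrite /x /red map_mxB mulmxBr -!/(red _) e subrr.
  have [w xw] := kerK _ redx.
  have [z1' xz] : exists z1', x - M *m lift w = (p ^ m.+1)%:R *: z1'.
    by apply: red_eq0_divisible; rewrite map_mxB -!/(red _) redM liftK xw subrr.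
  (* As [phi] kills multiples of [p ^ m], the reduced column span contains the columns of [p ^ m I];
     [colspan_pow_of_red] lifts this to the p-adic integers. *)
  have exY : exists Y, (p ^ m)%:R *: 1%:M = red M *m Y.
    have exy j : exists y : 'cV[A]_c, (p ^ m)%:R *: delta_mx j 0 = red M *m y.
      by apply: kerK; rewrite -scalemxAr; apply: pmK.
    have [Y hY] := fin_all_exists exy.
    exists (\matrix_(i, j) Y j i 0); apply/matrixP => i j.
    have := congr1 (fun v : 'cV_n => v i 0) (hY j); rewrite !mxE eqxx andbT => ->.
    by apply: eq_bigr => k _; congr (_ * _); rewrite mxE.
  have [Y hY] := exY.
  have [Z hZ] : exists Z, (p ^ m)%:R *: 1%:M - M *m lift Y = (p ^ m.+1)%:R *: Z.
    apply: red_eq0_divisible; rewrite map_mxB -!/(red _) redM liftK -hY.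
    by rewrite /red map_mxZ map_scalar_mx rmorph1 rmorph_nat subrr.
  have [W hW] : exists W, (p ^ m)%:R *: 1%:M = M *m W.
    by apply: (@colspan_pow_of_red (lift Y) Z); rewrite -hZ addrC subrK.
  exists (lift w + W *m (p%:R *: z1')).
  rewrite mulmxDr mulmxA -hW -(subrK (M *m lift w) x) xz addrC; congr (_ + _).
  by rewrite -scalemxAl mul1mx scalerA -natrM -expnSr.
move=> g gG; have := iota_in iotaK gG; rewrite -imphi => /imsetP[x _ gx].
exists (cok_proj M (lift x)) => //.
rewrite (@phi_proj _ (lift x)); last by rewrite secP.
by rewrite liftK -gx (iotaK_uniota iotaI iotaK).
Qed.

End CokIsog.

(** * Random residues *)

Section RandomResidues.
Variables (R : realType) (d : measure_display) (T : measurableType d) (P : probability T R).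

Definition prob (E : set T) : R := fine (P E).

Lemma probE E : measurable E -> P E = (prob E)%:E.
Proof. by move=> mE; rewrite /prob fineK // fin_num_measure. Qed.

Lemma prob_ge0 E : 0 <= prob E.
Proof. by rewrite /prob fine_ge0. Qed.

Section FiniteValued.
Variables (I : finType) (Z : T -> I).
Hypothesis mZ : forall x, measurable [set w | Z w = x]%classic.

Lemma measurable_finite_valued (S : pred I) : measurable [set w | S (Z w)]%classic.
Proof.
have -> : [set w | S (Z w)]%classic = (\bigcup_(x in [set x | S x]) [set w | Z w = x])%classic.
  by apply/seteqP; split=> [w Sw|w [x Sx /= ->] //]; exists (Z w).
apply: fin_bigcup_measurable => // ; exact: finite_finset.
Qed.

Lemma prob_finite_valued (S : pred I) :
  prob [set w | S (Z w)]%classic = \sum_(x | S x) prob [set w | Z w = x]%classic.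
Proof.
have key (s : seq I) : uniq s ->
    prob [set w | Z w \in s]%classic = \sum_(x <- s) prob [set w | Z w = x]%classic.
  elim: s => [|x s IH] /=.
    move=> _; rewrite big_nil /prob (_ : [set w | _]%classic = set0) ?measure0 //.
    by apply/seteqP; split.
  case/andP=> xs us; rewrite big_cons -IH //.
  have ms : measurable [set w | Z w \in s]%classic by exact: (measurable_finite_valued (mem s)).
  rewrite (_ : [set w | Z w \in x :: s]%classic =
     ([set w | Z w = x] `|` [set w | Z w \in s])%classic); last first.
    apply/seteqP; split=> w /=; rewrite inE; first by move=> /predU1P.
    by move=> ?; apply/predU1P.
  rewrite /prob measureU //; last first.
    by apply/seteqP; split=> // w [/= Zx]; rewrite Zx (negbTE xs).
  by rewrite fineD // fin_num_measure.
rewrite -big_filter -key ?filter_uniq ?index_enum_uniq //.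
congr prob; apply/seteqP; split=> w /=; rewrite mem_filter mem_index_enum andbT //.
Qed.

End FiniteValued.
End RandomResidues.

Section BalancedResidue.
Variables (p m : nat).
Hypothesis p_prime : prime p.
Local Notation A := 'Z_(p ^ m.+1).

(** Since a nonzero [c] kills [x - a], the latter is not a unit, and so [p] divides it. *)
Lemma Zpp_mul_eq_mod (c x a : A) : c != 0 -> c * x = c * a -> x = a %[mod p].
Proof.
move=> c0 /eqP; rewrite -subr_eq0 -mulrBr => /eqP cxa.
have : x - a \isn't a GRing.unit.
  by apply: contra c0 => u; rewrite -[c]mulr1 -(divrr u) mulrA cxa mul0r.
have P1 : (1 < p ^ m.+1)%N by rewrite -(exp1n m.+1) ltn_exp2r // prime_gt1.
rewrite -{1}(natr_Zp (x - a)) unitZpE // coprime_pexpl // prime_coprime // negbK => pd.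
have -> : x = ((a : nat) + (x - a)%R)%N%:R by rewrite natrD !natr_Zp addrC subrK.
by rewrite natr_Zpp_val // modn_dvdm ?dvdn_exp // -modnDmr (eqP pd) addn0.
Qed.

Variables (R : realType) (d : measure_display) (T : measurableType d) (P : probability T R).
Implicit Type xi : {RV P >-> padic p}.

Lemma measurable_residue xi k (a : 'Z_(p ^ k.+1)) :
  measurable [set w | resid k (xi w) = a]%classic.
Proof.
have mA : measurable [set x : padic p | residue x k = a]%classic.
  by apply: sub_sigma_algebra; exists k, a.
exact: (measurable_funPTI xi mA).
Qed.

Definition residue_law xi (a : A) : R := prob P [set w | resid m (xi w) = a]%classic.

Lemma is_pmf_residue_law xi : is_pmf (residue_law xi).
Proof.
split=> [a|]; first exact: prob_ge0.
rewrite -(prob_finite_valued P (fun a => @measurable_residue xi m a) predT).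
rewrite (_ : [set w | _]%classic = setT) /prob ?probability_setT //.
by apply/seteqP; split.
Qed.

Lemma spread_out_residue_law xi eps : balanced eps xi -> spread_out eps (residue_law xi).
Proof.
move=> bxi c a c0.
rewrite -(prob_finite_valued P (fun a => @measurable_residue xi m a) (fun b => c * b == c * a)).
rewrite -lee_fin -probE; last first.
  exact: (measurable_finite_valued (fun a => @measurable_residue xi m a) (fun b => c * b == c * a)).
apply: le_trans (bxi ((a : nat)%:R)).
apply: le_measure; rewrite ?inE.
- exact: (measurable_finite_valued (fun a => @measurable_residue xi m a) (fun b => c * b == c * a)).
- exact: (@measurable_residue xi 0).
(* The level 0 residue lives in ['Z_(p ^ 1)], and [balanced] speaks of ['Z_p]; representatives are
   compared. *)
move=> w /= /eqP cxa; apply: val_inj.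
transitivity ((a : nat) %% p ^ 1)%N; last by rewrite /= -(natr_Zpp_val p_prime 0).
apply: etrans (resid_val_mod p_prime (xi w) (leq0n m)) _; rewrite expn1.
exact: Zpp_mul_eq_mod c0 cxa.
Qed.

End BalancedResidue.

Section RandomMatrixLaw.
Variables (p m : nat).
Hypothesis p_prime : prime p.
Local Notation A := 'Z_(p ^ m.+1).
Variables (R : realType) (d : measure_display) (T : measurableType d) (P : probability T R).
Variables (n c k : nat) (alpha beta : nat -> nat) (eps : R).
Variable M : 'I_n -> 'I_c -> {RV P >-> padic p}.
Hypothesis balM : balanced_with_stairs eps k alpha beta M.

Definition residue_mx (w : T) : 'M[A]_(n, c) := \matrix_(i, j) resid m (M i j w).

Definition entry_law (i : 'I_n) (j : 'I_c) (a : A) : R := residue_law (M i j) a.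

Lemma residue_mx_eqE (X : 'M[A]_(n, c)) :
  [set w | residue_mx w = X]%classic =
  (\bigcap_(ij in [set: 'I_n * 'I_c]) [set w | resid m (M ij.1 ij.2 w) = X ij.1 ij.2])%classic.
Proof.
apply/seteqP; split=> w /= => [<- [i j] _|h]; first by rewrite mxE.
by apply/matrixP => i j; rewrite mxE; exact: (h (i, j)).
Qed.

Lemma measurable_residue_mx X : measurable [set w | residue_mx w = X]%classic.
Proof.
rewrite residue_mx_eqE; apply: fin_bigcap_measurable; first exact: finite_finset.
by move=> ij _; exact: measurable_residue.
Qed.

(** Independence is given off the stairs. A nonzero entry of [X] on the stairs makes both sides 0;
    otherwise the entries on the stairs contribute factors 1. *)
Lemma residue_mx_law X : prob P [set w | residue_mx w = X]%classic = mx_prob entry_law X.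
Proof.
case: balM => zeroM _ indM.
pose J := [set ij : 'I_n * 'I_c | ~~ in_stairs k alpha beta ij.1 ij.2].
rewrite /mx_prob exchange_big pair_big /=.
have [|] := boolP [forall ij : 'I_n * 'I_c, in_stairs k alpha beta ij.1 ij.2 ==> (X ij.1 ij.2 == 0)].
  move=> /forallP X0; rewrite (bigID (mem J)) /= [X in _ * X]big1 ?mulr1; last first.
    move=> [i j]; rewrite inE negbK /= => ij; rewrite /entry_law /residue_law.
    have := X0 (i, j); rewrite /= ij => /eqP ->.
    rewrite (_ : [set w | _]%classic = setT) /prob ?probability_setT //.
    by apply/seteqP; split=> // w _ /=; rewrite (zeroM _ _ ij) rmorph0.
  apply: EFin_inj; rewrite -probE; last exact: measurable_residue_mx.
  have JD : J \subset (fun ij : 'I_n * 'I_c => ~~ in_stairs k alpha beta ij.1 ij.2).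
    by apply/fintype.subsetP => ij; rewrite inE.
  have mA ij : measurable [set x : padic p | residue x m = X ij.1 ij.2]%classic.
    by apply: sub_sigma_algebra; exists m, (X ij.1 ij.2).
  rewrite -prodEFin; under [RHS]eq_bigr => ij _.
    rewrite -probE; last exact: measurable_residue.
    over.
  rewrite -[RHS](indM J _ JD mA); congr (P _).
  rewrite residue_mx_eqE; apply/seteqP; split=> w h [i j] /= ijJ; first exact: (h (i, j)).
  have [ij|ij] := boolP (in_stairs k alpha beta i j).
    by have := X0 (i, j); rewrite /= ij => /eqP ->; rewrite (zeroM _ _ ij) rmorph0.
  by apply: (h (i, j)); rewrite /= inE.
case/forallPn => -[i j]; rewrite negb_imply /= => /andP[ij Xij].
rewrite (bigD1 (i, j)) //= [entry_law i j _](_ : _ = 0) ?mul0r; last first.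
  rewrite /entry_law /residue_law /prob (_ : [set w | _]%classic = set0) ?measure0 //.
  by apply/seteqP; split=> // w /=; rewrite (zeroM _ _ ij) rmorph0 => X0; rewrite -X0 eqxx in Xij.
rewrite /prob (_ : [set w | _]%classic = set0) ?measure0 //.
apply/seteqP; split=> // w /= /matrixP/(_ i j).
by rewrite mxE (zeroM _ _ ij) rmorph0 => X0; rewrite -X0 eqxx in Xij.
Qed.

End RandomMatrixLaw.

Section CokernelProbability.
Variables (p : nat) (gT : finGroupType) (G : {group gT}) (m r : nat).
Hypothesis p_prime : prime p.
Local Notation A := 'Z_(p ^ m.+1).
Variables (K : {set 'cV[A]_r}) (iota : gT -> 'cV[A]_r).
Hypothesis pmK : {in K, forall v, (p ^ m)%:R *: v = 0}.
Hypothesis iotaM : {in G &, {morph iota : x y / (x * y)%g >-> x + y}}.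
Hypothesis iotaI : {in G &, injective iota}.
Hypothesis iotaK : [set iota g | g in G] = K.
Variables (R : realType) (d : measure_display) (T : measurableType d) (P : probability T R).
Variables (n c k : nat) (alpha beta : nat -> nat) (eps : R).
Variable M : 'I_n -> 'I_c -> {RV P >-> padic p}.
Hypothesis balM : balanced_with_stairs eps k alpha beta M.

Lemma iso_count_cok_isog (X : 'M[padic p]_(n, c)) :
  iso_count K (map_mx (@resid p m) X) = (#|Aut G| * `[< cok_isog X G >])%N.
Proof.
case: asboolP => [/(cok_isogP p_prime pmK iotaM iotaI iotaK)[phi hphi]|noiso].
  by rewrite muln1 -(card_iso_maps iotaM iotaI iotaK hphi).
rewrite muln0; apply: eq_card0 => phi; apply/negP => hphi; apply: noiso.
by apply/(cok_isogP p_prime pmK iotaM iotaI iotaK); exists phi.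
Qed.

(** The event is measurable because the residue matrix, which takes finitely many values, decides it
    through [iso_count]. *)
Lemma prob_cok_isog :
  P [set w | cok_isog (\matrix_(i < n, j < c) M i j w) G]%classic =
  (#|Aut G|%:R^-1 * \sum_X mx_prob (entry_law (m := m) M) X * (iso_count K X)%:R)%:E.
Proof.
pose S (X : 'M[A]_(n, c)) := (iso_count K X == #|Aut G|).
have Aut_gt0 : (0 < #|Aut G|)%N by exact: cardG_gt0.
have SE w : iso_count K (residue_mx m M w) =
    (#|Aut G| * `[< cok_isog (\matrix_(i < n, j < c) M i j w) G >])%N.
  rewrite -iso_count_cok_isog; congr (iso_count K _).
  by apply/matrixP => i j; rewrite !mxE.
have mZ := measurable_residue_mx (m := m) M.
rewrite (_ : [set w | _]%classic = [set w | S (residue_mx m M w)]%classic); last first.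
  apply/seteqP; split=> w /=; rewrite /S SE; first by move=> h; rewrite asboolT // muln1.
  by case: asboolP => // _; rewrite muln0 => /eqP G0; rewrite -G0 in Aut_gt0.
rewrite probE ?prob_finite_valued //; last exact: measurable_finite_valued.
congr EFin; rewrite mulr_sumr big_mkcond; apply: eq_bigr => X _.
have [empty|] := pselect ([set w | residue_mx m M w = X]%classic = set0).
  (* A matrix that is never attained is tied to no cokernel here, but its weight is 0. *)
  rewrite -(residue_mx_law balM) empty {2}/prob measure0 /= mul0r mulr0.
  by case: ifP => // _; rewrite /prob measure0.
move=> /eqP/set0P[w /= wX]; rewrite /S -{1 4}wX SE; case: asboolP => _.
  by rewrite muln1 eqxx mulrCA mulVf ?mulr1 ?(residue_mx_law balM) // pnatr_eq0 -lt0n.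
by rewrite muln0 !mulr0 eq_sym -leqn0 leqNgt Aut_gt0.
Qed.

End CokernelProbability.

(** * The limiting distribution *)

Local Open Scope classical_set_scope.
Local Open Scope ring_scope.

Lemma gap_near (R : realType) (k : nat) (alpha beta : nat -> nat -> nat) g :
  (forall i : nat, (1 <= i <= k)%N ->
     ((n%:R - (alpha n i)%:R - (beta n i)%:R : R) @[n --> \oo] --> +oo)) ->
  \forall n \near \oo, forall i, (1 <= i <= k)%N -> (alpha n i + beta n i + g <= n)%N.
Proof.
move=> gap.
have near_i (i : 'I_k.+1) : \forall n \near \oo,
    (1 <= i <= k)%N -> (alpha n i + beta n i + g <= n)%N.
  case: (boolP (1 <= i <= k)%N) => [ik|_]; last exact: nearW.
  have /cvgryPge/(_ g%:R) := gap i ik; apply: filterS => n h _.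
  rewrite -(ler_nat R) !natrD; move: h; lra.
apply: filterS (filter_forall _ near_i) => n h i ik.
have ik1 : (i < k.+1)%N by case/andP: ik.
exact: (h (Ordinal ik1) ik).
Qed.

Theorem theorem10p3 (R : realType) (p : nat) (eps : R) (t k : nat)
    (alpha beta : nat -> nat -> nat)
    (d : nat -> measure_display) (T : forall n : nat, measurableType (d n))
    (P : forall n : nat, probability (T n) R)
    (M : forall n : nat, 'I_n -> 'I_(n + t) -> {RV (P n) >-> padic p})
    (p_prime : prime p) (eps_bounds : 0 < eps < 1) (k_gt0 : (0 < k)%N)
    (steps : \forall n \near \oo, stair_steps k n (n + t) (alpha n) (beta n))
    (stairs : \forall n \near \oo,
       balanced_with_stairs eps k (alpha n) (beta n) (M n))
    (gap : forall i : nat, (1 <= i <= k)%N ->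
       ((n%:R - (alpha n i)%:R - (beta n i)%:R : R) @[n --> \oo] --> +oo))
    (gT : finGroupType) (G : {group gT})
    (G_abelian : abelian G) (G_pgroup : (p.-group G)%g) :
  P n [set w | cok_isog (\matrix_(i < n, j < n + t) M n i j w) G] @[n --> \oo]
    --> ((#|Aut G|%:R * #|G|%:R ^+ t)^-1 * euler_product R p t)%:E.
Proof.
have [r [K [iota [addK pmK iotaM iotaI iotaK]]]] := exists_embedding R p_prime G_abelian G_pgroup.
set m := logn p #|G| in K iota addK pmK iotaM iotaI iotaK.
have cardK : #|K| = #|G| by rewrite -iotaK card_in_imset.
have Aut_gt0 : 0 < #|Aut G|%:R :> R by rewrite ltr0n cardG_gt0.
apply: cvg_EFin.
  move: stairs; apply: filterS => n bal.
  by rewrite (prob_cok_isog p_prime pmK iotaM iotaI iotaK bal).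
apply/cvgrPdist_le => delta d0.
have dA : 0 < delta * #|Aut G|%:R by exact: mulr_gt0.
(* [2 ^ k] bounds the number of blocks, one for each set of steps. *)
have [g0 [n0 hmain]] := iso_count_expectation p_prime addK pmK t (2 ^ k) eps_bounds dA.
near=> n.
have bal : balanced_with_stairs eps k (alpha n) (beta n) (M n) by near: n.
have gapn : forall i, (1 <= i <= k)%N -> (alpha n i + beta n i + g0 <= n)%N.
  by near: n; exact: gap_near gap.
have n0n : (n0 <= n)%N by near: n; exact: nbhs_infty_ge.
rewrite /= (prob_cok_isog p_prime pmK iotaM iotaI iotaK bal) /=.
case: (bal) => _ freeM _.
have := hmain n g0 _ (entry_law (m := m) (M n)) n0n (leqnn g0)
  (stair_pattern_in_stairs t k_gt0 gapn) (fun i j => is_pmf_residue_law _ _).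
have spread (i : 'I_n) (j : 'I_(n + t)) :
    i \in [set i : 'I_n | ~~ in_stairs k (alpha n) (beta n) i j]%SET ->
    spread_out eps (entry_law (m := m) (M n) i j).
  by rewrite finset.inE => /freeM; exact: spread_out_residue_law.
move/(_ spread); rewrite cardK.
set Sum := \sum_X _ => close.
rewrite invfM -mulrA -mulrBr normrM gtr0_norm ?invr_gt0 // distrC.
by rewrite mulrC ler_pdivrMr.
Unshelve. all: by end_near.
Qed.
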